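(* For $p+q\ge4$ and every $m\ge0$ there is a vector space isomorphism $$HR^m(\mathfrak h_{p,q})\cong H^{m+3}_{\mathrm{Lie}}(\mathfrak{so}(p,q);\mathbf R)\oplus\big(H^{m+3-n}_{\mathrm{Lie}}(\mathfrak{so}(p,q);\mathbf R)\otimes\langle\gamma^*_{pq}\rangle\big),$$ where $H^{j}_{\mathrm{Lie}}=0$ for $j<0$.
   Context: Let $p,q$ be nonnegative integers, $n=p+q$. On $\mathbf R^n$ write $\partial_i=\partial/\partial x^i$; $\alpha_{ij}=x_i\partial_j-x_j\partial_i$ ($1\le i<j\le p$ or $p+1\le i<j\le n$), $\beta_{ij}=x_i\partial_j+x_j\partial_i$ ($1\le i\le p<j\le n$); their span is identified with $\mathfrak{so}(p,q)$; $\mathfrak h_{p,q}$ is the Lie algebra of vector fields with basis $\{\alpha_{ij}\}\cup\{\beta_{ij}\}\cup\{\partial_i\}$, and $\alpha_{ij}^*,\beta_{ij}^*,dx^i$ is the dual basis. For a Lie algebra $\mathfrak g$ over $\mathbf R$, identify $\mathrm{Hom}(\mathfrak g\otimes\wedge^{m+1}\mathfrak g,\mathbf R)$ with the Chevalley–Eilenberg cochains $C^{m+1}(\mathfrak g;\mathfrak g')$, $\mathfrak g'=\mathrm{Hom}(\mathfrak g,\mathbf R)$ the coadjoint module; the map $\pi_R^*:\mathrm{Hom}(\wedge^{m+2}\mathfrak g,\mathbf R)\to\mathrm{Hom}(\mathfrak g\otimes\wedge^{m+1}\mathfrak g,\mathbf R)$ induced by $g_1\otimes g_2\wedge\cdots\wedge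 g_{m+2}\mapsto g_1\wedge\cdots\wedge g_{m+2}$ is an injective cochain map, $CR^m(\mathfrak g)$ is its cokernel, and $HR^*(\mathfrak g)$ is the cohomology of the complex $CR^*(\mathfrak g)$. Here $\gamma^*_{pq}\in HR^{n-3}(\mathfrak h_{p,q})$ is the class (image under $H^{n-2}_{\mathrm{Lie}}(\mathfrak h_{p,q};\mathfrak h_{p,q}')\to HR^{n-3}(\mathfrak h_{p,q})$) of the cochain $$\gamma^*_{pq}=\sum_{1\le i<j\le p}(-1)^{i+j}\omega_{ij}\otimes\alpha^*_{ij}-\sum_{p+1\le i<j\le n}(-1)^{i+j+1}\omega_{ij}\otimes\alpha^*_{ij}-\sum_{1\le i\le p<j\le n}(-1)^{i+j+1}\omega_{ij}\otimes\beta^*_{ij},$$ $\omega_{ij}=dx^1\wedge\cdots\wedge\widehat{dx^i}\wedge\cdots\wedge\widehat{dx^j}\wedge\cdots\wedge dx^n$. *)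

(* Defs.v *)
From HB Require Import structures.
From mathcomp Require Import all_boot all_order all_algebra fingroup perm.
From mathcomp Require Import reals.

Set Implicit Arguments.
Unset Strict Implicit.
Unset Printing Implicit Defensive.

Import Order.TTheory GRing.Theory Num.Theory.
Local Open Scope ring_scope.

(* Chevalley--Eilenberg complex of a finite-dimensional Lie algebra g with   *)
(* basis (e_a)_{a : I} and structure constants [e_a, e_b] = sum_e c a b e e_e *)
(* with values in a finite-dimensional module M with basis (m_d)_{d : D} and *)
(* action e_a . m_d = sum_{d'} rho a d' d m_{d'}.                            *)
(* A k-cochain omega is recorded by its values on basis elements:            *)
(*   f (t, d) = d-th coordinate of omega(e_{t 0}, ..., e_{t (k-1)}).          *)
Section CE.
Variables (R : fieldType) (I D : finType).
Variable (c : I -> I -> I -> R) (rho : I -> D -> D -> R).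

Definition cochain (k : nat) := {ffun ({ffun 'I_k -> I} * D) -> R^o}.

Definition alt_defect k (f : cochain k) :
    {ffun ({perm 'I_k} * ({ffun 'I_k -> I} * D)) -> R^o} :=
  [ffun x : {perm 'I_k} * ({ffun 'I_k -> I} * D) =>
             f ([ffun r => x.2.1 (x.1 r)], x.2.2)
             - (-1) ^+ (odd_perm x.1) * f x.2].

Definition alt k : {vspace cochain k} := lker (linfun (@alt_defect k))%VS.

Definition rem1 k (t : {ffun 'I_k.+1 -> I}) (i : 'I_k.+1) : {ffun 'I_k -> I} :=
  [ffun r => t (lift i r)].

Definition rem2 k (t : {ffun 'I_k.+1 -> I}) (i j : 'I_k.+1) (e : I) :
    {ffun 'I_k -> I} :=
  [ffun r : 'I_k => if val r == 0%N then e
     else t (nth i [seq l <- enum 'I_k.+1 | (l != i) && (l != j)] (val r).-1)].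

(* (d omega)(x_0,..,x_k) = sum_i (-1)^i x_i . omega(.., x_i^, ..)
     + sum_{i<j} (-1)^(i+j) omega([x_i,x_j], .., x_i^, .., x_j^, ..) *)
Definition dfun k (f : cochain k) : cochain k.+1 :=
  [ffun x : {ffun 'I_k.+1 -> I} * D => let t := x.1 in let d' := x.2 in
    \sum_(i : 'I_k.+1) (-1) ^+ i *
        \sum_(d : D) rho (t i) d' d * f (rem1 t i, d)
  + \sum_(i : 'I_k.+1) \sum_(j : 'I_k.+1 | (i < j)%N) (-1) ^+ (i + j) *
        \sum_(e : I) c (t i) (t j) e * f (rem2 t i j e, d')].

Definition dCE k : 'Hom(cochain k, cochain k.+1) := linfun (@dfun k).

Definition cobnd k : {vspace cochain k} :=
  match k return {vspace cochain k} with
  | 0 => 0%VS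
  | k'.+1 => (dCE k' @: alt k')%VS
  end.

Definition Hdim k : nat := (\dim (lker (dCE k) :&: alt k)%VS - \dim (cobnd k))%N.

End CE.

(* Trivial coefficients R, and the coadjoint module g' = Hom(g, R) with     *)
(* basis the dual basis e^*_b : (e_a . f)(e_b) = - f([e_a, e_b]).           *)
Definition rho_triv (R : fieldType) (I : finType) : I -> unit -> unit -> R :=
  fun _ _ _ => 0.
Definition rho_coad (R : fieldType) (I : finType) (c : I -> I -> I -> R) :
  I -> I -> I -> R := fun a b e => - c a b e.

Definition betti (R : fieldType) (I : finType) (c : I -> I -> I -> R)
  (j : int) : nat :=
  match j with
  | Posz k => Hdim c (@rho_triv R I) k
  | Negz _ => 0%N
  end.

Section HR.
Variables (R : fieldType) (I : finType) (c : I -> I -> I -> R).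

Notation Ctriv k := (cochain R I unit k).
Notation Ccoad k := (cochain R I I k).

(* pi_R^* : Hom(wedge^{k+1} g, R) -> Hom(g (x) wedge^k g, R) = C^k(g; g') *)
Definition pistar_fun k (f : Ctriv k.+1) : Ccoad k :=
  [ffun x : {ffun 'I_k -> I} * I => f ([ffun r : 'I_k.+1 => if unlift ord0 r is Some r' then x.1 r'
                                     else x.2], tt)].
Definition pistar k : 'Hom(Ctriv k.+1, Ccoad k) := linfun (@pistar_fun k).

Definition Pim k : {vspace Ccoad k} := (pistar k @: @alt R I unit k.+1)%VS.

Definition dco k := dCE c (rho_coad c) k.

(* CR^m = C^{m+1}(g;g') / Pim (m+1); its cocycles and coboundaries, pulled  *)
(* back to C^{m+1}(g;g')                                                     *)
Definition CRcyc m : {vspace Ccoad m.+1} :=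
  ((dco m.+1 @^-1: Pim m.+2) :&: @alt R I I m.+1)%VS.
Definition CRbnd m : {vspace Ccoad m.+1} := ((dco m @: @alt R I I m) + Pim m.+1)%VS.

Definition HRdim m : nat := (\dim (CRcyc m) - \dim (CRbnd m))%N.

Definition HRclass_span_dim m (w : Ccoad m.+1) : nat :=
  (\dim (<[w]> + CRbnd m)%VS - \dim (CRbnd m))%N.

End HR.

(* The Lie algebra h_{p,q}.  Coordinates x^1..x^n are indexed 0..n-1.      *)
(* An affine vector field sum_i (A x + v)_i d_i is represented by (A, v);   *)
(* the vector-field bracket [X, Y] = XY - YX then reads                     *)
(*   [(A, v), (B, w)] = (B A - A B, B v - A w).                             *)
(* Basis: for i < j, alpha_ij = x_i d_j - x_j d_i if i, j are in the same   *)
(* block ({0..p-1} or {p..n-1}), beta_ij = x_i d_j + x_j d_i otherwise;     *)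
(* and d_i.                                                                 *)
Definition pairT (n : nat) := {pr : 'I_n * 'I_n | (pr.1 < pr.2)%N}.
Definition basisH (n : nat) := (pairT n + 'I_n)%type.

Section Hpq.
Variables (R : realType) (p q : nat).
Local Notation n := (p + q)%N.

Definition sameblock (pr : pairT n) : bool :=
  ((val pr).1 < p)%N == ((val pr).2 < p)%N.

Definition affVF := ('M[R]_n * 'cV[R]_n)%type.

Definition vf_bracket (X Y : affVF) : affVF :=
  (Y.1 *m X.1 - X.1 *m Y.1, Y.1 *m X.2 - X.1 *m Y.2).

Definition hbasis (b : basisH n) : affVF :=
  match b with
  | inl pr => (delta_mx (val pr).2 (val pr).1
               + (if sameblock pr then -1 else 1) *: delta_mx (val pr).1 (val pr).2,
               0)
  | inr i => (0, delta_mx i ord0)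
  end.

(* coordinates w.r.t. the basis (valid on h_{p,q}) *)
Definition hcoord (X : affVF) (b : basisH n) : R :=
  match b with
  | inl pr => X.1 (val pr).2 (val pr).1
  | inr i => X.2 i ord0
  end.

Definition c_h (a b e : basisH n) : R := hcoord (vf_bracket (hbasis a) (hbasis b)) e.

Definition c_so (a b e : pairT n) : R := c_h (inl a) (inl b) (inl e).

(* omega_ij = dx^1 /\ .. dx^i^ .. dx^j^ .. /\ dx^n evaluated on basis vectors *)
(* (here as a k-form, used with k = n - 2):                                 *)
(*   omega(y_1..y_k) = det [ dx^{a_r}(y_s) ]_{r,s}                           *)
Definition omega k (pr : pairT n) (t : {ffun 'I_k -> basisH n}) : R :=
  \det (\matrix_(r < k, s < k)
     (if t s == inr (nth (val pr).1
           [seq l <- enum 'I_n | (l != (val pr).1) && (l != (val pr).2)] r)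
      then 1 else 0)).

(* the coefficient of omega_ij (x) alpha*_ij / beta*_ij in gamma*_pq;       *)
(* 0-indexed i, j have the same parity of i + j as the 1-indexed ones       *)
Definition gamma_coef (pr : pairT n) : R :=
  let i := val (val pr).1 in let j := val (val pr).2 in
  if ((i < p) && (j < p))%N then (-1) ^+ (i + j)
  else if ((p <= i) && (p <= j))%N then - (-1) ^+ (i + j).+1
  else - (-1) ^+ (i + j).+1.

(* gamma*_pq as an element of C^{n-2}(h; h') = Hom(h (x) wedge^{n-2} h, R):*)
(* gamma(t, b) = gamma*(e_b (x) e_{t 0} /\ ... )                            *)
Definition gamma_star : cochain R (basisH n) (basisH n) (n - 3).+1 :=
  [ffun x : {ffun 'I_(n - 3).+1 -> basisH n} * basisH n => \sum_(pr : pairT n)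
     gamma_coef pr * (if x.2 == inl pr then 1 else 0) * omega pr x.1].

End Hpq.

(* Main.v *)
(* A cochain is encoded by its values on increasing tuples of basis vectors, so
   that the exterior algebra becomes a Fock space with creation and annihilation
   operators, and the differential is a polynomial in these.  The structure
   constants of h_{p,q} differ from those of h_{0,n} = so(n) |x R^n only by the
   cocycle of a Z/2-grading, and multiplying cochains by suitable signs turns one
   complex into the other; hence only the compact form matters.

   Contraction against the action of so(n) is a homotopy between the Casimir
   operator and 0.  The action is skew-symmetric for the standard inner product,
   so the Casimir operator is diagonalisable with the invariants as kernel, and
   every relative class of the complex has a representative that is invariant for
   the action of so(n) on the dx^i and on the coefficients.  By classical
   invariant theory in degree one and two, the invariants form four copies of the
   cochains of so(n).  The metric family cancels against the wedge family, the
   family contracting the volume form is absorbed by pi_R^*, and the gamma family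
   gives H^{m+3-n}(so).  The cochains with neither a dx^i nor an R^n
   coefficient give, modulo pi_R^*, H^{m+3}(so).

   The line spanned by gamma*_pq in HR is nonzero, as evaluation on commuting
   vectors shows. *)
Require Import Defs.
From HB Require Import structures.
From mathcomp Require Import all_boot all_order all_algebra fingroup perm.
From mathcomp Require Import reals ring lra zify.

Set Implicit Arguments.
Unset Strict Implicit.
Unset Printing Implicit Defensive.

Import Order.TTheory GRing.Theory Num.Theory.
Local Open Scope ring_scope.

(** Let V be the span of the translations. The action of so(n) leaves the legs dual to so(n) alone,
    so that the complex is that of so(n) with values in the module of V'-forms with coefficients in
    h', plus a translation term that is equivariant. The Casimir homotopy is the one for this
    module.

    Cohomology of a cokernel asks about x with dx in the image of pi_R^*, and the homotopy does not
    preserve that image. It is therefore enlarged to [VB], a sum of two subcomplexes that is stable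
    under the homotopy and contains all invariants. The two summands meet trivially, so an equation
    in [VB] splits into one equation in each.

    This works in positive weight only, the weight being the number of the dx^i plus one for a
    coefficient in V'; the differential preserves it. Weight 0 is the complex of so(n) with values
    in so(n)', which is acyclic. Hence if dx is the image of y, the weight-0 part of y is an
    so(n)-cocycle, two degrees above x, and every cocycle of that degree occurs. This connecting map
    is the source of H^{m+3}(so). *)

Fact ce_key : unit. Proof. exact: tt. Qed.

(** * Chevalley-Eilenberg differentials from creation and annihilation operators *)

Section AbstractCE.
Variables (R : numFieldType) (U : lmodType R) (P : finType) (c : P -> P -> P -> R).
Variables (C N A : P -> {linear U -> U}).
Hypothesis NC : forall a b f, N a (C b f) = (a == b)%:R *: f - C b (N a f).
Hypothesis NN : forall a b f, N a (N b f) = - N b (N a f).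
Hypothesis NA : forall a b f, N a (A b f) = A b (N a f).
Hypothesis CA : forall a b f, C a (A b f) = A b (C a f).
Hypothesis c_anti : forall a b e, c a b e = - c b a e.

(** Minus the derivation extending the coadjoint action of [e_a] to the exterior factor, so that
    [A a - ad_leg a] is the Lie derivative along [e_a]. *)
Definition ad_leg a : U -> U :=
  locked_with ce_key (fun f => \sum_b \sum_e c a b e *: C b (N e f)).
(** The bracket term meets every pair of arguments in both orders, whence [2^-1]. *)
Definition ce_diff : U -> U :=
  locked_with ce_key (fun f => \sum_a C a (A a f - 2^-1 *: ad_leg a f)).
Lemma ad_legE a f : ad_leg a f = \sum_b \sum_e c a b e *: C b (N e f).
Proof. by rewrite /ad_leg unlock. Qed.
Lemma ce_diffE f : ce_diff f = \sum_a C a (A a f - 2^-1 *: ad_leg a f).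
Proof. by rewrite /ce_diff unlock. Qed.

Lemma ad_leg_is_linear a : linear (ad_leg a).
Proof.
move=> k f g; rewrite !ad_legE scaler_sumr -big_split /=; apply: eq_bigr => b _.
rewrite scaler_sumr -big_split /=; apply: eq_bigr => e _.
by rewrite !(linearD, linearZ) /= !scalerA mulrC.
Qed.
HB.instance Definition _ a := GRing.isLinear.Build R U U _ (ad_leg a) (ad_leg_is_linear a).

Lemma ce_diff_is_linear : linear ce_diff.
Proof.
move=> k f g; rewrite !ce_diffE scaler_sumr -big_split /=; apply: eq_bigr => a _.
rewrite -linearP /=; congr (C a _); rewrite !(linearD, linearZ) /= scalerBr !scalerA.
by rewrite !scalerN addrACA.
Qed.
HB.instance Definition _ := GRing.isLinear.Build R U U _ ce_diff ce_diff_is_linear.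

Lemma sum_delta (V : lmodType R) (J : finType) (x : J) (F : J -> V) :
  \sum_b (x == b)%:R *: F b = F x.
Proof.
rewrite (bigD1 x) //= eqxx scale1r big1 ?addr0 // => b /negPf.
by rewrite eq_sym => ->; rewrite scale0r.
Qed.

Lemma N_ad_leg x a f :
  N x (ad_leg a f) = ad_leg a (N x f) + \sum_e c a x e *: N e f.
Proof.
rewrite !ad_legE linear_sum /=.
rewrite -(sum_delta x (fun b => \sum_e c a b e *: N e f)) -big_split /=.
apply: eq_bigr => b _; rewrite linear_sum scaler_sumr -big_split /=.
apply: eq_bigr => e _; rewrite linearZ /= NC NN linearN opprK scalerDr addrC.
by rewrite !scalerA mulrC.
Qed.

(** Half of [ad_leg x] comes from moving [N x] past [C], the other half, by antisymmetry of [c],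
    from moving it past [ad_leg]. *)
Lemma cartan x f :
  N x (ce_diff f) = A x f - ad_leg x f - ce_diff (N x f).
Proof.
rewrite [ce_diff f]ce_diffE linear_sum /=.
under eq_bigr do rewrite NC.
rewrite sumrB sum_delta.
have -> : \sum_b C b (N x (A b f - 2^-1 *: ad_leg b f)) =
  ce_diff (N x f) + 2^-1 *: ad_leg x f.
  have -> : ad_leg x f = - \sum_a \sum_e c a x e *: C a (N e f).
    rewrite !ad_legE -sumrN; apply: eq_bigr => a _; rewrite -sumrN.
    by apply: eq_bigr => e _; rewrite -scaleNr c_anti.
  rewrite ce_diffE scalerN scaler_sumr -sumrB; apply: eq_bigr => b _.
  rewrite raddfB /= NA linearZ /= N_ad_leg scalerDr !linearB /= linearD /= opprD addrA.
  congr (_ - _); rewrite linearZ linear_sum /=; congr (_ *: _).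
  by apply: eq_bigr => e _; rewrite linearZ.
rewrite opprD addrA addrAC; congr (_ - _).
rewrite -addrA -opprD -scalerDl; congr (_ - _).
by rewrite (_ : 2^-1 + 2^-1 = 1) ?scale1r // [RHS]splitr mul1r.
Qed.

Section Casimir.
Hypothesis c_cyc : forall a b e, c a b e = - c e b a.
Hypothesis AA : forall a b f, A a (A b f) = A b (A a f) + \sum_e c a b e *: A e f.

(** By [c_anti] and [c_cyc] the structure constants are totally antisymmetric: the basis is
    orthonormal for an invariant form, and this is the Casimir operator of that form. *)
Definition casimir f := \sum_a A a (A a f).
Definition homot f := \sum_a N a (A a f).

Lemma A_ad_leg a b f : A a (ad_leg b f) = ad_leg b (A a f).
Proof.
rewrite !ad_legE linear_sum; apply: eq_bigr => x _; rewrite linear_sum.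
by apply: eq_bigr => e _; rewrite linearZ /= NA CA.
Qed.

Lemma A_ce_diff a f :
  A a (ce_diff f) = ce_diff (A a f) + \sum_b \sum_e c a b e *: C b (A e f).
Proof.
rewrite !ce_diffE linear_sum -big_split; apply: eq_bigr => b _ /=.
rewrite -CA linearB /= (AA a b) linearZ /= A_ad_leg.
rewrite addrAC linearD /=; congr (_ + _).
by rewrite linear_sum; apply: eq_bigr => e _; rewrite linearZ.
Qed.

(** Cartan's formula produces the Casimir operator and an [ad_leg] term; the commutator of [A a]
    with the differential produces another sum of the same shape. The two cancel by total
    antisymmetry of [c]. *)
Lemma homotP f : ce_diff (homot f) + homot (ce_diff f) = casimir f.
Proof.
rewrite /homot linear_sum -big_split /=.
have E a : ce_diff (N a (A a f)) + N a (A a (ce_diff f)) =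
   A a (A a f) - ad_leg a (A a f) + N a (\sum_b \sum_e c a b e *: C b (A e f)).
  rewrite A_ce_diff linearD /= cartan addrA; congr (_ + _).
  by rewrite addrC subrK.
under eq_bigr do rewrite E.
rewrite big_split sumrB /= -addrA -[RHS]addr0; congr (_ + _).
apply/eqP; rewrite addrC subr_eq0; apply/eqP.
have -> : \sum_i ad_leg i (A i f) = - \sum_e \sum_b \sum_a c e b a *: C b (N e (A a f)).
  under eq_bigr do rewrite ad_legE.
  rewrite exchange_big /= [in RHS]exchange_big -sumrN; apply: eq_bigr => b _ /=.
  rewrite exchange_big -sumrN; apply: eq_bigr => e _; rewrite -sumrN.
  by apply: eq_bigr => a _; rewrite -scaleNr -c_cyc.
rewrite -sumrN; apply: eq_bigr => e _.
rewrite linear_sum -sumrN; apply: eq_bigr => b _; rewrite linear_sum -sumrN.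
apply: eq_bigr => a _; rewrite linearZ /= NC scalerBr scalerA.
case: eqP => [<-|_]; last by rewrite mulr0 scale0r add0r.
suff -> : c e e a = 0 by rewrite mul0r !scale0r oppr0 addr0.
by apply/eqP; rewrite -eqNr; apply/eqP; rewrite -c_anti.
Qed.
End Casimir.
End AbstractCE.

(** * The Fock space of cochains *)

Section Pointwise.
Variables (R : numFieldType) (X : finType).
Implicit Types (f g : {ffun X -> R^o}).
Lemma fockD f g x : (f + g) x = f x + g x. Proof. exact: ffunE. Qed.
Lemma fockN f x : (- f) x = - f x. Proof. exact: ffunE. Qed.
Lemma fockZ (k : R) f x : (k *: f) x = k * f x. Proof. exact: ffunE. Qed.
Lemma fock0 x : (0 : {ffun X -> R^o}) x = 0. Proof. exact: ffunE. Qed.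
Definition fockE := (fockD, fockN, fockZ, fock0).
End Pointwise.

Section Fock.
Variables (R : numFieldType) (I D : finType) (rk : I -> nat).
Hypothesis rk_inj : injective rk.
Local Notation W := {ffun {set I} * D -> R^o}.
Implicit Types (f g : W) (a b : I) (S : {set I}).

(* [S] stands for the increasing tuple of its elements in the order given by
   [rk]; [cr a] is the exterior product with the dual of [e_a], [an a] the
   contraction by [e_a], and [sg] their sign. *)
Definition sg a S : R := (-1) ^+ #|[set b in S | (rk b < rk a)%N]|.

Lemma sg_sq a S : sg a S * sg a S = 1.
Proof. by rewrite -expr2 sqrr_sign. Qed.

Lemma sgU a b S : b \notin S -> sg a (b |: S) = (-1) ^+ (rk b < rk a)%N * sg a S.
Proof.
move=> bS; rewrite /sg -exprD; congr (_ ^+ _).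
have [lt|ge] := boolP (rk b < rk a)%N.
  rewrite (_ : [set _ in _ | _] = b |: [set x in S | (rk x < rk a)%N]).
    by rewrite cardsU1 inE (negPf bS).
  by apply/setP=> x; rewrite !inE; case: eqP => [->|] //=; rewrite lt.
rewrite add0n; apply: eq_card => x; rewrite !inE; case: eqP => [->|] //=.
by rewrite (negPf ge) (negPf bS).
Qed.

Lemma sgD a b S : b \in S -> sg a (S :\ b) = (-1) ^+ (rk b < rk a)%N * sg a S.
Proof.
move=> bS; rewrite -[in RHS](setD1K bS) sgU ?setD11 // mulrA -signr_addb addbb.
by rewrite mul1r.
Qed.

Lemma sgDid a S : sg a (S :\ a) = sg a S.
Proof.
by rewrite /sg; congr (_ ^+ _); apply: eq_card => x; rewrite !inE; case: eqP => [->|] //=; rewrite ltnn andbF.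
Qed.

Lemma sgUid a S : sg a (a |: S) = sg a S.
Proof.
by rewrite /sg; congr (_ ^+ _); apply: eq_card => x; rewrite !inE; case: eqP => [->|] //=; rewrite ltnn andbF.
Qed.

Lemma rk_swap a b : a != b -> (rk a < rk b)%N = ~~ (rk b < rk a)%N.
Proof. by move=> ab; rewrite -leqNgt ltn_neqAle (inj_eq rk_inj) ab. Qed.

Definition cr a f : W :=
  [ffun x : {set I} * D => if a \in x.1 then sg a x.1 * f (x.1 :\ a, x.2) else 0].
Definition an a f : W :=
  [ffun x : {set I} * D => if a \in x.1 then 0 else sg a x.1 * f (a |: x.1, x.2)].
Definition cf (r : D -> D -> R) f : W := [ffun x : {set I} * D => \sum_d r x.2 d * f (x.1, d)].

Lemma cr_is_linear a : linear (cr a).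
Proof.
move=> k f g; apply/ffunP => x; rewrite !ffunE; case: ifP => _.
  by rewrite mulrDr /GRing.scale /= mulrCA.
by rewrite scaler0 addr0.
Qed.
HB.instance Definition _ a := GRing.isLinear.Build R W W _ (cr a) (cr_is_linear a).

Lemma an_is_linear a : linear (an a).
Proof.
move=> k f g; apply/ffunP => x; rewrite !ffunE; case: ifP => _.
  by rewrite scaler0 addr0.
by rewrite mulrDr /GRing.scale /= mulrCA.
Qed.
HB.instance Definition _ a := GRing.isLinear.Build R W W _ (an a) (an_is_linear a).

Lemma cf_is_linear r : linear (cf r).
Proof.
move=> k f g; apply/ffunP => x; rewrite !ffunE scaler_sumr -big_split.
by apply: eq_bigr => d _; rewrite !ffunE mulrDr /GRing.scale /= mulrCA.
Qed.
HB.instance Definition _ r := GRing.isLinear.Build R W W _ (cf r) (cf_is_linear r).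

Lemma an_cr a b f : an a (cr b f) = (a == b)%:R *: f - cr b (an a f).
Proof.
apply/ffunP => [[S d]]; rewrite !ffunE /=; case: (eqVneq a b) => [<-|ab].
  rewrite /GRing.scale /= mul1r !inE eqxx /=; case: (boolP (a \in S)) => aS.
    by rewrite sgDid mulrA sg_sq mul1r setD1K // subrr.
  by rewrite subr0 sgUid mulrA sg_sq mul1r setU1K.
rewrite /GRing.scale /= mul0r add0r !inE eq_sym (negPf ab) /=.
case: (boolP (a \in S)) => aS; case: (boolP (b \in S)) => bS; rewrite ?mulr0 ?oppr0 //.
have -> : (a |: S) :\ b = a |: (S :\ b).
  by apply/setP=> x; rewrite !inE; case: (eqVneq x a) => [->|]; rewrite ?ab.
rewrite sgU // sgD // (rk_swap ab) signrN.
ring.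
Qed.

Lemma cr_sq a f : cr a (cr a f) = 0.
Proof. by apply/ffunP => [[S d]]; rewrite !ffunE /= !inE eqxx /= mulr0 if_same. Qed.

Lemma an_sq a f : an a (an a f) = 0.
Proof. by apply/ffunP => [[S d]]; rewrite !ffunE /= !inE eqxx /= mulr0 if_same. Qed.

Lemma cr_cr a b f : cr a (cr b f) = - cr b (cr a f).
Proof.
have [<-|ab] := eqVneq a b; first by rewrite cr_sq oppr0.
apply/ffunP => [[S d]]; rewrite !ffunE /= !inE eq_sym (negPf ab) /=.
case: (boolP (a \in S)) => aS; case: (boolP (b \in S)) => bS; rewrite ?mulr0 ?oppr0 //.
rewrite !sgD // (rk_swap ab) signrN setDDl setUC -setDDl.
ring.
Qed.

Lemma an_an a b f : an a (an b f) = - an b (an a f).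
Proof.
have [<-|ab] := eqVneq a b; first by rewrite an_sq oppr0.
apply/ffunP => [[S d]]; rewrite !ffunE /= !inE eq_sym (negPf ab) /=.
case: (boolP (a \in S)) => aS; case: (boolP (b \in S)) => bS; rewrite ?mulr0 ?oppr0 //.
rewrite !sgU // (rk_swap ab) signrN setUCA.
ring.
Qed.

Lemma an_cf a r f : an a (cf r f) = cf r (an a f).
Proof.
apply/ffunP => [[S d]]; rewrite !ffunE /=; under [RHS]eq_bigr do rewrite ffunE /=.
case: ifP => _; first by rewrite big1 // => i _; rewrite mulr0.
by rewrite mulr_sumr; apply: eq_bigr => i _; rewrite mulrCA.
Qed.

Lemma cr_cf a r f : cr a (cf r f) = cf r (cr a f).
Proof.
apply/ffunP => [[S d]]; rewrite !ffunE /=; under [RHS]eq_bigr do rewrite ffunE /=.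
case: ifP => _; last by rewrite big1 // => i _; rewrite mulr0.
by rewrite mulr_sumr; apply: eq_bigr => i _; rewrite mulrCA.
Qed.

Lemma cf_cf r r' f : cf r (cf r' f) = cf (fun d d' => \sum_e r d e * r' e d') f.
Proof.
apply/ffunP => [[S d]]; rewrite !ffunE /=; under eq_bigr do rewrite ffunE /= mulr_sumr.
rewrite exchange_big /=; apply: eq_bigr => d' _; rewrite mulr_suml.
by apply: eq_bigr => e _; rewrite mulrA.
Qed.

Definition dot f g : R := \sum_x f x * g x.

(** The involution that toggles [a] in the set matches the nonzero terms of both sides. *)
Lemma dot_cr a f g : dot (cr a f) g = dot f (an a g).
Proof.
pose h (x : {set I} * D) := (if a \in x.1 then x.1 :\ a else a |: x.1, x.2).
have hK : involutive h.
  move=> [S d]; rewrite /h /=; case: (boolP (a \in S)) => aS.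
    by rewrite !inE eqxx /= setD1K.
  by rewrite !inE eqxx /= setU1K.
rewrite /dot (reindex_inj (inv_inj hK)); apply: eq_bigr => [[S d]] _.
rewrite !ffunE /h /=; case: (boolP (a \in S)) => aS; rewrite !inE eqxx /=.
  by rewrite mul0r mulr0.
by rewrite setU1K // sgUid mulrA [_ * f _]mulrC.
Qed.

Lemma dotC f g : dot f g = dot g f.
Proof. by apply: eq_bigr => x _; rewrite mulrC. Qed.

Lemma dotZl k f g : dot (k *: f) g = k * dot f g.
Proof. by rewrite mulr_sumr; apply: eq_bigr => x _; rewrite ffunE mulrA. Qed.

Lemma dotDl f f' g : dot (f + f') g = dot f g + dot f' g.
Proof. by rewrite -big_split; apply: eq_bigr => x _; rewrite ffunE mulrDl. Qed.

Lemma dotNl f g : dot (- f) g = - dot f g.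
Proof. by rewrite -scaleN1r dotZl mulN1r. Qed.

Lemma dot_suml (J : finType) (F : J -> W) g : dot (\sum_j F j) g = \sum_j dot (F j) g.
Proof.
apply: (big_morph (fun f => dot f g) (fun f f' => dotDl f f' g)).
by rewrite /dot big1 // => x _; rewrite ffunE mul0r.
Qed.

Lemma dot_cf r f g : dot (cf r f) g = dot f (cf (fun d d' => r d' d) g).
Proof.
have dotE u v : dot u v = \sum_S \sum_d u (S, d) * v (S, d).
  by rewrite pair_bigA; apply: eq_bigr => [[]].
rewrite !dotE; apply: eq_bigr => S _.
under eq_bigr do rewrite ffunE /= mulr_suml.
rewrite exchange_big; apply: eq_bigr => d _; rewrite ffunE /= mulr_sumr.
by apply: eq_bigr => e _; rewrite mulrA [f _ * _]mulrC.
Qed.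

(** The value of [T f] at [S] is, up to sign, that of a contraction at a smaller set, so induction
    on the size of [S] ends in degree 0. Operator identities below are proved by applying this to
    the difference of their two sides. *)
Lemma an_inj_op (T : W -> W) (eps : R) :
  (forall b f, an b (T f) = eps *: T (an b f)) ->
  (forall f d, T f (set0, d) = 0) -> forall f, T f = 0.
Proof.
move=> Tan T0 f; apply/ffunP => [[S d]]; rewrite [RHS]ffunE.
elim: {S}_.+1 {-2}S (ltnSn #|S|) f => // n IHn S; rewrite ltnS => leSn f.
have [->|[a aS]] := set_0Vmem S; first exact: T0.
have /ffunP /(_ (S :\ a, d)) := Tan a f; rewrite !ffunE /= !inE eqxx /= setD1K //.
rewrite [T (an a f) _]IHn; last by move: leSn; rewrite (cardsD1 a) aS add1n.
by rewrite scaler0 => /eqP; rewrite mulf_eq0 signr_eq0 /= => /eqP.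
Qed.

End Fock.

(** * Derivations of the exterior algebra and Lie derivatives *)

Section LieCochains.
Variables (R : numFieldType) (I D : finType) (rk : I -> nat).
Hypothesis rk_inj : injective rk.
Local Notation W := {ffun {set I} * D -> R^o}.
Local Notation an := (an rk).
Local Notation cr := (cr rk).

(** The second quantization of [m]: the derivation of the exterior algebra that extends it. *)
Definition quad (m : I -> I -> R) : W -> W :=
  locked_with ce_key (fun f => \sum_b \sum_e m b e *: cr b (an e f)).
Lemma quadE m f : quad m f = \sum_b \sum_e m b e *: cr b (an e f).
Proof. by rewrite /quad unlock. Qed.

Lemma quad_is_linear m : linear (quad m).
Proof.
move=> k f g; rewrite !quadE scaler_sumr -big_split /=; apply: eq_bigr => b _.
rewrite scaler_sumr -big_split /=; apply: eq_bigr => e _.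
by rewrite !(linearD, linearZ) /= !scalerA mulrC.
Qed.
HB.instance Definition _ m := GRing.isLinear.Build R W W _ (quad m) (quad_is_linear m).

(** The matrices are arbitrary because two cases occur: the full Lie derivative, and the action of
    so(n) on coefficients and vector legs only. *)
Definition lieop (r : D -> D -> R) (m : I -> I -> R) : W -> W :=
  locked_with ce_key (fun f => cf r f - quad m f).
Lemma lieopE r m f : lieop r m f = cf r f - quad m f.
Proof. by rewrite /lieop unlock. Qed.

Lemma lieop_is_linear r m : linear (lieop r m).
Proof.
by move=> k f g; rewrite !lieopE !linearP /= scalerDr addrACA.
Qed.
HB.instance Definition _ r m := GRing.isLinear.Build R W W _ (lieop r m) (lieop_is_linear r m).

Lemma an_quad y m f : an y (quad m f) = quad m (an y f) + \sum_e m y e *: an e f.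
Proof.
rewrite !quadE linear_sum /=.
rewrite -(sum_delta y (fun b => \sum_e m b e *: an e f)) -big_split /=.
apply: eq_bigr => b _; rewrite linear_sum scaler_sumr -big_split /=.
apply: eq_bigr => e _; rewrite linearZ /= an_cr // an_an // linearN opprK scalerDr addrC.
by rewrite !scalerA mulrC.
Qed.

Lemma an_lieop y r m f : an y (lieop r m f) = lieop r m (an y f) - \sum_e m y e *: an e f.
Proof. by rewrite !lieopE linearB /= an_cf an_quad opprD addrA. Qed.

Lemma lieop_set0 r m f d : lieop r m f (set0, d) = cf r f (set0, d).
Proof.
rewrite lieopE fockD fockN quadE sum_ffunE big1 ?oppr0 ?addr0 // => b _.
by rewrite sum_ffunE big1 // => e _; rewrite fockZ ffunE /= inE mulr0.
Qed.

(** The defect commutes with contractions, since the terms with a contracted leg cancel by the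
    second hypothesis; in degree 0 it vanishes by the first. The order is reversed in the second
    because [lieop] subtracts [quad m]. *)
Lemma lieop_bracket (J : finType) r1 m1 r2 m2 (k : J -> R) rr mm f :
  (forall d d', \sum_e r1 d e * r2 e d' - \sum_e r2 d e * r1 e d' = \sum_j k j * rr j d d') ->
  (forall z u, \sum_e m2 z e * m1 e u - \sum_e m1 z e * m2 e u = \sum_j k j * mm j z u) ->
  lieop r1 m1 (lieop r2 m2 f) = lieop r2 m2 (lieop r1 m1 f) + \sum_j k j *: lieop (rr j) (mm j) f.
Proof.
move=> Hr Hm.
pose T f := lieop r1 m1 (lieop r2 m2 f) -
  (lieop r2 m2 (lieop r1 m1 f) + \sum_j k j *: lieop (rr j) (mm j) f).
apply/eqP; rewrite -subr_eq0; apply/eqP; rewrite -/(T f).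
apply: (@an_inj_op _ _ _ rk T 1) => {f} [z f|f d]; last first.
  have E r m r' m' : lieop r m (lieop r' m' f) (set0, d) =
      \sum_d' (\sum_e r d e * r' e d') * f (set0, d').
    rewrite lieop_set0 ffunE /=; under eq_bigr do rewrite lieop_set0 ffunE mulr_sumr.
    rewrite exchange_big; apply: eq_bigr => d' _; rewrite mulr_suml.
    by apply: eq_bigr => e _; rewrite mulrA.
  rewrite /T !fockE !E sum_ffunE opprD addrA -sumrB.
  under eq_bigr do rewrite -mulrBl Hr mulr_suml.
  rewrite exchange_big -sumrB big1 // => j _.
  rewrite fockZ lieop_set0 ffunE mulr_sumr; apply/eqP; rewrite subr_eq0; apply/eqP.
  by apply: eq_bigr => d' _; rewrite mulrA.
have E r m r' m' : an z (lieop r m (lieop r' m' f)) =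
  lieop r m (lieop r' m' (an z f)) - \sum_e m' z e *: lieop r m (an e f)
  - \sum_e m z e *: lieop r' m' (an e f) + \sum_u (\sum_e m z e * m' e u) *: an u f.
  rewrite an_lieop an_lieop linearB /= linear_sum -!addrA; congr (_ + _).
  congr (- _ + _); first by apply: eq_bigr => e _; rewrite linearZ.
  under eq_bigr do rewrite an_lieop scalerBr scaler_sumr.
  rewrite sumrB opprD opprK exchange_big /=; congr (_ + _); apply: eq_bigr => u _.
  by rewrite scaler_suml; apply: eq_bigr => e _; rewrite scalerA.
have -> : an z (T f) = an z (lieop r1 m1 (lieop r2 m2 f)) -
    (an z (lieop r2 m2 (lieop r1 m1 f)) + an z (\sum_j k j *: lieop (rr j) (mm j) f)).
  by rewrite /T linearB linearD.
have -> : an z (\sum_j k j *: lieop (rr j) (mm j) f) =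
    \sum_j k j *: lieop (rr j) (mm j) (an z f) -
   (\sum_u (\sum_e m2 z e * m1 e u) *: an u f - \sum_u (\sum_e m1 z e * m2 e u) *: an u f).
  rewrite linear_sum /=; under eq_bigr do rewrite linearZ /= an_lieop scalerBr.
  rewrite sumrB; congr (_ - _).
  rewrite -sumrB; under [RHS]eq_bigr do rewrite -scalerBl Hm scaler_suml.
  under [LHS]eq_bigr do rewrite scaler_sumr.
  by rewrite exchange_big; do 2!apply: eq_bigr => ? _; rewrite scalerA.
rewrite !E scale1r /T.
apply/ffunP => x; rewrite !fockE; ring.
Qed.

End LieCochains.

(** * The differential on the Fock space *)

Section CEdiff.
Variables (R : numFieldType) (I D : finType) (rk : I -> nat).
Hypothesis rk_inj : injective rk.
Local Notation W := {ffun {set I} * D -> R^o}.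
Variables (c : I -> I -> I -> R) (rho : I -> D -> D -> R).

Definition dW : W -> W :=
  ce_diff c (fun a => cr rk a : {linear W -> W}) (fun a => an rk a : {linear W -> W})
    (fun a => cf (rho a) : {linear W -> W}).
HB.instance Definition _ := GRing.Linear.on dW.

Hypothesis c_anti : forall a b e, c a b e = - c b a e.

Lemma dWE f : dW f = \sum_a cr rk a (cf (rho a) f - 2^-1 *: quad rk (c a) f).
Proof.
by rewrite /dW ce_diffE; apply: eq_bigr => a _; rewrite ad_legE quadE.
Qed.

Lemma an_dW x f : an rk x (dW f) = lieop rk (rho x) (c x) f - dW (an rk x f).
Proof.
rewrite /dW cartan //=; first by rewrite ad_legE lieopE quadE.
- by move=> a b g; rewrite /= an_cr.
- by move=> a b g; rewrite /= an_an.
- by move=> a b g; rewrite /= an_cf.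
Qed.

Lemma dW_set0 f d : dW f (set0, d) = 0.
Proof. by rewrite dWE sum_ffunE big1 // => a _; rewrite ffunE /= inE. Qed.

Hypothesis jacobi : forall a b x y,
  \sum_e c a b e * c e x y = \sum_e c b x e * c a e y - \sum_e c a x e * c b e y.
Hypothesis rho_rep : forall a b d d',
  \sum_e rho a d e * rho b e d' - \sum_e rho b d e * rho a e d' = \sum_e c a b e * rho e d d'.

Lemma lieop_bracketW a b f :
  lieop rk (rho a) (c a) (lieop rk (rho b) (c b) f) =
  lieop rk (rho b) (c b) (lieop rk (rho a) (c a) f) +
  \sum_e c a b e *: lieop rk (rho e) (c e) f.
Proof. exact: lieop_bracket. Qed.

(** By Cartan's formula and the bracket relation of Lie derivatives, the defect anticommutes with
    every contraction; [an_inj_op] applies with sign [-1]. *)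
Lemma lieop_dW x f : lieop rk (rho x) (c x) (dW f) = dW (lieop rk (rho x) (c x) f).
Proof.
apply/eqP; rewrite -subr_eq0; apply/eqP.
pose T g := lieop rk (rho x) (c x) (dW g) - dW (lieop rk (rho x) (c x) g).
rewrite -/(T f); apply: (@an_inj_op _ _ _ rk T (-1)) => {f} [y f|f d]; last first.
  rewrite /T !fockE lieop_set0 dW_set0 subr0 ffunE big1 // => d' _.
  by rewrite dW_set0 mulr0.
rewrite /T linearB /= an_lieop // !an_dW an_lieop //.
have -> : \sum_e c x y e *: an rk e (dW f) =
    \sum_e c x y e *: lieop rk (rho e) (c e) f - dW (\sum_e c x y e *: an rk e f).
  rewrite [dW (\sum_e _)]linear_sum -sumrB; apply: eq_bigr => e _ /=.
  by rewrite an_dW scalerBr [dW (_ *: _)]linearZ.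
rewrite !linearB /= lieop_bracketW.
apply/ffunP => z; rewrite !fockE; ring.
Qed.

(** Two uses of Cartan's formula show that contractions commute with the square, the Lie derivatives
    cancelling by [lieop_dW]. *)
Lemma dW_sq f : dW (dW f) = 0.
Proof.
apply: (@an_inj_op _ _ _ rk (dW \o dW) 1) => {f} [y f|f d] /=; last exact: dW_set0.
by rewrite scale1r !an_dW lieop_dW linearB /= opprB addrC subrK.
Qed.

End CEdiff.

(** * Components with respect to the coefficients, and degrees *)

Section Components.
Variables (R : numFieldType) (I D : finType) (rk : I -> nat).
Hypothesis rk_inj : injective rk.
Local Notation W := {ffun {set I} * D -> R^o}.
Local Notation W1 := {ffun {set I} * unit -> R^o}.

Definition comp (b : D) (f : W) : W1 := [ffun x : {set I} * unit => f (x.1, b)].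

Lemma comp_is_linear b : linear (comp b).
Proof. by move=> k f g; apply/ffunP => x; rewrite !ffunE. Qed.
HB.instance Definition _ b := GRing.isLinear.Build R W W1 _ (comp b) (comp_is_linear b).

Lemma compP (f g : W) : (forall b, comp b f = comp b g) -> f = g.
Proof. by move=> h; apply/ffunP => [[S b]]; have /ffunP /(_ (S, tt)) := h b; rewrite !ffunE. Qed.

Lemma comp_cr b a f : comp b (cr rk a f) = cr rk a (comp b f).
Proof. by apply/ffunP => x; rewrite !ffunE. Qed.

Lemma comp_an b a f : comp b (an rk a f) = an rk a (comp b f).
Proof. by apply/ffunP => x; rewrite !ffunE. Qed.

Lemma comp_cf b r f : comp b (cf r f) = \sum_e r b e *: comp e f.
Proof.
apply/ffunP => x; rewrite !ffunE /= sum_ffunE.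
by apply: eq_bigr => e _; rewrite !ffunE.
Qed.

Lemma comp_quad b m f : comp b (quad rk m f) = quad rk m (comp b f).
Proof.
rewrite !quadE linear_sum; apply: eq_bigr => x _; rewrite linear_sum.
by apply: eq_bigr => e _; rewrite linearZ /= comp_cr comp_an.
Qed.

Lemma cf0 (D' : finType) (f : {ffun {set I} * D' -> R^o}) (r : D' -> D' -> R) :
  (forall d e, r d e = 0) -> cf r f = 0.
Proof. by move=> h; apply/ffunP => x; rewrite !ffunE big1 // => d _; rewrite h mul0r. Qed.

Lemma dW_trivE c (f : W1) :
  dW rk c (@rho_triv R I) f = \sum_a cr rk a (- (2^-1 *: quad rk (c a) f)).
Proof. by rewrite dWE; apply: eq_bigr => a _; rewrite cf0 // add0r. Qed.

Lemma comp_dW c rho b f : comp b (dW rk c rho f) =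
  dW rk c (@rho_triv R I) (comp b f) + \sum_a \sum_e rho a b e *: cr rk a (comp e f).
Proof.
rewrite dWE linear_sum dW_trivE -big_split /=; apply: eq_bigr => a _.
rewrite comp_cr linearB /= comp_cf linearZ /= comp_quad addrC linearD /=; congr (_ + _).
by rewrite linear_sum; apply: eq_bigr => e _; rewrite linearZ.
Qed.

Definition deg k (f : W) : W := [ffun x : {set I} * D => if #|x.1| == k then f x else 0].

Lemma deg_is_linear k : linear (deg k).
Proof. by move=> l f g; apply/ffunP => x; rewrite !ffunE; case: eqP; rewrite ?scaler0 ?addr0. Qed.
HB.instance Definition _ k := GRing.isLinear.Build R W W _ (deg k) (deg_is_linear k).

Lemma deg_id k f : deg k (deg k f) = deg k f.
Proof. by apply/ffunP => x; rewrite !ffunE; case: eqP. Qed.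

Lemma cr_deg a k f : cr rk a (deg k f) = deg k.+1 (cr rk a f).
Proof.
apply/ffunP => [[S d]]; rewrite !ffunE /=; case: ifP => aS; last by rewrite if_same.
by rewrite [in RHS](cardsD1 a) aS eqSS; case: eqP => // _; rewrite mulr0.
Qed.

Lemma an_deg a k f : an rk a (deg k.+1 f) = deg k (an rk a f).
Proof.
apply/ffunP => [[S d]]; rewrite !ffunE /=; case: (boolP (a \in S)) => aS; first by rewrite if_same.
by rewrite cardsU1 aS eqSS; case: eqP => // _; rewrite mulr0.
Qed.

Lemma cf_deg r k f : cf r (deg k f) = deg k (cf r f).
Proof.
apply/ffunP => [[S d]]; rewrite !ffunE /=; under eq_bigr do rewrite ffunE /=.
by case: eqP => // _; rewrite big1 // => i _; rewrite mulr0.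
Qed.

Lemma an_deg0 a f : an rk a (deg 0 f) = 0.
Proof.
apply/ffunP => [[S d]]; rewrite !ffunE /=; case: (boolP (a \in S)) => // aS.
by rewrite cardsU1 aS mulr0.
Qed.

Lemma quad_deg m k f : quad rk m (deg k f) = deg k (quad rk m f).
Proof.
rewrite !quadE linear_sum; apply: eq_bigr => b _; rewrite linear_sum; apply: eq_bigr => e _.
rewrite linearZ /=; congr (_ *: _); case: k => [|k]; last by rewrite an_deg cr_deg.
rewrite an_deg0 linear0; apply/ffunP => [[S d]]; rewrite !ffunE /=; case: ifP => //.
by rewrite cards_eq0 => /eqP ->; rewrite inE.
Qed.

Lemma dW_deg c rho k f : dW rk c rho (deg k f) = deg k.+1 (dW rk c rho f).
Proof.
rewrite !dWE linear_sum; apply: eq_bigr => a _ /=.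
by rewrite -cr_deg cf_deg quad_deg [deg k (_ - _)]linearB /= [deg k (_ *: _)]linearZ.
Qed.

Lemma deg0_dW c rho f : deg 0 (dW rk c rho f) = 0.
Proof.
apply/ffunP => [[S d]]; rewrite !ffunE /=; case: ifP => //.
by rewrite cards_eq0 => /eqP ->; rewrite dW_set0.
Qed.

End Components.

(** * The map pi_R^* on the Fock space *)

Section PiMap.
Variables (R : numFieldType) (I : finType) (rk : I -> nat).
Hypothesis rk_inj : injective rk.
Local Notation WI := {ffun {set I} * I -> R^o}.
Local Notation W1 := {ffun {set I} * unit -> R^o}.

Definition piW (y : W1) : WI := [ffun x : {set I} * I => an rk x.2 y (x.1, tt)].

Lemma comp_piW b y : comp b (piW y) = an rk b y.
Proof. by apply/ffunP => [[S []]]; rewrite !ffunE. Qed.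

Lemma piW_is_linear : linear piW.
Proof.
by move=> k f g; apply: compP => b; rewrite linearP /= !comp_piW linearP.
Qed.
HB.instance Definition _ := GRing.isLinear.Build R W1 WI _ piW piW_is_linear.

Lemma piW_deg k y : piW (deg k.+1 y) = deg k (piW y).
Proof.
apply: compP => b; rewrite comp_piW an_deg -comp_piW.
by apply/ffunP => x; rewrite !ffunE.
Qed.

(** A value at a nonempty set is, up to sign, a value of some contraction; only the scalar part
    escapes. *)
Lemma piW_inj y : piW y = 0 -> y (set0, tt) = 0 -> y = 0.
Proof.
move=> py y0; apply/ffunP => [[S []]]; rewrite [RHS]ffunE.
have [->//|[a aS]] := set_0Vmem S.
have /ffunP /(_ (S :\ a, a)) := py; rewrite !ffunE /= setD11 setD1K //.
by move/eqP; rewrite mulf_eq0 signr_eq0 /= => /eqP.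
Qed.

Variable c : I -> I -> I -> R.
Hypothesis c_anti : forall a b e, c a b e = - c b a e.

(** This is Cartan's formula: for trivial coefficients the Lie derivative along [e_b] is exactly the
    coadjoint term of the [b]-component. The sign comes from inserting the coefficient as first
    argument; images are the same. *)
Lemma dW_piW y :
  dW rk c (rho_coad c) (piW y) = - piW (dW rk c (@rho_triv R I) y).
Proof.
apply: compP => b; rewrite comp_dW linearN /= !comp_piW an_dW // lieopE cf0 // sub0r.
rewrite opprD !opprK addrC; congr (_ + _).
rewrite quadE; apply: eq_bigr => a _; apply: eq_bigr => e _.
by rewrite comp_piW /rho_coad -c_anti.
Qed.

End PiMap.

(** * Comparison with alternating cochains *)

Section CochainMaps.
Variables (R : fieldType) (I D : finType) (c : I -> I -> I -> R) (rho : I -> D -> D -> R).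

Lemma dfun_is_linear k : linear (@dfun R I D c rho k).
Proof.
move=> l f g; apply/ffunP => x; rewrite !ffunE scalerDr addrACA; congr (_ + _).
  rewrite scaler_sumr -big_split; apply: eq_bigr => i _ /=.
  rewrite /GRing.scale /= mulrCA -mulrDr; congr (_ * _); rewrite mulr_sumr -big_split.
  by apply: eq_bigr => d _; rewrite !ffunE mulrDr /GRing.scale /= mulrCA.
rewrite scaler_sumr -big_split; apply: eq_bigr => i _ /=.
rewrite scaler_sumr -big_split; apply: eq_bigr => j _ /=.
rewrite /GRing.scale /= mulrCA -mulrDr; congr (_ * _); rewrite mulr_sumr -big_split.
by apply: eq_bigr => d _; rewrite !ffunE mulrDr /GRing.scale /= mulrCA.
Qed.
HB.instance Definition _ k := GRing.isLinear.Build R (cochain R I D k) (cochain R I D k.+1) _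
  (@dfun R I D c rho k) (@dfun_is_linear k).

Lemma dCEE k f : dCE c rho k f = dfun c rho f.
Proof. by rewrite /dCE lfunE. Qed.

Lemma alt_defect_is_linear k : linear (@alt_defect R I D k).
Proof.
move=> l f g; apply/ffunP => x; rewrite !ffunE /GRing.scale /=.
by rewrite !mulrDr mulrN opprD addrACA (mulrCA _ l).
Qed.
HB.instance Definition _ k := GRing.isLinear.Build R (cochain R I D k) _ _
  (@alt_defect R I D k) (@alt_defect_is_linear k).

Lemma altP k (f : cochain R I D k) :
  reflect (forall (s : {perm 'I_k}) (t : {ffun 'I_k -> I}) d,
    f ([ffun r => t (s r)], d) = (-1) ^+ (odd_perm s) * f (t, d)) (f \in alt R I D k).
Proof.
rewrite memv_ker lfunE; apply: (iffP eqP) => [h s t d|h].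
  have /ffunP /(_ (s, (t, d))) := h; rewrite !ffunE /= => /eqP.
  by rewrite subr_eq0 => /eqP.
by apply/ffunP => [[s [t d]]]; rewrite !ffunE h subrr.
Qed.

Lemma pistar_fun_is_linear k : linear (@pistar_fun R I k).
Proof. by move=> l f g; apply/ffunP => x; rewrite !ffunE. Qed.
HB.instance Definition _ k := GRing.isLinear.Build R (cochain R I unit k.+1) (cochain R I I k) _
  (@pistar_fun R I k) (@pistar_fun_is_linear k).

Lemma pistarE k f : pistar R I k f = pistar_fun f.
Proof. by rewrite /pistar lfunE. Qed.

End CochainMaps.

(** * Tuples with entries removed or prepended *)

Section Tuples.
Variable (I : finType).

Definition tcons k (e : I) (u : {ffun 'I_k -> I}) : {ffun 'I_k.+1 -> I} :=
  [ffun r => if unlift ord0 r is Some r' then u r' else e].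

Lemma rem1_tcons k e (u : {ffun 'I_k -> I}) : rem1 (tcons e u) ord0 = u.
Proof. by apply/ffunP => r; rewrite !ffunE liftK. Qed.

Lemma tcons0 k e (u : {ffun 'I_k -> I}) : tcons e u ord0 = e.
Proof. by rewrite ffunE unlift_none. Qed.

Lemma sorted_enum_ord n : sorted (fun i j : 'I_n => (i < j)%N) (enum 'I_n).
Proof. by have := iota_ltn_sorted 0 n; rewrite -val_enum_ord sorted_map. Qed.

(** Both lists are strictly increasing and have the same members. *)
Lemma enum_neq2 k (i : 'I_k.+2) (j : 'I_k.+1) :
  [seq l <- enum 'I_k.+2 | (l != i) && (l != lift i j)] =
  [seq lift i (lift j r) | r <- enum 'I_k].
Proof.
have tr : transitive (fun i j : 'I_k.+2 => (i < j)%N) by move=> a b e; apply: ltn_trans.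
apply: (irr_sorted_eq tr) => [a|||l]; first exact: ltnn.
- exact/sorted_filter/sorted_enum_ord.
- rewrite sorted_map; apply: sub_sorted (sorted_enum_ord k) => a b /=.
  by rewrite /bump /=; lia.
rewrite mem_filter mem_enum andbT; apply/idP/mapP => [/andP[li lij]|[r _ ->]].
  case: (unliftP i l) li lij => [l' -> _|->]; last by rewrite eqxx.
  rewrite (inj_eq lift_inj); case: (unliftP j l') => [r ->|->]; last by rewrite eqxx.
  by exists r; rewrite ?mem_enum.
by rewrite eq_sym neq_lift (inj_eq lift_inj) eq_sym neq_lift.
Qed.

Lemma rem2_lift k (t : {ffun 'I_k.+2 -> I}) i j e :
  rem2 t i (lift i j) e = tcons e (rem1 (rem1 t i) j).
Proof.
apply/ffunP => r; rewrite !ffunE; case: unliftP => [r' ->|->] //=.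
rewrite !ffunE enum_neq2 add0n; congr (t _).
by rewrite (nth_map (r' : 'I_k)) ?size_enum_ord // (@nth_ord_enum k).
Qed.

Lemma rem2C k (t : {ffun 'I_k.+1 -> I}) i j e : rem2 t i j e = rem2 t j i e.
Proof.
have [->//|ij] := eqVneq i j.
case: k t i j ij => [|k] t i j ij; first by rewrite !ord1 eqxx in ij.
apply/ffunP => r; rewrite !ffunE; case: ifP => // r0; congr (t _).
rewrite (eq_filter (a2 := fun l => (l != j) && (l != i))); last by move=> l; rewrite andbC.
(* The sides now differ only in the default of [nth], which is never reached. *)
apply: set_nth_default.
case: (unliftP j i) ij => [l ->|->]; last by rewrite eqxx.
by move=> _; rewrite enum_neq2 size_map size_enum_ord; case: r r0 => [[|r]] //=.
Qed.

End Tuples.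

(** * Evaluation of Fock-space elements on tuples *)

Section Psi.
Variables (R : numFieldType) (I D : finType) (rk : I -> nat).
Hypothesis rk_inj : injective rk.
Local Notation W := {ffun {set I} * D -> R^o}.
Local Notation an := (an rk).
Local Notation cr := (cr rk).

(** Evaluation by iterated contraction, first argument first; unlike the encoding by sets, it makes
    sense for unsorted tuples and tuples with repetitions. *)
Fixpoint psi k : W -> {ffun 'I_k -> I} -> D -> R :=
  match k with
  | 0 => fun f _ d => f (set0, d)
  | k'.+1 => fun f t d => psi (an (t ord0) f) (rem1 t ord0) d
  end.

Definition Psi k (f : W) : cochain R I D k := [ffun x => psi f x.1 x.2].

Lemma psiS k f t d : psi (k := k.+1) f t d = psi (an (t ord0) f) (rem1 t ord0) d.
Proof. by []. Qed.

Lemma psi_linear k t d (l : R) f g :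
  psi (k := k) (l *: f + g) t d = l * psi f t d + psi g t d.
Proof.
elim: k f g t => [|k IHk] f g t /=; first by rewrite !ffunE.
by rewrite linearP IHk.
Qed.

Lemma psi0 k t d : psi (k := k) 0 t d = 0.
Proof. by elim: k t => [|k IHk] t /=; rewrite ?ffunE // linear0. Qed.

Lemma psiD k t d f g : psi (k := k) (f + g) t d = psi f t d + psi g t d.
Proof. by have := psi_linear t d 1 f g; rewrite scale1r mul1r. Qed.

Lemma psiZ k t d l f : psi (k := k) (l *: f) t d = l * psi f t d.
Proof. by have := psi_linear t d l f 0; rewrite psi0 !addr0. Qed.

Lemma psiN k t d f : psi (k := k) (- f) t d = - psi f t d.
Proof. by rewrite -scaleN1r psiZ mulN1r. Qed.

Lemma psi_sum k t d (J : finType) (F : J -> W) :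
  psi (k := k) (\sum_j F j) t d = \sum_j psi (F j) t d.
Proof. exact: (big_morph (fun f => psi f t d) (psiD t d) (psi0 t d)). Qed.

Lemma Psi_is_linear k : linear (@Psi k).
Proof. by move=> l f g; apply/ffunP => x; rewrite !ffunE psi_linear. Qed.
HB.instance Definition _ k := GRing.isLinear.Build R W (cochain R I D k) _ (@Psi k) (@Psi_is_linear k).

Lemma psi_cf k r f t d : psi (k := k) (cf r f) t d = \sum_d' r d d' * psi f t d'.
Proof.
elim: k f t => [|k IHk] f t /=; first by rewrite ffunE.
by rewrite an_cf IHk.
Qed.

Lemma psi_cr0 a f t d : psi (k := 0) (cr a f) t d = 0.
Proof. by rewrite /= ffunE /= inE. Qed.

Lemma psi_cr k a f t d :
  psi (k := k.+1) (cr a f) t d =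
  \sum_(i < k.+1) (-1) ^+ i * ((t i == a)%:R * psi f (rem1 t i) d).
Proof.
elim: k f t => [|k IHk] f t; rewrite big_ord_recl expr0 mul1r.
  rewrite big_ord0 addr0 /= an_cr // !fockE /=.
  by rewrite [cr _ _ _]ffunE /= inE subr0.
rewrite [LHS]psiS an_cr // psiD psiZ psiN IHk; congr (_ + _).
rewrite -sumrN; apply: eq_bigr => i _; rewrite ffunE -mulNr.
have -> : - (-1) ^+ i = (-1) ^+ (lift ord0 i) :> R by rewrite exprS mulN1r.
congr (_ * (_ * _)); rewrite /=; congr (psi (an _ _) _ _).
  by rewrite ffunE; congr (t _); apply: val_inj.
apply/ffunP => r; rewrite !ffunE; congr (t _); apply: val_inj => /=.
by rewrite /bump /=; lia.
Qed.

Lemma psi_quad0 m f t d : psi (k := 0) (quad rk m f) t d = 0.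
Proof.
rewrite quadE psi_sum big1 // => b _; rewrite psi_sum big1 // => e _.
by rewrite psiZ psi_cr0 mulr0.
Qed.

Lemma psi_quad k m f t d :
  psi (k := k.+1) (quad rk m f) t d =
  \sum_(j < k.+1) (-1) ^+ j * \sum_e m (t j) e * psi f (tcons e (rem1 t j)) d.
Proof.
rewrite quadE psi_sum.
under eq_bigr do rewrite psi_sum.
under eq_bigr do under eq_bigr do rewrite psiZ psi_cr mulr_sumr.
rewrite exchange_big /=; under eq_bigr do rewrite exchange_big.
rewrite exchange_big /=; apply: eq_bigr => j _; rewrite mulr_sumr; apply: eq_bigr => e _.
rewrite (bigD1 (t j)) //= eqxx mul1r big1 => [|b /negPf bj]; last by rewrite eq_sym bj mul0r !mulr0.
by rewrite addr0 rem1_tcons tcons0 mulrCA.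
Qed.

Variables (c : I -> I -> I -> R) (rho : I -> D -> D -> R).
Hypothesis c_anti : forall a b e, c a b e = - c b a e.

(** Position [j] among the slots other than [i] is slot [j] if [j < i] and slot [j.+1] otherwise.
    The shift flips the sign in the second case, so that both orders of a pair contribute
    equally. *)
Lemma big_antisym k (T : 'I_k.+2 -> 'I_k.+2 -> R) :
  (forall i j, T j i = - T i j) ->
  \sum_(i < k.+2) (-1) ^+ i * (\sum_(j : 'I_k.+1) (-1) ^+ j * T i (lift i j)) =
  - 2 * \sum_(i < k.+2) \sum_(j < k.+2 | (i < j)%N) (-1) ^+ (i + j) * T i j.
Proof.
move=> Tanti.
have E (i : 'I__) : (-1) ^+ i * (\sum_(j : 'I_k.+1) (-1) ^+ j * T i (lift i j)) =
   \sum_(j < k.+2 | (j < i)%N) (-1) ^+ (i + j) * T i j - \sum_(j < k.+2 | (i < j)%N) (-1) ^+ (i + j) * T i j.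
  rewrite [X in _ = X - _]big_mkcond [X in _ = _ - X]big_mkcond.
  rewrite [X in _ = X - _](bigD1_ord i) // [X in _ = _ - X](bigD1_ord i) //=.
  rewrite ltnn !add0r -sumrB mulr_sumr.
  apply: eq_bigr => j _; rewrite /bump; have [ij|ij] := leqP i j.
    rewrite add1n ltnS ij ltnNge (leq_trans ij) //= sub0r.
    by rewrite addnS exprS mulN1r mulNr opprK exprD mulrA.
  by rewrite add0n ij ltnNge ltnW //= subr0 exprD mulrA.
under eq_bigr do rewrite E.
rewrite sumrB (exchange_big_dep predT) //=.
rewrite mulNr -[2]/(1 + 1) mulrDl mul1r opprD; congr (_ - _).
rewrite -sumrN; apply: eq_bigr => j _; rewrite -sumrN; apply: eq_bigr => i _.
by rewrite Tanti mulrN addnC.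
Qed.

(** The Fock-space bracket term runs over ordered pairs of slots; [big_antisym] folds it onto
    [i < j], and its factor [- 2] cancels [- 2^-1]. *)
Lemma Psi_dW k f : Psi k.+1 (dW rk c rho f) = dCE c rho k (Psi k f).
Proof.
apply/ffunP => [[t d]]; rewrite dCEE [RHS]ffunE.
transitivity (psi (k := k.+1) (dW rk c rho f) t d); first by rewrite ffunE.
rewrite dWE psi_sum; under eq_bigr do rewrite psi_cr.
rewrite exchange_big /=.
have E (i : 'I__) : \sum_a (-1) ^+ i * ((t i == a)%:R *
     psi (cf (rho a) f - 2^-1 *: quad rk (c a) f) (rem1 t i) d) =
   (-1) ^+ i * (\sum_d' rho (t i) d d' * Psi k f (rem1 t i, d')) -
   2^-1 * ((-1) ^+ i * psi (quad rk (c (t i)) f) (rem1 t i) d).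
  rewrite -mulr_sumr (bigD1 (t i)) //= eqxx mul1r big1 => [|b /negPf bj]; last first.
    by rewrite eq_sym bj mul0r.
  rewrite addr0 psiD psiN psiZ psi_cf mulrBr; congr (_ * _ - _); last by rewrite mulrCA.
  by apply: eq_bigr => d' _; rewrite ffunE.
under eq_bigr do rewrite E.
rewrite sumrB; congr (_ + _); rewrite -mulr_sumr.
case: k f t {E} => [|k] f t.
  rewrite big1 => [|i _]; last by rewrite psi_quad0 mulr0.
  rewrite mulr0 oppr0 [RHS]big1 // => i _.
  by rewrite big_pred0 // => j; rewrite !ord1 ltnn.
pose T i j := \sum_e c (t i) (t j) e * Psi k.+1 f (rem2 t i j e, d).
transitivity (- (2^-1 * \sum_(i < k.+2) (-1) ^+ i * (\sum_(j : 'I_k.+1) (-1) ^+ j * T i (lift i j)))).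
  congr (- (_ * _)); apply: eq_bigr => i _; congr (_ * _); rewrite psi_quad.
  apply: eq_bigr => j _; congr (_ * _); apply: eq_bigr => e _.
  by rewrite [in RHS]ffunE rem2_lift ffunE.
rewrite big_antisym; last first.
  move=> i j; rewrite /T -sumrN; apply: eq_bigr => e _.
  by rewrite c_anti mulNr rem2C.
by rewrite mulNr mulrN opprK mulrA mulVf ?mul1r // pnatr_eq0.
Qed.

End Psi.

(** * The Fock space of degree k is the space of alternating k-cochains *)

Section PsiAlt.
Variables (R : numFieldType) (I D : finType) (rk : I -> nat).
Hypothesis rk_inj : injective rk.
Local Notation W := {ffun {set I} * D -> R^o}.
Local Notation an := (an rk).
Local Notation psi := (psi rk).

Let alternates k (s : {perm 'I_k}) := forall (f : W) (t : {ffun 'I_k -> I}) d,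
  psi f [ffun r => t (s r)] d = (-1) ^+ (odd_perm s) * psi f t d.

Let alternatesM k (s s' : {perm 'I_k}) : alternates s -> alternates s' -> alternates (s * s')%g.
Proof.
move=> hs hs' f t d; have := hs f [ffun r => t (s' r)] d; rewrite hs' mulrA -signr_addb -odd_permM.
by move=> <-; congr (psi f _ d); apply/ffunP => r; rewrite !ffunE permM.
Qed.

(** Induction handles two slots of the tail, anticommuting contractions handle the first two slots,
    and a swap of the first slot with any other is conjugate to the swap of the first two. *)
Let alternates_tperm k (x y : 'I_k) : alternates (tperm x y).
Proof.
elim: k x y => [[]//|k IHk] x y.
have liftP (x' y' : 'I_k) : alternates (tperm (lift ord0 x') (lift ord0 y')).
  move=> f t d; rewrite odd_tperm (inj_eq lift_inj) -odd_tperm !psiS -IHk.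
  congr (psi (an _ f) _ d); first by rewrite ffunE tpermD // eq_sym neq_lift.
  apply/ffunP => r; rewrite !ffunE; congr (t _).
  by rewrite !permE /= !(inj_eq lift_inj); case: ifP => // _; case: ifP.
have swap01 k' (f : {ffun 'I_k'.+2 -> I}) (g : W) d :
    psi g [ffun r => f (tperm ord0 (lift ord0 ord0) r)] d = - psi g f d.
  rewrite !psiS -psiN -an_an //; congr (psi (an _ (an _ g)) _ d).
  - by rewrite !ffunE tpermR.
  - by rewrite !ffunE tpermL.
  apply/ffunP => r; rewrite !ffunE tpermD // ?neq_lift //.
have ord0P (y' : 'I_k) : alternates (tperm ord0 (lift ord0 y')).
  case: k y' {IHk x y} liftP => [[]//|k] y' liftP.
  have [->|y'0] := eqVneq y' ord0.
    by move=> f t d; rewrite swap01 odd_tperm neq_lift expr1 mulN1r.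
  have <- : (tperm ord0 (lift ord0 ord0) ^ tperm (lift ord0 ord0) (lift ord0 y') =
      tperm ord0 (lift ord0 y'))%g.
    by rewrite tpermJ tpermL tpermD // eq_sym neq_lift.
  rewrite conjgE tpermV; apply: alternatesM => //; apply: alternatesM => // f t d.
  by rewrite swap01 odd_tperm neq_lift expr1 mulN1r.
case: (unliftP ord0 x) => [x' ->|->]; case: (unliftP ord0 y) => [y' ->|->] //.
  by rewrite tpermC.
move=> f t d; rewrite tperm1 odd_perm1 expr0 mul1r; congr (psi f _ d).
by apply/ffunP => r; rewrite ffunE perm1.
Qed.

Lemma psi_perm k (s : {perm 'I_k}) (f : W) (t : {ffun 'I_k -> I}) d :
  psi f [ffun r => t (s r)] d = (-1) ^+ (odd_perm s) * psi f t d.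
Proof.
move: f t d; rewrite -/(alternates s); have [ts -> _] := prod_tpermP s.
elim: ts => [|p ts IHts]; last first.
  by rewrite big_cons; apply: alternatesM => //; apply: alternates_tperm.
rewrite big_nil => f t d; rewrite odd_perm1 expr0 mul1r; congr (psi f _ d).
by apply/ffunP => r; rewrite ffunE perm1.
Qed.

Lemma Psi_alt k f : Psi rk k f \in alt R I D k.
Proof. by apply/altP => s t d; rewrite !ffunE psi_perm. Qed.

Lemma alt_noninj k f (t : {ffun 'I_k -> I}) d :
  f \in alt R I D k -> ~~ injectiveb t -> f (t, d) = 0.
Proof.
move=> /altP falt /injectivePn[x [y xy txy]].
have := falt (tperm x y) t d; rewrite odd_tperm xy expr1 mulN1r.
have -> : [ffun r => t (tperm x y r)] = t.
  by apply/ffunP => r; rewrite ffunE; case: tpermP => [->|->|].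
by move/eqP; rewrite eq_sym eqNr => /eqP.
Qed.

(** For injective [t], the sign of the permutation that sorts [t]. *)
Fixpoint chi k : {ffun 'I_k -> I} -> R :=
  match k with
  | 0 => fun _ => 1
  | k'.+1 => fun t => chi (rem1 t ord0) * sg R rk (t ord0) [set rem1 t ord0 i | i : 'I_k']
  end.

Lemma chi_neq0 k t : chi (k := k) t != 0.
Proof.
elim: k t => [|k IHk] t /=; first exact: oner_neq0.
by rewrite mulf_neq0 ?IHk ?signr_eq0.
Qed.

Lemma psi_inj k (f : W) (t : {ffun 'I_k -> I}) d : injective t ->
  psi f t d = chi t * f ([set t i | i : 'I_k], d).
Proof.
elim: k f t => [|k IHk] f t tinj.
  rewrite /= mul1r; congr (f (_, d)); apply/setP => x; rewrite inE.
  by apply/esym/negP => /imsetP[[]].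
have tinj' : injective (rem1 t ord0) by move=> i j; rewrite !ffunE => /tinj /lift_inj.
have imt : [set t i | i : 'I_k.+1] = t ord0 |: [set rem1 t ord0 i | i : 'I_k].
  apply/setP => x; rewrite !inE; apply/imsetP/orP => [[i _ ->]|[/eqP ->|/imsetP[i _ ->]]].
  - case: (unliftP ord0 i) => [j ->|->]; last by left.
    by right; apply/imsetP; exists j => //; rewrite ffunE.
  - by exists ord0.
  - by exists (lift ord0 i) => //; rewrite ffunE.
rewrite psiS IHk //= -mulrA; congr (_ * _).
rewrite ffunE /= ifN ?imt //; apply/imsetP => [[j _]]; rewrite ffunE => /tinj /eqP.
by rewrite (negPf (neq_lift _ _)).
Qed.

Lemma Psi_inj k (f : W) : deg k f = f -> Psi rk k f = 0 -> f = 0.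
Proof.
move=> <- /ffunP Pf; apply/ffunP => [[S d]]; rewrite !ffunE /=; case: eqP => // cS.
pose t : {ffun 'I_k -> I} := [ffun i => enum_val (cast_ord (esym cS) i)].
have tinj : injective t by move=> i j; rewrite !ffunE => /enum_val_inj /cast_ord_inj.
have imt : [set t i | i : 'I_k] = S.
  apply/setP => x; apply/imsetP/idP => [[i _ ->]|xS]; first by rewrite ffunE enum_valP.
  exists (cast_ord cS (enum_rank_in xS x)) => //.
  by rewrite ffunE cast_ordK enum_rankK_in.
have := Pf (t, d); rewrite !ffunE /= psi_inj // imt ffunE /= cS eqxx => /eqP.
by rewrite mulf_eq0 (negPf (chi_neq0 _)) /= => /eqP.
Qed.

Lemma Psi_deg k (f : W) : Psi rk k (deg k f) = Psi rk k f.
Proof.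
apply/ffunP => [[t d]]; rewrite !ffunE /=.
have [tinj|ninj] := boolP (injectiveb t).
  by rewrite !psi_inj ?ffunE /= ?card_imset ?card_ord ?eqxx //; apply/injectiveP.
have h g : psi g t d = Psi rk k g (t, d) by rewrite ffunE.
by rewrite !h !alt_noninj // Psi_alt.
Qed.

(** Each set gets one chosen enumeration, and the value there is corrected by its sorting sign.
    Another enumeration differs by a permutation, whose sign enters both [f] and [chi]. *)
Lemma Psi_surj k f : f \in alt R I D k -> exists2 g : W, deg k g = g & Psi rk k g = f.
Proof.
move=> falt.
pose tup S := [pick t : {ffun 'I_k -> I} | injectiveb t && ([set t i | i : 'I_k] == S)].
pose g0 : W := [ffun x : {set I} * D =>
  if tup x.1 is Some t then (chi t)^-1 * f (t, x.2) else 0].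
exists (deg k g0); first by rewrite deg_id.
rewrite Psi_deg; apply/ffunP => [[t d]].
have [/injectiveP tinj|ninj] := boolP (injectiveb t); last by rewrite !alt_noninj // Psi_alt.
rewrite ffunE /= psi_inj // ffunE /= /tup; case: pickP => [t0|/(_ t)]; last first.
  by rewrite eqxx andbT => /injectiveP.
move=> /andP[/injectiveP t0inj /eqP imt].
pose h r := odflt r [pick r0 | t0 r0 == t r].
have hP r : t0 (h r) = t r.
  rewrite /h; case: pickP => [r0 /eqP //|/= no].
  have : t r \in [set t0 i | i : 'I_k] by rewrite imt imset_f.
  by move=> /imsetP[r0 _ e]; have := no r0; rewrite e eqxx.
have hinj : injective h by move=> r r' e; apply: tinj; rewrite -!hP e.
have tE : t = [ffun r => t0 (perm hinj r)] by apply/ffunP => r; rewrite ffunE permE hP.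
have -> : f (t, d) = (-1) ^+ (odd_perm (perm hinj)) * f (t0, d).
  by rewrite {1}tE; apply/altP.
have -> : chi t = (-1) ^+ (odd_perm (perm hinj)) * chi t0.
  have := psi_perm (perm hinj) [ffun _ => 1] t0 d.
  by rewrite -tE !psi_inj // !ffunE !mulr1.
by rewrite -mulrA [chi t0 * _]mulrA mulfV ?chi_neq0 ?mul1r.
Qed.

End PsiAlt.

(** * Real forms *)

Section Twist.
Variables (R : numFieldType) (I : finType) (rk : I -> nat).
Variables (s : I -> bool).

Definition odd_count (S : {set I}) : nat := \sum_(a in S) s a.

(* The real form of the rescaling [e_a |-> i e_a] for odd [a]: a cochain with
   [n] odd arguments is multiplied by [i ^ n], divided by [i] when [n] is odd. *)
Definition twist (D : finType) (sD : D -> bool) (f : {ffun {set I} * D -> R^o}) :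
    {ffun {set I} * D -> R^o} :=
  [ffun x : {set I} * D => (-1) ^+ ((odd_count x.1 + sD x.2)./2) * f x].

Lemma twist_is_linear (D : finType) sD : linear (@twist D sD).
Proof. by move=> k f g; apply/ffunP => x; rewrite !ffunE mulrDr /GRing.scale /= mulrCA. Qed.
HB.instance Definition _ (D : finType) sD := GRing.isLinear.Build R {ffun {set I} * D -> R^o}
  {ffun {set I} * D -> R^o} _ (@twist D sD) (@twist_is_linear D sD).

Lemma odd_countU a (S : {set I}) : a \notin S -> odd_count (a |: S) = (s a + odd_count S)%N.
Proof. exact: big_setU1. Qed.

Lemma odd_countD a (S : {set I}) : a \in S -> odd_count S = (s a + odd_count (S :\ a))%N.
Proof. by move=> aS; rewrite -odd_countU ?setD11 // setD1K. Qed.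

(** Replacing two legs by one of the sum parity loses a factor i^2 = -1 exactly when both are
    odd. *)
Lemma twist_sign m (x y : bool) :
  (-1) ^+ ((x + (y + m))./2) = (-1) ^+ (x && y) * (-1) ^+ ((x (+) y + m)./2) :> R.
Proof. by case: x; case: y; rewrite /= ?add0n ?mul1r //= exprS. Qed.

Lemma twistK (D : finType) sD : involutive (@twist D sD).
Proof.
by move=> f; apply/ffunP => x; rewrite !ffunE mulrA -expr2 sqrr_sign mul1r.
Qed.

Lemma twist_deg (D : finType) sD k f : @twist D sD (deg k f) = deg k (twist sD f).
Proof. by apply/ffunP => x; rewrite !ffunE; case: ifP; rewrite ?mulr0. Qed.

Lemma twist_piW f : twist s (piW rk f) = piW rk (twist (fun _ : unit => false) f).
Proof.
apply/ffunP => [[S b]]; rewrite !ffunE /=; case: (boolP (b \in S)) => bS; rewrite ?mulr0 //.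
by rewrite odd_countU // addn0 mulrCA addnC.
Qed.

Variables (D : finType) (sD : D -> bool).
Variables (c c' : I -> I -> I -> R) (rho rho' : I -> D -> D -> R).
Hypothesis c_graded : forall a b e, c a b e != 0 -> s e = s a (+) s b.
Hypothesis cE : forall a b e, c' a b e = (-1) ^+ (s a && s b) * c a b e.
Hypothesis rho_graded : forall a d e, rho a d e != 0 -> sD e = s a (+) sD d.
Hypothesis rhoE : forall a d e, rho' a d e = (-1) ^+ (s a && sD d) * rho a d e.

(** The two kinds of summands intertwine separately: the grading fixes the parity of what replaces a
    pair, and [twist_sign] yields the sign in [rhoE], respectively [cE]. *)
Lemma twist_dW f : dW rk c' rho' (twist sD f) = twist sD (dW rk c rho f).
Proof.
have E1 a : cr rk a (cf (rho' a) (twist sD f)) = twist sD (cr rk a (cf (rho a) f)).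
  apply/ffunP => [[S d]]; rewrite !ffunE /=; case: (boolP (a \in S)) => aS; last by rewrite mulr0.
  rewrite mulrCA; congr (_ * _); rewrite mulr_sumr; apply: eq_bigr => e _.
  have [re0|re0] := eqVneq (rho a d e) 0; first by rewrite rhoE re0 !(mul0r, mulr0).
  rewrite rhoE ffunE /= (odd_countD aS) (rho_graded re0) addnAC -addnA twist_sign.
  by rewrite addnC !mulrA; congr (_ * _); rewrite mulrAC.
have E2 a : cr rk a (quad rk (c' a) (twist sD f)) = twist sD (cr rk a (quad rk (c a) f)).
  rewrite !quadE !linear_sum; apply: eq_bigr => b _; rewrite !linear_sum; apply: eq_bigr => e _ /=.
  rewrite !linearZ /=.
  have [ce0|ce0] := eqVneq (c a b e) 0; first by rewrite cE ce0 mulr0 !scale0r.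
  rewrite cE; apply/ffunP => [[S d]]; rewrite !ffunE /=.
  case: (boolP (a \in S)) => aS; last by rewrite !mulr0 !scaler0.
  case: (boolP (b \in S :\ a)) => bS; last by rewrite !mulr0 !scaler0.
  case: (boolP (e \in _)) => eS; first by rewrite !mulr0 !scaler0.
  rewrite (odd_countD aS) (odd_countD bS) odd_countU // -!addnA twist_sign (c_graded ce0).
  rewrite /GRing.scale /=; set x := (-1) ^+ (_ && _); set y := (-1) ^+ _./2.
  set u := sg _ _ _ _; set v := sg _ _ _ _; set w := sg _ _ _ _; set g := f _; set k := c _ _ _.
  ring.
rewrite !dWE linear_sum; apply: eq_bigr => a _ /=.
rewrite [cr rk a (_ - _)]linearB /= [cr rk a (_ *: _)]linearZ /= E1 E2.
by rewrite [cr rk a (_ - _)]linearB /= [cr rk a (_ *: _)]linearZ /= [RHS]linearB /= [in RHS]linearZ.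
Qed.

End Twist.

(** * Cohomology dimensions computed in the Fock space *)

Section Transfer.
Variables (R : numFieldType) (I : finType) (rk : I -> nat).
Hypothesis rk_inj : injective rk.

Definition homog (D : finType) k : {vspace {ffun {set I} * D -> R^o}} :=
  lker (linfun (@deg R I D k) - \1)%VF.

Lemma homogP (D : finType) k (f : {ffun {set I} * D -> R^o}) :
  reflect (deg k f = f) (f \in homog D k).
Proof.
rewrite memv_ker add_lfunE opp_lfunE id_lfunE lfunE subr_eq0; exact: eqP.
Qed.

Definition dl (D : finType) c rho := linfun (@dW R I D rk c rho).
Definition pil := linfun (@piW R I rk).

(** Kernel and image are taken in all degrees at once and then cut down. In degree 0 the image
    contributes nothing, in accordance with [cobnd]. *)
Definition fock_cohdim (D : finType) c (rho : I -> D -> D -> R) k :=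
  (\dim (lker (dl c rho) :&: homog D k) - \dim (limg (dl c rho) :&: homog D k))%N.

Definition fock_HRdim c m :=
  (\dim ((dl c (rho_coad c) @^-1: limg pil) :&: homog I m.+1)
   - \dim ((limg (dl c (rho_coad c)) + limg pil) :&: homog I m.+1))%N.

Lemma dim_bij (U V : vectType R) (phi : {linear U -> V}) (X : {vspace U}) (Y : {vspace V}) :
  (forall x, x \in X -> phi x \in Y) ->
  (forall y, y \in Y -> exists2 x, x \in X & phi x = y) ->
  (forall x, x \in X -> phi x = 0 -> x = 0) -> \dim X = \dim Y.
Proof.
move=> XY YX inj; rewrite (_ : Y = linfun phi @: X)%VS.
  rewrite limg_dim_eq //; apply/eqP; rewrite -subv0; apply/subvP => x.
  by rewrite memv_cap memv_ker lfunE memv0 => /andP[xX /eqP /(inj x xX) ->].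
apply/vspaceP => y; apply/idP/memv_imgP => [/YX[x xX <-]|[x xX ->]].
  by exists x; rewrite ?lfunE.
by rewrite lfunE XY.
Qed.

Section TransferModule.
Variables (s : I -> bool) (D : finType) (sD : D -> bool).
Variables (c c' : I -> I -> I -> R) (rho rho' : I -> D -> D -> R).
Hypothesis c_graded : forall a b e, c a b e != 0 -> s e = s a (+) s b.
Hypothesis cE : forall a b e, c' a b e = (-1) ^+ (s a && s b) * c a b e.
Hypothesis rho_graded : forall a d e, rho a d e != 0 -> sD e = s a (+) sD d.
Hypothesis rhoE : forall a d e, rho' a d e = (-1) ^+ (s a && sD d) * rho a d e.
Hypothesis c_anti' : forall a b e, c' a b e = - c' b a e.
Local Notation W := {ffun {set I} * D -> R^o}.

Definition PsiT k : W -> cochain R I D k := fun f => Psi rk k (twist s sD f).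

Lemma PsiT_is_linear k : linear (@PsiT k).
Proof. by move=> l f g; rewrite /PsiT !linearP. Qed.
HB.instance Definition _ k := GRing.isLinear.Build R W (cochain R I D k) _ (@PsiT k) (@PsiT_is_linear k).

Lemma PsiT_alt k f : PsiT k f \in alt R I D k.
Proof. exact: Psi_alt. Qed.

Lemma PsiT_inj k f : f \in homog D k -> PsiT k f = 0 -> f = 0.
Proof.
move=> /homogP df P0; rewrite -[f](twistK s sD).
by rewrite (@Psi_inj _ _ _ rk k (twist s sD f)) ?linear0 // -twist_deg df.
Qed.

Lemma PsiT_surj k g : g \in alt R I D k -> exists2 f, f \in homog D k & PsiT k f = g.
Proof.
move=> /(Psi_surj rk_inj)[f df Pf]; exists (twist s sD f).
  by apply/homogP; rewrite -twist_deg df.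
by rewrite /PsiT twistK.
Qed.

Lemma PsiT_dW k f : dCE c' rho' k (PsiT k f) = PsiT k.+1 (dW rk c rho f).
Proof. by rewrite /PsiT -Psi_dW // (twist_dW rk c_graded cE rho_graded rhoE). Qed.

Lemma homog_dW k f : f \in homog D k -> dW rk c rho f \in homog D k.+1.
Proof. by move=> /homogP df; apply/homogP; rewrite -dW_deg df. Qed.

Lemma homog_boundary k x : x \in (limg (dl c rho) :&: homog D k.+1)%VS ->
  exists2 z, z \in homog D k & x = dW rk c rho z.
Proof.
rewrite memv_cap => /andP[/memv_imgP[z _ ->] /homogP]; rewrite lfunE /= => dx.
exists (deg k z); first by apply/homogP; rewrite deg_id.
by rewrite dW_deg.
Qed.

Lemma Hdim_transfer k : Hdim c' rho' k = fock_cohdim c rho k.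
Proof.
congr (_ - _)%N; symmetry.
  apply: (@dim_bij _ _ (PsiT k)) => [x|y|x].
  - rewrite !memv_cap PsiT_alt andbT => /andP[]; rewrite !memv_ker lfunE /= => /eqP dx _.
    by rewrite PsiT_dW dx linear0.
  - rewrite memv_cap memv_ker => /andP[/eqP dy] /PsiT_surj[x xk xy].
    exists x => //; rewrite memv_cap xk andbT memv_ker lfunE /=; apply/eqP.
    by apply: (PsiT_inj (homog_dW xk)); rewrite -PsiT_dW xy.
  - by rewrite memv_cap => /andP[_]; apply: PsiT_inj.
case: k => [|k].
  rewrite dimv0; apply/eqP; rewrite dimv_eq0 -subv0; apply/subvP => x.
  rewrite memv_cap memv0 => /andP[/memv_imgP[z _ ->] /homogP <-].
  by rewrite lfunE /= deg0_dW.
apply: (@dim_bij _ _ (PsiT k.+1)) => [x|y|x].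
- move=> /homog_boundary[z _ ->]; rewrite /= -PsiT_dW; apply: memv_img; exact: PsiT_alt.
- move=> /memv_imgP[a /PsiT_surj[z zk <-] ->]; rewrite PsiT_dW.
  exists (dW rk c rho z) => //; rewrite memv_cap homog_dW // andbT.
  by apply/memv_imgP; exists z; rewrite ?memvf ?lfunE.
- by rewrite memv_cap => /andP[_]; apply: PsiT_inj.
Qed.

End TransferModule.

Lemma psi_comp (D : finType) k (f : {ffun {set I} * D -> R^o}) (t : {ffun 'I_k -> I}) b :
  psi rk f t b = psi rk (comp b f) t tt.
Proof.
elim: k f t => [|k IHk] f t; first by rewrite /= ffunE.
by rewrite !psiS IHk comp_an.
Qed.

Lemma pistar_Psi k (y : {ffun {set I} * unit -> R^o}) :
  pistar R I k (Psi rk k.+1 y) = Psi rk k (piW rk y).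
Proof.
rewrite pistarE; apply/ffunP => [[t b]].
transitivity (psi rk (k := k.+1) y (tcons b t) tt); first by rewrite !ffunE.
by rewrite [RHS]ffunE [RHS]psi_comp comp_piW psiS tcons0 rem1_tcons.
Qed.

Section TransferHR.
Variables (s : I -> bool) (c c' : I -> I -> I -> R).
Hypothesis c_graded : forall a b e, c a b e != 0 -> s e = s a (+) s b.
Hypothesis cE : forall a b e, c' a b e = (-1) ^+ (s a && s b) * c a b e.
Hypothesis c_anti' : forall a b e, c' a b e = - c' b a e.

Lemma coad_graded a d e : rho_coad c a d e != 0 -> s e = s a (+) s d.
Proof. by rewrite oppr_eq0; apply: c_graded. Qed.
Lemma coadE a d e : rho_coad c' a d e = (-1) ^+ (s a && s d) * rho_coad c a d e.
Proof. by rewrite /rho_coad cE mulrN. Qed.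

Local Notation P1 := (@PsiT s unit (fun _ => false)).
Local Notation PI := (@PsiT s I s).

Let PI_dW k f : dco c' k (PI k f) = PI k.+1 (dW rk c (rho_coad c) f).
Proof. exact: (PsiT_dW c_graded cE coad_graded coadE). Qed.

Let pistar_PsiT k y : pistar R I k (P1 k.+1 y) = PI k (piW rk y).
Proof. by rewrite pistar_Psi -twist_piW. Qed.

Let homog_piW k y : y \in homog unit k.+1 -> piW rk y \in homog I k.
Proof. by move=> /homogP dy; apply/homogP; rewrite -piW_deg dy. Qed.

(** A coadjoint coefficient counts in [twist] as one more leg of the same parity; this is why the
    twist is compatible with pi_R^* and passes to the cokernel. *)
Lemma HRdim_transfer m : HRdim c' m = fock_HRdim c m.
Proof.
congr (_ - _)%N; symmetry.
  apply: (@dim_bij _ _ (PI m.+1)) => [x|y|x].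
  - rewrite !memv_cap PsiT_alt andbT => /andP[+ /homogP dx].
    rewrite -!memv_preim lfunE /= => /memv_imgP[y _]; rewrite lfunE /= => dxy.
    rewrite PI_dW -dx dW_deg dxy -piW_deg -pistar_PsiT.
    by apply: memv_img; apply: PsiT_alt.
  - rewrite memv_cap -memv_preim => /andP[dy] /(@PsiT_surj s I s _ _)[x xk xy].
    exists x => //; rewrite memv_cap xk andbT -memv_preim lfunE /=.
    move: dy; rewrite -xy PI_dW => /memv_imgP[w /(@PsiT_surj s unit (fun _ => false) _ _)[z zk <-]].
    rewrite pistar_PsiT => /eqP; rewrite -subr_eq0 -linearB => /eqP P0.
    have /eqP := PsiT_inj (rpredB (homog_dW c (rho_coad c) xk) (homog_piW zk)) P0.
    by rewrite subr_eq0 => /eqP ->; apply/memv_imgP; exists z; rewrite ?memvf ?lfunE.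
  - by rewrite memv_cap => /andP[_]; apply: PsiT_inj.
apply: (@dim_bij _ _ (PI m.+1)) => [x|y|x].
- rewrite memv_cap => /andP[/memv_addP[u /memv_imgP[z _ ->] [v /memv_imgP[y _ ->] ->]]].
  rewrite !lfunE /= => /homogP <-.
  rewrite linearD /= -dW_deg -piW_deg linearD /= -PI_dW -pistar_PsiT.
  by apply: memv_add; apply: memv_img; apply: PsiT_alt.
- move=> /memv_addP[u /memv_imgP[a /(@PsiT_surj s I s _ _)[z zk <-] ->]
    [v /memv_imgP[w /(@PsiT_surj s unit (fun _ => false) _ _)[y1 yk <-] ->] ->]].
  rewrite PI_dW pistar_PsiT -linearD.
  exists (dW rk c (rho_coad c) z + piW rk y1) => //.
  rewrite memv_cap; apply/andP; split; last by apply: rpredD; [apply: homog_dW|apply: homog_piW].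
  by apply: memv_add; apply/memv_imgP; [exists z|exists y1]; rewrite ?memvf ?lfunE.
- by rewrite memv_cap => /andP[_]; apply: PsiT_inj.
Qed.

End TransferHR.
End Transfer.

(** * The compact form so(n) and its extension by translations *)

Definition ordpair n (u v : 'I_n) (uv : (u < v)%N) : pairT n :=
  exist (fun pr : 'I_n * 'I_n => (pr.1 < pr.2)%N) (u, v) uv.

Section CompactForm.
Variables (R : numFieldType) (n : nat).

Definition so_mx (a : pairT n) : 'M[R]_n :=
  delta_mx (val a).2 (val a).1 - delta_mx (val a).1 (val a).2.

Lemma so_mxE a u v : so_mx a u v =
  ((u == (val a).2) && (v == (val a).1))%:R - ((u == (val a).1) && (v == (val a).2))%:R.
Proof. by rewrite !mxE. Qed.

Lemma so_mx_anti a u v : so_mx a u v = - so_mx a v u.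
Proof. by rewrite !so_mxE opprB andbC [in X in _ - X]andbC. Qed.

Lemma so_mx_lt a (u v : 'I_n) : (u < v)%N ->
  so_mx a u v = - ((u == (val a).1) && (v == (val a).2))%:R.
Proof.
move=> uv; rewrite so_mxE; case: andP => [[/eqP u2 /eqP v1]|_]; last by rewrite sub0r.
by have := valP a; rewrite -u2 -v1 ltnNge (ltnW uv).
Qed.

Lemma so_expand (X : 'M[R]_n) : (forall u v, X u v = - X v u) ->
  X = \sum_e X (val e).2 (val e).1 *: so_mx e.
Proof.
move=> Xanti; set Y := \sum_e _.
have YE u v : Y u v = \sum_e X (val e).2 (val e).1 * so_mx e u v.
  by rewrite summxE; apply: eq_bigr => e _; rewrite mxE.
have Yanti u v : Y u v = - Y v u.
  by rewrite !YE -sumrN; apply: eq_bigr => e _; rewrite so_mx_anti mulrN.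
have XY (u v : 'I_n) : (u < v)%N -> X u v = Y u v.
  move=> uv; rewrite YE (bigD1 (ordpair uv)) //= so_mx_lt // !eqxx mulrN1 -Xanti.
  rewrite big1 ?addr0 // => e ne; rewrite so_mx_lt //.
  case: andP => [[/eqP eu /eqP ev]|_]; last by rewrite oppr0 mulr0.
  by case/negP: ne; apply/eqP/val_inj; rewrite /= eu ev -surjective_pairing.
apply/matrixP => u v; case: (ltngtP u v) => uv; first exact: XY.
  by rewrite Xanti Yanti XY.
have {uv} <- := val_inj uv.
have diag0 (Z : 'M[R]_n) : Z u u = - Z u u -> Z u u = 0.
  by move=> h; apply/eqP; rewrite -eqNr -h.
by rewrite (diag0 X) // (diag0 Y).
Qed.

(** The order of the matrix products is that of the bracket of vector fields, opposite to the matrix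
    commutator. *)
Definition ceuc (x y z : basisH n) : R :=
  match x, y, z with
  | inl a, inl b, inl e => (so_mx b *m so_mx a - so_mx a *m so_mx b) (val e).2 (val e).1
  | inl a, inr k, inr l => - so_mx a l k
  | inr k, inl a, inr l => so_mx a l k
  | _, _, _ => 0
  end.

Lemma ceuc_anti a b e : ceuc a b e = - ceuc b a e.
Proof.
case: a b e => [a|k] [b|l] [e|j] //=; rewrite ?oppr0 ?opprK //.
by rewrite -[in RHS]opprB [in RHS]mxE opprK.
Qed.

Lemma so_comm_anti a b u v :
  (so_mx b *m so_mx a - so_mx a *m so_mx b) u v = - (so_mx b *m so_mx a - so_mx a *m so_mx b) v u.
Proof.
rewrite !mxE -!sumrB -sumrN; apply: eq_bigr => w _.
rewrite (so_mx_anti b u) (so_mx_anti a w v) (so_mx_anti a u) (so_mx_anti b w v).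
by rewrite !mulrNN opprB [_ * so_mx b v w]mulrC [_ * so_mx a v w]mulrC.
Qed.

Lemma so_closed a b : so_mx b *m so_mx a - so_mx a *m so_mx b =
  \sum_e ceuc (inl a) (inl b) (inl e) *: so_mx e.
Proof. exact/so_expand/so_comm_anti. Qed.

(** Affine vector fields as square matrices of size n + 1, so that the Jacobi identity is inherited
    from associativity. *)
Definition aff_mx (x : basisH n) : 'M[R]_(n + 1) :=
  match x with
  | inl a => block_mx (so_mx a) 0 0 0
  | inr i => block_mx 0 (delta_mx i ord0) 0 0
  end.

Definition aff_coord (X : 'M[R]_(n + 1)) (x : basisH n) : R :=
  match x with
  | inl a => ulsubmx X (val a).2 (val a).1
  | inr i => ursubmx X i ord0
  end.

Lemma aff_coord_sum (z : basisH n -> R) y : aff_coord (\sum_x z x *: aff_mx x) y = z y.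
Proof.
have E : \sum_x z x *: aff_mx x =
   block_mx (\sum_a z (inl a) *: so_mx a) (\sum_i z (inr i) *: delta_mx i ord0) 0 0.
  rewrite big_sumType /=.
  have -> : \sum_a z (inl a) *: block_mx (so_mx a) 0 0 0 =
      block_mx (\sum_a z (inl a) *: so_mx a) 0 0 0 :> 'M_(n + 1, n + 1).
    elim/big_rec2: _ => [|a X Y _ ->]; first by rewrite block_mx_const.
    by rewrite scale_block_mx !scaler0 add_block_mx !addr0.
  have -> : \sum_i z (inr i) *: block_mx 0 (delta_mx i ord0) 0 0 =
      block_mx 0 (\sum_i z (inr i) *: delta_mx i ord0) 0 0 :> 'M_(n + 1, n + 1).
    elim/big_rec2: _ => [|a X Y _ ->]; first by rewrite block_mx_const.
    by rewrite scale_block_mx !scaler0 add_block_mx !addr0.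
  by rewrite add_block_mx !addr0 !add0r.
rewrite E; case: y => [b|j] /=.
  rewrite block_mxKul summxE (bigD1 b) //= mxE so_mxE !eqxx /= big1 ?addr0.
    by rewrite [(val b).2 == _]eq_sym -val_eqE ltn_eqF ?(valP b) //= subr0 mulr1.
  move=> a ab; rewrite mxE so_mxE; case: andP => [[/eqP e2 /eqP e1]|_].
    by case/negP: ab; apply/eqP/val_inj; rewrite [LHS]surjective_pairing -e1 -e2 -surjective_pairing.
  case: andP => [[/eqP e2 /eqP e1]|_]; last by rewrite subr0 mulr0.
  by have := valP a; rewrite /= -e1 -e2 => h; have := ltn_trans h (valP b); rewrite ltnn.
rewrite block_mxKur summxE (bigD1 j) //= !mxE !eqxx /= mulr1 big1 ?addr0 // => i ij.
by rewrite !mxE eq_sym (negPf ij) mulr0.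
Qed.

Lemma aff_closed (a b : basisH n) : aff_mx b *m aff_mx a - aff_mx a *m aff_mx b =
  \sum_e ceuc a b e *: aff_mx e.
Proof.
have sumP (z : pairT n -> R) : \sum_a z a *: aff_mx (inl a) =
    block_mx (\sum_a z a *: so_mx a) 0 0 0.
  elim/big_rec2: _ => [|e X Y _ ->]; first by rewrite block_mx_const.
  by rewrite scale_block_mx !scaler0 add_block_mx !addr0.
have sumV (z : 'I_n -> R) : \sum_i z i *: aff_mx (inr i) =
    block_mx 0 (\sum_i z i *: delta_mx i ord0) 0 0.
  elim/big_rec2: _ => [|e X Y _ ->]; first by rewrite block_mx_const.
  by rewrite scale_block_mx !scaler0 add_block_mx !addr0.
have colE e k : \sum_i so_mx e i k *: delta_mx i ord0 = so_mx e *m delta_mx k (@ord0 0).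
  apply/colP => i; rewrite summxE -colE mxE (bigD1 i) //= !mxE !eqxx mulr1 big1 ?addr0 //.
  by move=> j ji; rewrite mxE [delta_mx _ _ _ _]mxE eq_sym (negPf ji) mulr0.
rewrite big_sumType sumP sumV /= add_block_mx !addr0 add0r.
case: a b => [a|k] [b|l] /=; rewrite !mulmx_block !(mulmx0, mul0mx, addr0, add0r);
  rewrite opp_block_mx add_block_mx !(oppr0, addr0, add0r).
- rewrite {1}so_closed /= [X in _ = block_mx _ X _ _]big1 // => i _; exact: scale0r.
- rewrite [X in _ = block_mx X _ _ _]big1 => [|e _]; last exact: scale0r.
  by rewrite -colE -sumrN; under [X in block_mx _ X _ _ = _]eq_bigr do rewrite -scaleNr.
- rewrite [X in _ = block_mx X _ _ _]big1 => [|e _]; last exact: scale0r.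
  by rewrite -colE.
rewrite [X in _ = block_mx X _ _ _]big1 => [|e _]; last exact: scale0r.
by rewrite [X in _ = block_mx _ X _ _]big1 // => e _; exact: scale0r.
Qed.

(** Each sum is a coordinate of a double commutator of affine matrices, and these satisfy the
    identity. *)
Lemma ceuc_jacobi a b x y :
  \sum_e ceuc a b e * ceuc e x y = \sum_e ceuc b x e * ceuc a e y - \sum_e ceuc a x e * ceuc b e y.
Proof.
have coordE (z : basisH n -> R) (w : basisH n -> basisH n -> R) :
    \sum_e z e * w e y = aff_coord (\sum_e z e *: \sum_u w e u *: aff_mx u) y.
  rewrite -(aff_coord_sum (fun u => \sum_e z e * w e u)); congr (aff_coord _ y).
  under [RHS]eq_bigr do rewrite scaler_sumr.
  rewrite exchange_big; apply: eq_bigr => u _; rewrite scaler_suml.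
  by apply: eq_bigr => e _; rewrite scalerA.
have coordB X Y : aff_coord (X - Y) y = aff_coord X y - aff_coord Y y.
  by case: (y) => [e|i]; rewrite /= !mxE.
rewrite (coordE _ (fun e => ceuc e x)) !coordE -coordB; congr (aff_coord _ y).
have brl z (X : 'M[R]_(n + 1)) : \sum_e z e *: (X *m aff_mx e - aff_mx e *m X) =
   X *m (\sum_e z e *: aff_mx e) - (\sum_e z e *: aff_mx e) *m X.
  rewrite mulmx_sumr mulmx_suml -sumrB; apply: eq_bigr => e _.
  by rewrite scalerBr -scalemxAr -scalemxAl.
have brr z (X : 'M[R]_(n + 1)) : \sum_e z e *: (aff_mx e *m X - X *m aff_mx e) =
   (\sum_e z e *: aff_mx e) *m X - X *m (\sum_e z e *: aff_mx e).
  by rewrite -opprB -brl -sumrN; apply: eq_bigr => e _; rewrite -scalerN opprB.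
under eq_bigr do rewrite -aff_closed.
under [in RHS]eq_bigr do rewrite -aff_closed.
under [X in _ = _ - X]eq_bigr do rewrite -aff_closed.
rewrite brl !brr -!aff_closed.
move: (aff_mx a) (aff_mx b) (aff_mx x) => A B X.
rewrite !(mulmxBr, mulmxBl) !mulmxA.
apply/matrixP => i j; rewrite !mxE; ring.
Qed.

Lemma tr_so_mx (X : 'M[R]_n) a : (forall u v, X u v = - X v u) ->
  \tr (X *m so_mx a) = - 2 * X (val a).2 (val a).1.
Proof.
move=> Xanti.
have trd i j : \tr (X *m delta_mx i j) = X j i.
  rewrite /mxtrace (bigD1 j) //= mxE (bigD1 i) //= mxE !eqxx mulr1.
  rewrite !big1 ?addr0 // => k kj; last by rewrite mxE (negPf kj) mulr0.
  by rewrite mxE big1 // => l _; rewrite mxE (negPf kj) andbF mulr0.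
by rewrite mulmxBr raddfB /= !trd Xanti mulNr -[2]/(1 + 1) mulrDl mul1r opprD.
Qed.

(** The basis is orthonormal for - tr(XY) / 2, which is invariant because the trace is cyclic. *)
Lemma ceuc_cyc a b e :
  ceuc (inl a) (inl b) (inl e) = - ceuc (inl e) (inl b) (inl a).
Proof.
have /mulfI inj2 : (- 2 : R) != 0 by rewrite oppr_eq0 pnatr_eq0.
have trE a' b' e' : - 2 * ceuc (inl a') (inl b') (inl e') =
    \tr (so_mx b' *m so_mx a' *m so_mx e') - \tr (so_mx a' *m so_mx b' *m so_mx e').
  by rewrite -raddfB /= -mulmxBl (tr_so_mx _ (@so_comm_anti a' b')).
apply: inj2; rewrite mulrN !trE opprB; congr (_ - _).
  by rewrite mxtrace_mulC mulmxA.
by rewrite -mulmxA mxtrace_mulC.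
Qed.

End CompactForm.

(** * The structure constants of h_{p,q} as signed ones of the compact form *)

Section RealForm.
Variables (R : realType) (p q : nat).
Local Notation n := (p + q)%N.

Definition blk (i : 'I_n) : bool := (p <= i)%N.
Definition parity (x : basisH n) : bool :=
  match x with inl a => blk (val a).1 (+) blk (val a).2 | inr i => blk i end.

(* [theta u v] is the factor between the (u, v) entries of the basis matrices
   of so(p, q) and of so(n). *)
Definition theta (u v : 'I_n) : R := (-1) ^+ (~~ blk u && blk v).

Lemma hbasis_inl a u v : (@hbasis R p q (inl a)).1 u v = theta u v * so_mx R a u v.
Proof.
rewrite so_mxE !mxE /theta /blk /sameblock -!ltnNge.
have := valP a; case: (val a) => i j /= ij.
have [/andP[/eqP -> /eqP ->]|] := boolP ((u == j) && (v == i)).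
  rewrite [j == i]eq_sym -val_eqE ltn_eqF //= mulr0 addr0 subr0 mulr1.
  by rewrite (_ : _ && _ = false) //; apply/negP => /andP[]; lia.
move=> _; have [/andP[/eqP -> /eqP ->]|_] := boolP ((u == i) && (v == j)).
  rewrite mulr0n mulr1n add0r sub0r mulr1 mulrN1.
  by case: (ltnP i p); case: (ltnP j p); rewrite ?expr0 ?expr1 ?opprK //=; lia.
by rewrite mulr0n mulr0 addr0 subrr mulr0.
Qed.

Lemma so_mx_parity a u v : so_mx R a u v != 0 -> parity (inl a) = blk u (+) blk v.
Proof.
rewrite so_mxE /=; case: andP => [[/eqP -> /eqP ->]|_]; first by rewrite addbC.
by case: andP => [[/eqP -> /eqP ->]|_]; rewrite ?subrr ?eqxx.
Qed.

(** With d = 1 on the first block and d = i on the second, [theta u v] is d_u / d_v times -i to the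
    parity of the basis element. It is therefore multiplicative up to (-i)^2, lost when both factors
    are odd. *)
Lemma theta_mul a b u v w :
  theta u v * so_mx R a u v * (theta v w * so_mx R b v w) =
  (-1) ^+ (parity (inl a) && parity (inl b)) * theta u w * (so_mx R a u v * so_mx R b v w).
Proof.
have [->|/so_mx_parity ->] := eqVneq (so_mx R a u v) 0; first by rewrite mulr0 !mul0r mulr0.
have [->|/so_mx_parity ->] := eqVneq (so_mx R b v w) 0; first by rewrite !mulr0.
rewrite mulrACA; congr (_ * _); rewrite /theta.
by case: (blk u); case: (blk v); case: (blk w); rewrite /= ?expr0 ?expr1 ?mulr1 ?mul1r ?mulrNN ?mulr1.
Qed.

Lemma hbasis_mul_delta a k l :
  ((@hbasis R p q (inl a)).1 *m delta_mx k (@ord0 0)) l ord0 =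
  (-1) ^+ (parity (inl a) && blk k) * so_mx R a l k.
Proof.
rewrite -colE mxE hbasis_inl.
have [->|/so_mx_parity ->] := eqVneq (so_mx R a l k) 0; first by rewrite !mulr0.
by congr (_ * _); rewrite /theta; case: (blk l); case: (blk k).
Qed.

Lemma c_hE a b e : @c_h R p q a b e = (-1) ^+ (parity a && parity b) * ceuc R a b e.
Proof.
have i2 x : (@hbasis R p q (inl x)).2 = 0 by [].
have r1 i : (@hbasis R p q (inr i)).1 = 0 by [].
have r2 i : (@hbasis R p q (inr i)).2 = delta_mx i ord0 by [].
rewrite /c_h; case: a b e => [a|k] [b|l] [e|j]; rewrite ?mulr0 /hcoord /vf_bracket; cbn [fst snd].
- have commE (X Y : 'M[R]_n) u v :
      (Y *m X - X *m Y) u v = \sum_w (Y u w * X w v - X u w * Y w v).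
    by rewrite !mxE -sumrB.
  rewrite /ceuc [LHS]commE commE mulr_sumr; apply: eq_bigr => v _.
  (* Coordinates are read off below the diagonal, where [theta] is 1. *)
  have theta1 : theta (val e).2 (val e).1 = 1.
    rewrite /theta (_ : _ && _ = false) //; apply/negbTE; rewrite negb_and negbK -!ltnNge.
    by have := valP e; rewrite /blk /=; lia.
  by rewrite !hbasis_inl !theta_mul theta1 !mulr1 mulrBr andbC.
- by rewrite !i2 !mulmx0 subrr mxE.
- by rewrite r1 mul0mx mulmx0 subrr mxE.
- by rewrite i2 r1 mulmx0 sub0r r2 mxE hbasis_mul_delta mulrN.
- by rewrite r1 mul0mx mulmx0 subrr mxE.
- by rewrite r1 r2 i2 mulmx0 subr0 hbasis_mul_delta andbC.
- by rewrite !r1 !mul0mx subrr mxE.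
- by rewrite !r1 !mul0mx subrr mxE.
Qed.

Lemma ceuc_graded a b e : ceuc R a b e != 0 -> parity e = parity a (+) parity b.
Proof.
case: a b e => [a|k] [b|l] [e|j]; rewrite ?eqxx //.
- move=> /negPf h; apply/eqP; apply: contraFT h => pe; apply/eqP.
  rewrite /= !mxE -sumrB big1 // => v _.
  have zero a' b' : parity (inl e) != parity (inl a') (+) parity (inl b') ->
      so_mx R a' (val e).2 v * so_mx R b' v (val e).1 = 0.
    have [->|/so_mx_parity ->] := eqVneq (so_mx R a' (val e).2 v) 0; first by rewrite mul0r.
    have [->|/so_mx_parity ->] := eqVneq (so_mx R b' v (val e).1) 0; first by rewrite mulr0.
    by rewrite /=; do 3!case: (blk _).
  by rewrite !zero ?subrr // addbC.
- by rewrite oppr_eq0 => /so_mx_parity ->; rewrite /= addbK.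
- by move=> /so_mx_parity -> /=; rewrite addbCA addbb addbF.
Qed.

End RealForm.

(** * Harmonic representatives *)

Section Harmonic.
Variables (R : realFieldType) (I D P : finType).
Local Notation W := {ffun {set I} * D -> R^o}.
Variables (A : P -> {linear W -> W}) (d h : {linear W -> W}).
Hypothesis A_anti : forall a f g, dot (A a f) g = - dot f (A a g).
Hypothesis dhP : forall f, d (h f) + h (d f) = casimir A f.
Hypothesis d_sq : forall f, d (d f) = 0.
Local Notation Om := (casimir A).

Lemma dot_eq0 (f : W) : dot f f = 0 -> f = 0.
Proof.
move=> /eqP; rewrite psumr_eq0 => [/allP h0|x _]; last by rewrite -expr2 sqr_ge0.
apply/ffunP => x; rewrite [RHS]ffunE; have := h0 x (mem_index_enum x).
by rewrite /= mulf_eq0 orbb => /eqP.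
Qed.

Lemma casimir_is_linear : linear Om.
Proof.
move=> k f g; rewrite /casimir scaler_sumr -big_split; apply: eq_bigr => a _ /=.
by rewrite !(linearD, linearZ).
Qed.
HB.instance Definition _ := GRing.isLinear.Build R W W _ Om casimir_is_linear.

(** Skew-symmetry makes the pairing of [Om f] with [f] minus a sum of squares. *)
Lemma casimir_ker f : Om f = 0 -> forall a, A a f = 0.
Proof.
move=> Of a; have : dot (Om f) f = 0 by rewrite Of -(scale0r f) dotZl mul0r.
rewrite /casimir dot_suml; under eq_bigr do rewrite A_anti.
rewrite sumrN => /eqP; rewrite oppr_eq0 psumr_eq0 => [/allP h0|b _]; last first.
  by apply: sumr_ge0 => x _; rewrite -expr2 sqr_ge0.
by apply: dot_eq0; apply/eqP; exact: (h0 a (mem_index_enum a)).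
Qed.

Lemma casimir_sym f g : dot (Om f) g = dot f (Om g).
Proof.
rewrite /casimir dot_suml [RHS]dotC dot_suml; apply: eq_bigr => a _.
by rewrite A_anti [RHS]A_anti dotC.
Qed.

Lemma casimir_sq f : Om (Om f) = 0 -> Om f = 0.
Proof.
move=> OOf; apply: dot_eq0; rewrite casimir_sym OOf dotC.
by rewrite -(scale0r f) dotZl mul0r.
Qed.

Lemma casimir_d f : Om (d f) = d (Om f).
Proof. by rewrite -!dhP linearD /= !d_sq linear0 addr0 add0r. Qed.

(** A symmetric operator for a definite form has kernel and image meeting in 0, also inside any
    stable subspace; dimensions do the rest. *)
Lemma casimir_decomp (U : {vspace W}) x : (forall y, y \in U -> Om y \in U) -> x \in U ->
  exists x0 y, [/\ x0 \in U, y \in U, Om x0 = 0 & x = x0 + Om y].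
Proof.
move=> stab xU; pose om := linfun Om.
have sub1 : ((U :&: lker om) + om @: U <= U)%VS.
  rewrite subv_add capvSl; apply/subvP => _ /memv_imgP[y yU ->].
  by rewrite lfunE; apply: stab.
have dj : ((U :&: lker om) :&: (om @: U))%VS = 0%VS.
  apply/eqP; rewrite -subv0; apply/subvP => y; rewrite !memv_cap memv0 memv_ker.
  move=> /andP[/andP[_ Oy]] /memv_imgP[z _ yE]; move: Oy; rewrite yE !lfunE /=.
  by move/eqP/casimir_sq => ->.
have : U = ((U :&: lker om) + om @: U)%VS.
  apply/esym/eqP; rewrite eqEdim sub1 dimv_disjoint_sum //.
  by rewrite limg_ker_dim leqnn.
move=> UE; move: xU; rewrite {1}UE => /memv_addP[x0 + [_ /memv_imgP[y yU ->] ->]].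
rewrite memv_cap memv_ker lfunE => /andP[x0U /eqP Ox0].
by exists x0, y; rewrite lfunE.
Qed.

(** Write x = x0 + Om (Om z) in [U] and d x = b0 + Om (Om b2) in [B]. Comparing non-harmonic parts
    gives Om (d z) = Om b2, which lies in [B]. As Om = d h + h d, the term Om (Om z) is d (h (Om z))
    + h (Om b2). The decomposition is iterated because only Om (d z), not d z, is known to lie in
    [B]. *)
Lemma harmonic_repr (U B : {vspace W}) x :
  (forall y, y \in U -> d y \in U) -> (forall y, y \in U -> h y \in U) ->
  (forall y, y \in B -> d y \in B) -> (forall y, y \in B -> h y \in B) ->
  x \in U -> d x \in B ->
  exists x0 u b, [/\ x0 \in U, Om x0 = 0, u \in U, b \in B & x = x0 + d u + b].
Proof.
move=> dU hU dB hB xU dxB.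
have OU y : y \in U -> Om y \in U by move=> yU; rewrite -dhP rpredD ?dU ?hU ?dU.
have OB y : y \in B -> Om y \in B by move=> yB; rewrite -dhP rpredD ?dB ?hB ?dB.
have [x0 [y [x0U yU Ox0 xE]]] := casimir_decomp OU xU.
have [y0 [z [_ zU Oy0 yE]]] := casimir_decomp OU yU.
have [b0 [b1 [_ b1B Ob0 dxE]]] := casimir_decomp OB dxB.
have [b1' [b2 [_ b2B Ob1' b1E]]] := casimir_decomp OB b1B.
have xE' : x = x0 + Om (Om z) by rewrite {1}xE yE linearD /= Oy0 add0r.
have dzE : Om (d z) = Om b2.
  apply/eqP; rewrite -subr_eq0 -linearB; apply/eqP; do 2!apply: casimir_sq => /=.
  have -> : Om (Om (d z - b2)) = b0 - d x0.
    rewrite !linearB /= !casimir_d.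
    have /eqP := dxE; rewrite {1}xE' b1E !linearD /= Ob1' add0r.
    rewrite -subr_eq0 => /eqP e; apply/eqP; rewrite -subr_eq0; apply/eqP.
    by rewrite -[RHS]e; apply/ffunP => t; rewrite !fockE; ring.
  by rewrite linearB /= casimir_d Ob0 Ox0 linear0 subr0.
exists x0, (h (Om z)), (h (Om b2)); split => //; rewrite ?hU ?hB ?OU ?OB //.
by rewrite xE' -[Om (Om z)]dhP -casimir_d dzE addrA.
Qed.

End Harmonic.

(** * Commutators and adjoints of Lie derivatives *)

Section MoreQuad.
Variables (R : numFieldType) (I D : finType) (rk : I -> nat).
Hypothesis rk_inj : injective rk.
Local Notation W := {ffun {set I} * D -> R^o}.

Lemma cr_an_cr b e y (f : W) :
  cr rk b (an rk e (cr rk y f)) = cr rk y (cr rk b (an rk e f)) + (e == y)%:R *: cr rk b f.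
Proof.
by rewrite an_cr // linearB /= linearZ /= cr_cr // opprK addrC.
Qed.

Lemma quad_cr m y (f : W) :
  quad rk m (cr rk y f) = cr rk y (quad rk m f) + \sum_b m b y *: cr rk b f.
Proof.
rewrite !quadE linear_sum -big_split; apply: eq_bigr => b _ /=.
rewrite linear_sum /= (bigD1 y) //= [in RHS](bigD1 y) //= cr_an_cr eqxx scale1r scalerDr.
rewrite linearZ /= -!addrA; congr (_ + _); rewrite addrC; congr (_ + _).
apply: eq_bigr => e /negPf ey; rewrite cr_an_cr ey scale0r addr0.
by rewrite linearZ.
Qed.

Lemma quad_cf m r (f : W) : quad rk m (cf r f) = cf r (quad rk m f).
Proof.
rewrite !quadE linear_sum; apply: eq_bigr => b _; rewrite linear_sum.
by apply: eq_bigr => e _; rewrite linearZ /= an_cf cr_cf.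
Qed.

Lemma lieop_cr r m y (f : W) :
  lieop rk r m (cr rk y f) = cr rk y (lieop rk r m f) - \sum_b m b y *: cr rk b f.
Proof. by rewrite !lieopE quad_cr -cr_cf linearB /= opprD addrA. Qed.

Lemma dot_lieop r m (f g : W) :
  dot (lieop rk r m f) g = dot f (lieop rk (fun d d' => r d' d) (fun b e => m e b) g).
Proof.
have dotNr (u v : W) : dot u (- v) = - dot u v by rewrite dotC dotNl dotC.
have dotDr (u v w : W) : dot u (v + w) = dot u v + dot u w by rewrite dotC dotDl !(dotC u).
rewrite !lieopE dotDl dotNl dot_cf dotDr dotNr; congr (_ - _).
rewrite !quadE dot_suml [RHS]dotC dot_suml; under eq_bigr do rewrite dot_suml.
under [RHS]eq_bigr do rewrite dot_suml.
rewrite exchange_big /=; apply: eq_bigr => e _; apply: eq_bigr => b _.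
by rewrite !dotZl !dot_cr dotC.
Qed.

End MoreQuad.

(** * The differential of the Euclidean algebra and its homotopy *)

Section EuclideanAlgebra.
Variables (R : realFieldType) (n : nat).
Local Notation P := (pairT n).
Local Notation H := (basisH n).
Local Notation WI := {ffun {set H} * H -> R^o}.
Local Notation W1 := {ffun {set H} * unit -> R^o}.
Local Notation c := (@ceuc R n).
Local Notation rho := (rho_coad c).

Definition rkP (a : P) : nat := enum_rank a.
(** Pairs precede translations, so that signs of operators on the so(n)-legs do not see the dx^i. *)
Definition rkH (x : H) : nat := match x with inl a => rkP a | inr i => #|{: P}| + i end.

Lemma rkP_inj : injective rkP.
Proof. by move=> a b /val_inj /enum_rank_inj. Qed.

Lemma rkP_lt a : (rkP a < #|{: P}|)%N.
Proof. exact: ltn_ord. Qed.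

Lemma rkH_inj : injective rkH.
Proof.
move=> [a|i] [b|j] //= => [/rkP_inj ->//|e|e|/addnI /val_inj -> //].
  by have := rkP_lt a; rewrite e ltnNge leq_addr.
by have := rkP_lt b; rewrite -e ltnNge leq_addr.
Qed.

Definition cso (a b e : P) : R := c (inl a) (inl b) (inl e).
Definition mV (a : P) (x y : H) : R :=
  match x, y with inr k, inr l => c (inl a) (inr k) (inr l) | _, _ => 0 end.
Definition mP (a : P) (x y : H) : R :=
  match x, y with inl b, inl e => cso a b e | _, _ => 0 end.

(** Only coefficients and vector legs are moved: the so(n)-legs are the arguments of a cochain with
    values in the module acted upon. *)
Definition act a : WI -> WI := lieop rkH (rho (inl a)) (mV a).
HB.instance Definition _ a := GRing.Linear.on (act a).

Definition transl (f : WI) : WI := \sum_i cr rkH (inr i) (cf (rho (inr i)) f).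
Definition dI : WI -> WI := dW rkH c rho.
HB.instance Definition _ := GRing.Linear.on dI.

Lemma transl_is_linear : linear transl.
Proof.
move=> k f g; rewrite /transl scaler_sumr -big_split; apply: eq_bigr => i _ /=.
by rewrite !linearP.
Qed.
HB.instance Definition _ := GRing.isLinear.Build R WI WI _ transl transl_is_linear.

Lemma c_split (D : finType) x (f : {ffun {set H} * D -> R^o}) : quad rkH (c x) f =
  match x with
  | inl a => quad rkH (mP a) f + quad rkH (mV a) f
  | inr k => \sum_a \sum_l so_mx R a l k *: cr rkH (inl a) (an rkH (inr l) f)
  end.
Proof.
rewrite quadE; case: x => [a|k].
  rewrite !quadE -big_split; apply: eq_bigr => b _; rewrite -big_split; apply: eq_bigr => e _.
  rewrite /= -scalerDl; congr (_ *: _).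
  by case: b e => [b|k] [e|l]; rewrite ?addr0 ?add0r.
rewrite big_sumType /=.
rewrite [X in _ + X]big1 ?addr0; last by move=> i _; rewrite big_sumType /= !big1 ?addr0 // => *; rewrite scale0r.
apply: eq_bigr => a _; rewrite big_sumType /= big1 ?add0r // => *; rewrite scale0r //.
Qed.

Lemma quad_mV a (D : finType) (f : {ffun {set H} * D -> R^o}) : quad rkH (mV a) f =
  \sum_k \sum_l (- so_mx R a l k) *: cr rkH (inr k) (an rkH (inr l) f).
Proof.
rewrite quadE big_sumType /= [X in X + _]big1 ?add0r => [|b _]; last first.
  by rewrite big1 // => e _; rewrite scale0r.
apply: eq_bigr => k _; rewrite big_sumType /= [X in X + _]big1 ?add0r // => e _.
exact: scale0r.
Qed.

Lemma cr_mixed (D : finType) (f : {ffun {set H} * D -> R^o}) : \sum_i cr rkH (inr i) (quad rkH (c (inr i)) f) =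
  \sum_a cr rkH (inl a) (quad rkH (mV a) f).
Proof.
under eq_bigr do rewrite c_split linear_sum /=.
rewrite exchange_big; apply: eq_bigr => a _ /=.
rewrite quad_mV linear_sum; apply: eq_bigr => k _ /=.
rewrite !linear_sum; apply: eq_bigr => l _ /=.
by rewrite !linearZ /= cr_cr ?scalerN ?scaleNr //; exact: rkH_inj.
Qed.

(** A mixed bracket occurs once for each order of its arguments. By [cr_mixed] the two halves agree
    and add up to the leg part of [act], whereas brackets inside so(n) keep [2^-1]. *)
Lemma dIE f : dI f =
  \sum_a cr rkH (inl a) (act a f - 2^-1 *: quad rkH (mP a) f) + transl f.
Proof.
have crB x (u v : WI) : cr rkH x (u - 2^-1 *: v) = cr rkH x u - 2^-1 *: cr rkH x v.
  by rewrite linearB /= linearZ.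
have actE a : act a f = cf (rho (inl a)) f - quad rkH (mV a) f by rewrite /act lieopE.
rewrite /dI dWE big_sumType /=.
under eq_bigr do rewrite crB c_split linearD /=.
under [X in _ + X]eq_bigr do rewrite crB.
under [X in _ = X + _]eq_bigr do rewrite crB actE linearB /=.
rewrite !sumrB -!scaler_sumr cr_mixed big_split -/(transl f) /=.
set s1 := \sum_i _; set s2 := \sum_i _; set s3 := \sum_i _.
apply/ffunP => x; rewrite !fockE; lra.
Qed.

Let an_crP a b (f : WI) : an rkH (inl a) (cr rkH (inl b) f) =
  (a == b)%:R *: f - cr rkH (inl b) (an rkH (inl a) f).
Proof. by rewrite an_cr //; exact: rkH_inj. Qed.

Lemma act_an a b f : an rkH (inl b) (act a f) = act a (an rkH (inl b) f).
Proof.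
rewrite /act an_lieop; last exact: rkH_inj.
by rewrite big1 ?subr0 // => e _; rewrite scale0r.
Qed.

Lemma act_cr a b f : cr rkH (inl b) (act a f) = act a (cr rkH (inl b) f).
Proof.
rewrite /act lieop_cr; last exact: rkH_inj.
by rewrite big1 ?subr0 // => -[e|e] _; rewrite scale0r.
Qed.

Lemma coad_rep a b d d' :
  \sum_e rho a d e * rho b e d' - \sum_e rho b d e * rho a e d' = \sum_e c a b e * rho e d d'.
Proof.
rewrite /rho_coad; under [RHS]eq_bigr do rewrite mulrN.
rewrite sumrN ceuc_jacobi opprB.
by congr (_ - _); apply: eq_bigr => e _; rewrite mulrNN.
Qed.

Lemma mV_rep a b z u :
  \sum_e mV b z e * mV a e u - \sum_e mV a z e * mV b e u = \sum_e cso a b e * mV e z u.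
Proof.
rewrite !big_sumType /= [X in X + _ - _]big1 ?add0r => [|e _]; last by case: z => *; rewrite mul0r.
rewrite [X in _ - (X + _)]big1 ?add0r => [|e _]; last by case: z => *; rewrite mul0r.
case: z => [z|k]; first by rewrite !big1 ?subrr // => *; rewrite ?mul0r ?mulr0.
case: u => [u|l]; first by rewrite !big1 ?subrr // => *; rewrite ?mul0r ?mulr0.
have := ceuc_jacobi R (inl a) (inl b) (inr k) (inr l); rewrite !big_sumType /=.
rewrite [X in _ + X = _]big1 ?addr0 => [|e _]; last by rewrite mul0r.
rewrite [X in _ = X + _ - _]big1 ?add0r => [|e _]; last by rewrite mul0r.
by rewrite [X in _ = _ - (X + _)]big1 ?add0r => [|e _]; last by rewrite mul0r.
Qed.

Lemma act_bracket a b f : act a (act b f) = act b (act a f) + \sum_e cso a b e *: act e f.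
Proof.
apply: (@lieop_bracket _ _ _ rkH rkH_inj _ (rho (inl a)) (mV a) (rho (inl b)) (mV b)
  (cso a b) (fun e => rho (inl e)) mV) => [d d'|z u]; last exact: mV_rep.
rewrite coad_rep big_sumType /= [X in _ + X]big1 ?addr0 // => i _; exact: mul0r.
Qed.

Lemma cso_anti a b e : cso a b e = - cso b a e.
Proof. exact: ceuc_anti. Qed.

Lemma cso_cyc a b e : cso a b e = - cso e b a.
Proof. exact: ceuc_cyc. Qed.

Lemma cso_skew a b e : cso a b e = - cso a e b.
Proof. by rewrite cso_cyc cso_anti opprK cso_cyc. Qed.

Definition dA : WI -> WI := ce_diff cso (fun a => cr rkH (inl a) : {linear WI -> WI})
  (fun a => an rkH (inl a) : {linear WI -> WI}) (fun a => act a : {linear WI -> WI}).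
HB.instance Definition _ := GRing.Linear.on dA.

Lemma quad_mP (D : finType) a (f : {ffun {set H} * D -> R^o}) : quad rkH (mP a) f =
  \sum_b \sum_e cso a b e *: cr rkH (inl b) (an rkH (inl e) f).
Proof.
rewrite quadE big_sumType /= [X in _ + X]big1 ?addr0; last first.
  by move=> i _; rewrite big1 // => e _; rewrite scale0r.
apply: eq_bigr => b _; rewrite big_sumType /= [X in _ + X]big1 ?addr0 // => i _.
exact: scale0r.
Qed.

Lemma dI_split f : dI f = dA f + transl f.
Proof.
rewrite dIE /dA ce_diffE; congr (_ + _); apply: eq_bigr => a _.
by rewrite ad_legE quad_mP.
Qed.

Definition hom (f : WI) : WI := homot (fun a => an rkH (inl a) : {linear WI -> WI})
  (fun a => act a : {linear WI -> WI}) f.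
Local Notation Om := (casimir (fun a => act a : {linear WI -> WI})).

Lemma hom_is_linear : linear hom.
Proof.
move=> k f g; rewrite /hom /homot scaler_sumr -big_split; apply: eq_bigr => a _ /=.
by rewrite !linearP.
Qed.
HB.instance Definition _ := GRing.isLinear.Build R WI WI _ hom hom_is_linear.

Lemma coad_bracket x y (f : WI) : cf (rho x) (cf (rho y) f) =
  cf (rho y) (cf (rho x) f) + \sum_e c x y e *: cf (rho e) f.
Proof.
rewrite !cf_cf; apply/ffunP => z; rewrite fockD !ffunE sum_ffunE.
under [X in _ = _ + X]eq_bigr do rewrite fockZ ffunE mulr_sumr.
rewrite exchange_big -big_split /=; apply: eq_bigr => d' _.
under [X in _ = _ + X]eq_bigr do rewrite mulrA.
rewrite -mulr_suml -mulrDl; congr (_ * _).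
by rewrite -coad_rep addrC subrK.
Qed.

Lemma act_cf a i (f : WI) : act a (cf (rho (inr i)) f) = cf (rho (inr i)) (act a f) +
  \sum_l c (inl a) (inr i) (inr l) *: cf (rho (inr l)) f.
Proof.
have cfB (u v : WI) : cf (rho (inr i)) (u - v) = cf (rho (inr i)) u - cf (rho (inr i)) v.
  by rewrite linearB.
rewrite /act !lieopE cfB quad_cf coad_bracket addrAC; congr (_ + _).
by rewrite big_sumType /= big1 ?add0r // => e _; rewrite scale0r.
Qed.

Lemma act_crV a i (f : WI) : act a (cr rkH (inr i) f) = cr rkH (inr i) (act a f) -
  \sum_k c (inl a) (inr k) (inr i) *: cr rkH (inr k) f.
Proof.
rewrite /act lieop_cr; last exact: rkH_inj.
by rewrite big_sumType /= [X in _ - (X + _)]big1 ?add0r // => b _; rewrite scale0r.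
Qed.

(** The operator pairs the dx^i with the action of the dual basis of translations, and this pairing
    is invariant. *)
Lemma act_transl a f : act a (transl f) = transl (act a f).
Proof.
rewrite /transl [act a (\sum_i _)]linear_sum /=.
have E i : act a (cr rkH (inr i) (cf (rho (inr i)) f)) =
   cr rkH (inr i) (cf (rho (inr i)) (act a f)) +
   (\sum_l c (inl a) (inr i) (inr l) *: cr rkH (inr i) (cf (rho (inr l)) f) -
    \sum_k c (inl a) (inr k) (inr i) *: cr rkH (inr k) (cf (rho (inr i)) f)).
  rewrite act_crV act_cf addrA; congr (_ - _).
  rewrite [cr _ _ (_ + _)]linearD /=; congr (_ + _); rewrite linear_sum.
  by apply: eq_bigr => l _; rewrite linearZ.
under eq_bigr do rewrite E.
by rewrite big_split sumrB exchange_big /= subrr addr0.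
Qed.

(** [homotP] covers the so(n)-part. The translation part commutes with [act] and anticommutes with
    contractions of so(n)-legs, hence contributes nothing. *)
Lemma homP f : dI (hom f) + hom (dI f) = Om f.
Proof.
rewrite !dI_split (linearD hom) /= addrACA.
have -> : dA (hom f) + hom (dA f) = Om f.
  apply: (homotP (R := R)) => [a b g|a b g|a b g|a b g|a b e|a b e|a b g].
  - exact: an_crP.
  - by rewrite /= an_an //; exact: rkH_inj.
  - exact: act_an.
  - exact: act_cr.
  - exact: cso_anti.
  - exact: cso_cyc.
  - exact: act_bracket.
rewrite -[RHS]addr0; congr (_ + _).
rewrite /hom /homot [transl (\sum_a _)]linear_sum -big_split big1 // => a _ /=.
rewrite act_transl; have : forall g, transl (an rkH (inl a) g) = - an rkH (inl a) (transl g).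
  move=> g; rewrite /transl linear_sum -sumrN; apply: eq_bigr => i _ /=.
  by rewrite an_cr ?scale0r ?sub0r ?opprK ?an_cf //; exact: rkH_inj.
by move=> ->; rewrite addNr.
Qed.

Lemma dI_sq f : dI (dI f) = 0.
Proof.
apply: dW_sq; first exact: rkH_inj.
- exact: ceuc_anti.
- exact: ceuc_jacobi.
- exact: coad_rep.
Qed.

(** In the chosen bases an element of so(n) acts by skew matrices on the coefficients and on the
    vector legs. *)
Lemma act_anti a f g : dot (act a f) g = - dot f (act a g).
Proof.
have c_skew x y : c (inl a) x y = - c (inl a) y x.
  case: x y => [b|k] [e|l]; [exact: cso_skew|by rewrite /= oppr0..|].
  by rewrite /= so_mx_anti.
have dotNr (u v : WI) : dot u (- v) = - dot u v by rewrite dotC dotNl dotC.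
rewrite /act dot_lieop -dotNr; congr (dot f _).
rewrite !lieopE opprD; congr (_ - _).
  apply/ffunP => x; rewrite fockN !ffunE -sumrN; apply: eq_bigr => d _.
  by rewrite /rho_coad c_skew opprK mulNr opprK.
rewrite !quadE -sumrN; apply: eq_bigr => x _; rewrite -sumrN; apply: eq_bigr => y _.
rewrite -scaleNr; congr (_ *: _); case: x y => [b|k] [e|l]; rewrite /mV ?oppr0 //.
Qed.

End EuclideanAlgebra.

(** * Invariants of so(n) *)

Section Invariants.
Variables (R : numFieldType) (X : finType) (n : nat).
Local Notation U := {ffun X -> R^o}.
Variables (C N : 'I_n -> {linear U -> U}).
Hypothesis NC : forall a b f, N a (C b f) = (a == b)%:R *: f - C b (N a f).
Hypothesis NN : forall a b f, N a (N b f) = - N b (N a f).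
Hypothesis CC : forall a b f, C a (C b f) = - C b (C a f).

(** The infinitesimal rotation in the plane (i, j), acting on forms. *)
Definition rot i j (y : U) : U := C i (N j y) - C j (N i y).

Lemma rot_is_linear i j : linear (rot i j).
Proof. by move=> k f g; rewrite /rot !linearP; apply/ffunP => x; rewrite !fockE; ring. Qed.
HB.instance Definition _ i j := GRing.isLinear.Build R U U _ (rot i j) (rot_is_linear i j).

Lemma rot_C i j k y :
  rot i j (C k y) = C k (rot i j y) + (k == j)%:R *: C i y - (k == i)%:R *: C j y.
Proof.
rewrite /rot !NC !linearB !linearZ /= (CC i k) (CC j k) ![_ == k]eq_sym.
by apply/ffunP => x; rewrite !fockE; ring.
Qed.

Lemma rot_N i j k y :
  rot i j (N k y) = N k (rot i j y) - (k == i)%:R *: N j y + (k == j)%:R *: N i y.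
Proof.
rewrite /rot linearB /= !NC (NN j k) (NN i k) !linearN.
by apply/ffunP => x; rewrite !fockE; ring.
Qed.

Definition vec_invariant (F : 'I_n -> U) := forall i j k,
  rot i j (F k) + (k == i)%:R *: F j - (k == j)%:R *: F i = 0.

Definition bivec_invariant (F : 'I_n -> 'I_n -> U) := forall i j k l,
  rot i j (F k l) + (k == i)%:R *: F j l - (k == j)%:R *: F i l
  + (l == i)%:R *: F k j - (l == j)%:R *: F k i = 0.

Lemma sum_deltaC (j : 'I_n) (F : 'I_n -> U) : \sum_k (k == j)%:R *: F k = F j.
Proof. by under eq_bigr do rewrite eq_sym; rewrite sum_delta. Qed.

Lemma sum_rot j F : \sum_i rot i j (F i) = F j - N j (\sum_i C i (F i)) - C j (\sum_i N i (F i)).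
Proof.
rewrite /rot sumrB [N j (\sum_i _)]linear_sum [C j (\sum_i _)]linear_sum /=; congr (_ - _).
rewrite -[X in _ = X - _](sum_delta j) -sumrB; apply: eq_bigr => i _.
by rewrite NC opprB addrC subrK.
Qed.

(** Setting k = i in the invariance equation and summing over i expresses F through two scalar
    invariants. This is the invariant theory in degree one. *)
Lemma vec_repr F : vec_invariant F -> forall j,
  n%:R *: F j = N j (\sum_i C i (F i)) + C j (\sum_i N i (F i)).
Proof.
move=> Finv j; have : \sum_i (rot i j (F i) + (i == i)%:R *: F j - (i == j)%:R *: F i) = 0.
  by apply: big1 => i _; apply: Finv.
rewrite sumrB big_split /= sum_rot sum_deltaC.
under eq_bigr do rewrite eqxx scale1r.
rewrite sumr_const card_ord -scaler_nat; set q := N j _; set p := C j _ => e.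
rewrite -[RHS]addr0 -e; apply/ffunP => x; rewrite !fockE; ring.
Qed.

Lemma vec_C F : vec_invariant F -> forall i j, rot i j (\sum_k C k (F k)) = 0.
Proof.
move=> Finv i j; rewrite linear_sum /=; under eq_bigr do rewrite rot_C.
rewrite sumrB big_split /=.
rewrite !sum_deltaC.
have E k : C k (rot i j (F k)) = (k == j)%:R *: C k (F i) - (k == i)%:R *: C k (F j).
  rewrite -!linearZ -linearB /=; congr (C k _); have := Finv i j k => e.
  by rewrite -[LHS]subr0 -e; apply/ffunP => x; rewrite !fockE; ring.
under eq_bigr do rewrite E.
by rewrite sumrB !sum_deltaC; apply/ffunP => x; rewrite !fockE; ring.
Qed.

Lemma vec_N F : vec_invariant F -> forall i j, rot i j (\sum_k N k (F k)) = 0.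
Proof.
move=> Finv i j; rewrite linear_sum /=; under eq_bigr do rewrite rot_N.
rewrite big_split sumrB /= !sum_deltaC.
have E k : N k (rot i j (F k)) = (k == j)%:R *: N k (F i) - (k == i)%:R *: N k (F j).
  rewrite -!linearZ -linearB /=; congr (N k _); have := Finv i j k => e.
  by rewrite -[LHS]subr0 -e; apply/ffunP => x; rewrite !fockE; ring.
under eq_bigr do rewrite E.
by rewrite sumrB !sum_deltaC; apply/ffunP => x; rewrite !fockE; ring.
Qed.

Lemma vec_invariant_CN p q : (forall i j, rot i j p = 0) -> (forall i j, rot i j q = 0) ->
  vec_invariant (fun k => C k p + N k q).
Proof.
move=> p0 q0 i j k; rewrite linearD /= rot_C rot_N p0 q0 !linear0.
apply/ffunP => x; rewrite !fockE; ring.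
Qed.

Section Bivector.
Variable F : 'I_n -> 'I_n -> U.
Hypothesis Fanti : forall k l, F k l = - F l k.
Hypothesis Finv : bivec_invariant F.

Let rotF i j k l : rot i j (F k l) = (k == j)%:R *: F i l - (k == i)%:R *: F j l
  + (l == j)%:R *: F k i - (l == i)%:R *: F k j.
Proof.
rewrite -[LHS]subr0 -(Finv i j k l); apply/ffunP => x; rewrite !fockE; ring.
Qed.

Let Fdiag k : F k k = 0.
Proof.
apply/ffunP => x; have := congr1 (fun f : U => f x) (Fanti k k); rewrite fockN fock0 => e.
by apply/eqP; rewrite -eqNr; apply/eqP.
Qed.

(** The trace over i = k again. The factor drops from n to n - 1 because rotating the second index
    contributes F l j = - F j l. *)
Lemma bivec_repr j l : (n%:R - 1) *: F j l =
  N j (\sum_i C i (F i l)) + C j (\sum_i N i (F i l)).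
Proof.
have := sum_rot j (fun i => F i l); under eq_bigr do rewrite rotF.
rewrite sumrB big_split sumrB /= sum_deltaC.
under [X in _ - X + _ - _ = _]eq_bigr do rewrite eqxx scale1r.
rewrite sumr_const card_ord -scaler_nat.
under [X in _ + X - _ = _]eq_bigr do rewrite Fdiag scaler0.
rewrite big1_eq; under eq_bigr do rewrite eq_sym.
rewrite sum_deltaC (Fanti l j); set q := N j _; set p := C j _ => e.
have {}e : F j l - q - p - (F j l - n%:R *: F j l + 0 - - F j l) = 0 by rewrite e subrr.
rewrite -[RHS]addr0 -e; apply/ffunP => x; rewrite !fockE; ring.
Qed.

Lemma bivec_C : vec_invariant (fun l => \sum_k C k (F k l)).
Proof.
move=> i j l; rewrite linear_sum /=; under eq_bigr do rewrite rot_C rotF.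
rewrite sumrB big_split /=.
rewrite !sum_deltaC.
have -> : \sum_k C k ((k == j)%:R *: F i l - (k == i)%:R *: F j l
  + (l == j)%:R *: F k i - (l == i)%:R *: F k j) =
  C j (F i l) - C i (F j l) + (l == j)%:R *: \sum_k C k (F k i)
   - (l == i)%:R *: \sum_k C k (F k j).
  rewrite -(sum_deltaC j (fun k => C k (F i l))) -(sum_deltaC i (fun k => C k (F j l))).
  rewrite !scaler_sumr -!sumrB -big_split -sumrB; apply: eq_bigr => k _ /=.
  by rewrite linearB linearD linearB /= !linearZ.
by apply/ffunP => x; rewrite !fockE; ring.
Qed.

Lemma bivec_N : vec_invariant (fun l => \sum_k N k (F k l)).
Proof.
move=> i j l; rewrite linear_sum /=; under eq_bigr do rewrite rot_N rotF.
rewrite big_split sumrB /= !sum_deltaC.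
have -> : \sum_k N k ((k == j)%:R *: F i l - (k == i)%:R *: F j l
  + (l == j)%:R *: F k i - (l == i)%:R *: F k j) =
  N j (F i l) - N i (F j l) + (l == j)%:R *: \sum_k N k (F k i)
   - (l == i)%:R *: \sum_k N k (F k j).
  rewrite -(sum_deltaC j (fun k => N k (F i l))) -(sum_deltaC i (fun k => N k (F j l))).
  rewrite !scaler_sumr -!sumrB -big_split -sumrB; apply: eq_bigr => k _ /=.
  by rewrite linearB linearD linearB /= !linearZ.
by apply/ffunP => x; rewrite !fockE; ring.
Qed.

End Bivector.

Lemma bivec_invariant_CC z : (forall i j, rot i j z = 0) ->
  bivec_invariant (fun k l => C k (C l z)).
Proof.
move=> z0 i j k l; rewrite !rot_C z0 linear0 add0r [C k (_ - _)]linearB /= ![C k (_ *: _)]linearZ /=.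
apply/ffunP => x; rewrite !fockE; ring.
Qed.

Lemma bivec_invariant_NN z : (forall i j, rot i j z = 0) ->
  bivec_invariant (fun k l => N k (N l z)).
Proof.
move=> z0 i j k l; rewrite !rot_N z0 linear0 sub0r [N k (_ + _)]linearD /= linearN /= ![N k (_ *: _)]linearZ /=.
apply/ffunP => x; rewrite !fockE; ring.
Qed.

End Invariants.

(** * Invariant cochains of the Euclidean algebra *)

Section InvariantCochains.
Variables (R : realFieldType) (n : nat).
Local Notation P := (pairT n).
Local Notation H := (basisH n).
Local Notation WI := {ffun {set H} * H -> R^o}.
Local Notation W1 := {ffun {set H} * unit -> R^o}.
Local Notation Wso := {ffun {set P} * unit -> R^o}.
Local Notation c := (@ceuc R n).
Local Notation rkH := (@rkH n).
Local Notation rkP := (@rkP n).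

Definition Cv (i : 'I_n) : {linear W1 -> W1} := cr rkH (inr i) : {linear W1 -> W1}.
Definition Nv (i : 'I_n) : {linear W1 -> W1} := an rkH (inr i) : {linear W1 -> W1}.
Local Notation rotv := (rot Cv Nv).

Lemma NCv i j y : Nv i (Cv j y) = (i == j)%:R *: y - Cv j (Nv i y).
Proof. by rewrite /Nv /Cv /= an_cr //; exact: rkH_inj. Qed.
Lemma NNv i j y : Nv i (Nv j y) = - Nv j (Nv i y).
Proof. by rewrite /Nv /= an_an //; exact: rkH_inj. Qed.
Lemma CCv i j y : Cv i (Cv j y) = - Cv j (Cv i y).
Proof. by rewrite /Cv /= cr_cr //; exact: rkH_inj. Qed.

Lemma sum_so1 (V : lmodType R) (a : P) k (G : 'I_n -> V) :
  \sum_u so_mx R a u k *: G u =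
  (k == (val a).1)%:R *: G (val a).2 - (k == (val a).2)%:R *: G (val a).1.
Proof.
under eq_bigr do rewrite so_mxE scalerBl; rewrite sumrB; congr (_ - _).
  rewrite (bigD1 (val a).2) //= eqxx big1 ?addr0 // => u /negPf ->.
  by rewrite scale0r.
rewrite (bigD1 (val a).1) //= eqxx big1 ?addr0 // => u /negPf ->.
by rewrite scale0r.
Qed.

Lemma sum_so (V : lmodType R) (a : P) (G : 'I_n -> 'I_n -> V) :
  \sum_k \sum_l so_mx R a l k *: G k l = G (val a).1 (val a).2 - G (val a).2 (val a).1.
Proof.
under eq_bigr do rewrite sum_so1.
rewrite sumrB; congr (_ - _).
  under eq_bigr do rewrite eq_sym; rewrite sum_delta //.
by under eq_bigr do rewrite eq_sym; rewrite sum_delta.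
Qed.

Lemma comp_act b a (f : WI) : comp b (act a f) =
  \sum_e - c (inl a) b e *: comp e f + rotv (val a).1 (val a).2 (comp b f).
Proof.
rewrite /act lieopE linearB /= comp_cf comp_quad quad_mV; congr (_ + _).
under eq_bigr do under eq_bigr do rewrite scaleNr.
under eq_bigr do rewrite sumrN.
by rewrite sumrN opprK sum_so.
Qed.

Lemma comp_actV a k (f : WI) : comp (inr k) (act a f) =
  rotv (val a).1 (val a).2 (comp (inr k) f) +
  (k == (val a).1)%:R *: comp (inr (val a).2) f - (k == (val a).2)%:R *: comp (inr (val a).1) f.
Proof.
rewrite comp_act big_sumType /= big1 ?add0r => [|e _]; last by rewrite oppr0 scale0r.
under eq_bigr do rewrite opprK.
by rewrite sum_so1 addrC addrA.
Qed.

(** The so(n)'-components, extended antisymmetrically to all index pairs; they then transform like a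
    bivector. *)
Definition bi (f : WI) (k l : 'I_n) : W1 := \sum_b so_mx R b l k *: comp (inl b) f.

Lemma bi_anti f k l : bi f k l = - bi f l k.
Proof. by rewrite /bi -sumrN; apply: eq_bigr => b _; rewrite so_mx_anti scaleNr. Qed.

Lemma sum_pairs (V : lmodType R) (G : 'I_n -> 'I_n -> V) k l :
  (forall i j, G i j = - G j i) ->
  \sum_b so_mx R b l k *: G (val b).1 (val b).2 = G k l.
Proof.
move=> Ganti.
have lt_case (i j : 'I_n) : (i < j)%N ->
    \sum_b so_mx R b j i *: G (val b).1 (val b).2 = G i j.
  move=> ij; rewrite (bigD1 (ordpair ij)) //= so_mx_anti so_mx_lt // !eqxx opprK scale1r.
  rewrite big1 ?addr0 // => b ne; rewrite so_mx_anti so_mx_lt // opprK.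
  case: andP => [[/eqP eu /eqP ev]|_]; last by rewrite scale0r.
  by case/negP: ne; apply/eqP/val_inj; rewrite /= eu ev -surjective_pairing.
case: (ltngtP k l) => kl; first exact: lt_case.
  rewrite Ganti -(lt_case _ _ kl) -sumrN; apply: eq_bigr => b _.
  by rewrite so_mx_anti scaleNr.
have {kl} <- := val_inj kl; have Gkk : G k k = 0.
  have /eqP := Ganti k k; rewrite -subr_eq0 opprK -mulr2n -scaler_nat scaler_eq0 pnatr_eq0 /=.
  by move/eqP.
rewrite Gkk big1 // => b _.
have -> : so_mx R b k k = 0; last by rewrite scale0r.
by apply/eqP; rewrite -eqNr -so_mx_anti.
Qed.

Lemma bi_pair f b : bi f (val b).1 (val b).2 = comp (inl b) f.
Proof.
rewrite /bi (bigD1 b) //= so_mx_anti so_mx_lt ?(valP b) // !eqxx opprK scale1r.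
rewrite big1 ?addr0 // => e ne; rewrite so_mx_anti so_mx_lt ?(valP b) // opprK.
case: andP => [[/eqP eu /eqP ev]|_]; last by rewrite scale0r.
by case/negP: ne; apply/eqP/val_inj; rewrite [RHS]surjective_pairing eu ev -surjective_pairing.
Qed.

(** Total antisymmetry moves the coadjoint action onto the basis matrices, where it is a commutator
    whose entries act on one index at a time. *)
Lemma bi_act a f k l (i := (val a).1) (j := (val a).2) : bi (act a f) k l =
  rotv i j (bi f k l) + (k == i)%:R *: bi f j l - (k == j)%:R *: bi f i l
  + (l == i)%:R *: bi f k j - (l == j)%:R *: bi f k i.
Proof.
rewrite /bi; under eq_bigr do rewrite comp_act scalerDr.
rewrite big_split [rotv i j _]linear_sum /= addrC -!addrA; congr (_ + _).
  by apply: eq_bigr => b _; rewrite linearZ.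
rewrite !addrA.
have E b : so_mx R b l k *: (\sum_e - c (inl a) (inl b) e *: comp e f) =
    \sum_e (c (inl a) (inl e) (inl b) * so_mx R b l k) *: comp (inl e) f.
  rewrite big_sumType /= [X in _ + X]big1 ?addr0 => [|v _]; last by rewrite oppr0 scale0r.
  rewrite scaler_sumr; apply: eq_bigr => e _; rewrite scalerA mulrC; congr (_ * _ *: _).
  by apply/eqP; rewrite eqr_oppLR; apply/eqP; exact: cso_skew.
under eq_bigr do rewrite E.
rewrite exchange_big /=; under eq_bigr do rewrite -scaler_suml.
have E2 e : \sum_b c (inl a) (inl e) (inl b) * so_mx R b l k =
    \sum_u (so_mx R a u k * so_mx R e l u - so_mx R a l u * so_mx R e u k).
  have /matrixP /(_ l k) := so_closed R a e.
  rewrite [RHS]summxE => e1; transitivity ((so_mx R e *m so_mx R a - so_mx R a *m so_mx R e) l k).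
    by rewrite e1; apply: eq_bigr => b _; rewrite [RHS]mxE.
  rewrite mxE [X in _ + X]mxE [X in X + _]mxE [X in _ - X]mxE -sumrB.
  by apply: eq_bigr => u _; rewrite [in LHS]mulrC.
under eq_bigr do rewrite E2 scaler_suml.
rewrite exchange_big /=.
transitivity (\sum_u so_mx R a u k *: bi f u l + \sum_u so_mx R a u l *: bi f k u).
  rewrite -big_split; apply: eq_bigr => u _; rewrite /bi !scaler_sumr -big_split /=.
  apply: eq_bigr => e _; rewrite scalerBl !scalerA; congr (_ + _).
  by rewrite [so_mx R a l u]so_mx_anti mulNr scaleNr opprK.
by rewrite !sum_so1 addrA.
Qed.

Definition SP (S : {set H}) : {set P} := [set a | inl a \in S].
Definition SV (S : {set H}) : {set 'I_n} := [set i | inr i \in S].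

Lemma sgH_inl a (S : {set H}) : sg R rkH (inl a) S = sg R rkP a (SP S).
Proof.
rewrite /sg; congr (_ ^+ _); rewrite -(card_imset _ (@inl_inj P 'I_n)); apply: eq_card => x.
rewrite inE; apply/andP/imsetP => [[xS]|[b + ->]].
  case: x xS => [b|i] xS /=; first by exists b => //; rewrite !inE xS.
  by rewrite ltnNge (leq_trans (ltnW (rkP_lt a))) ?leq_addr.
by rewrite !inE => /andP.
Qed.

(* [emb T f] is the product of [f] with the [dx^i], [i] in [T]. *)
Definition emb (T : {set 'I_n}) (f : Wso) : W1 :=
  [ffun x : {set H} * unit => if SV x.1 == T then f (SP x.1, tt) else 0].

Lemma emb_is_linear T : linear (emb T).
Proof. by move=> k f g; apply/ffunP => x; rewrite !ffunE; case: eqP; rewrite ?scaler0 ?addr0. Qed.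
HB.instance Definition _ T := GRing.isLinear.Build R Wso W1 _ (emb T) (emb_is_linear T).

Lemma emb_cr T a f : emb T (cr rkP a f) = cr rkH (inl a) (emb T f).
Proof.
apply/ffunP => [[S []]]; rewrite !ffunE /= inE sgH_inl.
have -> : SV (S :\ inl a) = SV S by apply/setP => i; rewrite !inE.
have -> : SP (S :\ inl a) = SP S :\ a by apply/setP => b; rewrite !inE.
by case: eqP => _; case: ifP => _; rewrite ?mulr0.
Qed.

Lemma emb_an T a f : emb T (an rkP a f) = an rkH (inl a) (emb T f).
Proof.
apply/ffunP => [[S []]]; rewrite !ffunE /= inE sgH_inl.
have -> : SV (inl a |: S) = SV S by apply/setP => i; rewrite !inE.
have -> : SP (inl a |: S) = a |: SP S by apply/setP => b; rewrite !inE.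
by case: eqP => _; case: ifP => _; rewrite ?mulr0.
Qed.

Lemma Nv_emb0 i f : Nv i (emb set0 f) = 0.
Proof.
apply/ffunP => [[S []]]; rewrite /Nv /= !ffunE /=; case: ifP => // _.
case: eqP => [/setP /(_ i)|_]; last by rewrite mulr0.
by rewrite !inE eqxx.
Qed.

Lemma Cv_embT i f : Cv i (emb setT f) = 0.
Proof.
apply/ffunP => [[S []]]; rewrite /Cv /= !ffunE /=; case: ifP => // _.
case: eqP => [/setP /(_ i)|_]; last by rewrite mulr0.
by rewrite !inE eqxx.
Qed.

Lemma rot_emb0 i j f : rotv i j (emb set0 f) = 0.
Proof. by rewrite /rot !Nv_emb0 !linear0 addr0. Qed.

(** On the volume form Cv k after Nv l is delta_kl, which is symmetric, while [rot]
    antisymmetrises. *)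
Lemma rot_embT i j f : rotv i j (emb setT f) = 0.
Proof.
have CN k l : Cv k (Nv l (emb setT f)) = (l == k)%:R *: emb setT f.
  by have /eqP := NCv l k (emb setT f); rewrite Cv_embT linear0 eq_sym subr_eq0 => /eqP.
by rewrite /rot !CN [i == j]eq_sym subrr.
Qed.

Definition join (Q : {set P}) (T : {set 'I_n}) : {set H} := inl @: Q :|: inr @: T.

Lemma join_SPSV S : join (SP S) (SV S) = S.
Proof.
apply/setP => x; rewrite !inE; apply/orP/idP => [[] /imsetP[y + ->]|]; rewrite ?inE //.
by case: x => [a|i] xS; [left|right]; apply/imsetP; [exists a|exists i]; rewrite ?inE.
Qed.

Lemma SP_join Q T : SP (join Q T) = Q.
Proof.
apply/setP => a; rewrite !inE; apply/orP/idP => [[] /imsetP[b + [//]] [->]//|aQ].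
by left; apply/imsetP; exists a.
Qed.

Lemma SV_join Q T : SV (join Q T) = T.
Proof.
apply/setP => a; rewrite !inE; apply/orP/idP => [[] /imsetP[b + [//]] [->]//|aQ].
by right; apply/imsetP; exists a.
Qed.

Definition res (T : {set 'I_n}) (y : W1) : Wso := [ffun x : {set P} * unit => y (join x.1 T, tt)].

Lemma resK T : cancel (emb T) (res T).
Proof. by move=> f; apply/ffunP => [[Q []]]; rewrite !ffunE /= SV_join SP_join eqxx. Qed.

(** If [S] contains dx^i but not dx^j, evaluate the rotation at [S] with i replaced by j: the only
    surviving term is the value of [y] at [S], up to sign. Hence only none or all of the dx^i may
    occur. *)
Lemma scalar_invariant y : (0 < n)%N -> (forall i j, rotv i j y = 0) ->
  y = emb set0 (res set0 y) + emb setT (res setT y).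
Proof.
move=> n0 y0; have neT : (set0 : {set 'I_n}) != setT.
  by apply/eqP => /setP /(_ (Ordinal n0)); rewrite !inE.
apply/ffunP => [[S []]]; rewrite fockD !ffunE /=.
have [S0|[i iS]] := set_0Vmem (SV S).
  by rewrite S0 eqxx (negPf neT) addr0 -{1}(join_SPSV S) S0.
rewrite (negPf (_ : SV S != set0)); last by apply/set0Pn; exists i.
rewrite add0r; case: eqP => [ST|SnT]; first by rewrite -{1}(join_SPSV S) ST.
have [j jS] : exists j, j \notin SV S.
  apply/existsP; rewrite -negb_forall; apply/negP => /forallP h.
  by apply: SnT; apply/setP => j; rewrite h inE.
rewrite !inE in iS jS.
have ij : i != j by apply: contraNneq jS => <-.
have /ffunP /(_ (inr j |: (S :\ inr i), tt)) := y0 j i.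
have ijH : (inr i == inr j :> H) = false by apply/negbTE; apply: contraNneq ij => -[->].
rewrite /rot /Cv /Nv /= !ffunE /= !inE !eqxx [inr j == inr i]eq_sym ijH /= subr0.
rewrite setU1K ?inE ?(negPf jS) ?andbF // setD1K // => /eqP.
by rewrite !mulf_eq0 !signr_eq0 => /eqP.
Qed.

Definition dP (D : finType) (f : {ffun {set H} * D -> R^o}) : {ffun {set H} * D -> R^o} :=
  \sum_a cr rkH (inl a) (- (2^-1 *: quad rkH (mP R a) f)).
Definition ds : Wso -> Wso := dW rkP (@cso R n) (@rho_triv R P).
HB.instance Definition _ := GRing.Linear.on ds.

Lemma emb_ds T f : emb T (ds f) = dP (emb T f).
Proof.
rewrite /ds dW_trivE linear_sum; apply: eq_bigr => a _ /=.
rewrite emb_cr linearN linearZ /= quad_mP quadE; congr (cr _ _ (- (_ *: _))).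
rewrite linear_sum; apply: eq_bigr => b _; rewrite linear_sum; apply: eq_bigr => e _ /=.
by rewrite linearZ /= emb_cr emb_an.
Qed.

Lemma comp_dP (D : finType) b (f : {ffun {set H} * D -> R^o}) : comp b (dP f) = dP (comp b f).
Proof.
rewrite linear_sum; apply: eq_bigr => a _ /=.
by rewrite comp_cr linearN linearZ /= comp_quad.
Qed.

Lemma dP_C i y : dP (Cv i y) = - Cv i (dP y).
Proof.
rewrite /dP linear_sum -sumrN; apply: eq_bigr => a _ /=.
rewrite quad_cr; last exact: rkH_inj.
rewrite [X in _ + X]big1 ?addr0 => [|[b|k] _]; try by rewrite scale0r.
rewrite [X in _ = - X](cr_cr (@rkH_inj n)) opprK; congr (cr _ _ _).
by rewrite [RHS]linearN /= [cr _ _ (_ *: _)]linearZ /=.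
Qed.

Lemma dP_N i y : dP (Nv i y) = - Nv i (dP y).
Proof.
rewrite /dP linear_sum -sumrN; apply: eq_bigr => a _ /=.
rewrite an_cr; last exact: rkH_inj.
rewrite scale0r sub0r opprK; congr (cr _ _ _).
rewrite [an _ _ (- _)]linearN /= [an _ _ (_ *: _)]linearZ /= an_quad; last exact: rkH_inj.
by rewrite [X in _ + X]big1 ?addr0 // => e _; rewrite scale0r.
Qed.

Definition assemble (F : H -> W1) : WI := [ffun x : {set H} * H => F x.2 (x.1, tt)].

Lemma comp_assemble F b : comp b (assemble F) = F b.
Proof. by apply/ffunP => [[S []]]; rewrite !ffunE. Qed.

(* The four families of so(n)-invariants of the exterior algebra with
   coefficients in the coadjoint module: the metric, its coboundary, the class
   gamma and the contracted volume form. *)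
Definition phi_metric (f : Wso) := assemble (fun b =>
  match b with inl _ => 0 | inr k => Cv k (emb set0 f) end).
Definition phi_wedge (f : Wso) := assemble (fun b =>
  match b with inl b => Cv (val b).1 (Cv (val b).2 (emb set0 f)) | inr _ => 0 end).
Definition phi_gamma (f : Wso) := assemble (fun b =>
  match b with inl b => Nv (val b).1 (Nv (val b).2 (emb setT f)) | inr _ => 0 end).
Definition phi_vol (f : Wso) := assemble (fun b =>
  match b with inl _ => 0 | inr k => Nv k (emb setT f) end).

Lemma phi_metric_is_linear : linear phi_metric.
Proof.
move=> k f g; apply: compP => b; rewrite [RHS]linearD /= linearZ /= !comp_assemble.
by case: b => [b|b]; rewrite ?scaler0 ?addr0 // !(linearD, linearZ).
Qed.
HB.instance Definition _ := GRing.isLinear.Build R Wso WI _ phi_metric phi_metric_is_linear.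

Lemma phi_wedge_is_linear : linear phi_wedge.
Proof.
move=> k f g; apply: compP => b; rewrite [RHS]linearD /= linearZ /= !comp_assemble.
by case: b => [b|b]; rewrite ?scaler0 ?addr0 // !(linearD, linearZ).
Qed.
HB.instance Definition _ := GRing.isLinear.Build R Wso WI _ phi_wedge phi_wedge_is_linear.

Lemma phi_gamma_is_linear : linear phi_gamma.
Proof.
move=> k f g; apply: compP => b; rewrite [RHS]linearD /= linearZ /= !comp_assemble.
by case: b => [b|b]; rewrite ?scaler0 ?addr0 // !(linearD, linearZ).
Qed.
HB.instance Definition _ := GRing.isLinear.Build R Wso WI _ phi_gamma phi_gamma_is_linear.

Lemma transl_comp b (f : WI) : comp b (transl f) =
  match b with
  | inl b => - (Cv (val b).1 (comp (inr (val b).2) f) - Cv (val b).2 (comp (inr (val b).1) f))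
  | inr _ => 0
  end.
Proof.
rewrite /transl linear_sum /=.
under eq_bigr do rewrite comp_cr comp_cf big_sumType linearD /=.
case: b => [b|k]; last first.
  rewrite big1 // => i _; rewrite !big1 ?linear0 ?addr0 // => e _;
  by rewrite /rho_coad /= oppr0 scale0r.
rewrite -(sum_so b (fun i l => Cv i (comp (inr l) f))) -sumrN; apply: eq_bigr => i _.
rewrite [X in cr _ _ X + _]big1 => [|e _]; last by rewrite /rho_coad /= oppr0 scale0r.
rewrite linear0 add0r linear_sum -sumrN; apply: eq_bigr => l _ /=.
by rewrite linearZ /rho_coad /= scaleNr.
Qed.

Lemma dI_invariant f : (forall a, act a f = 0) -> dI f = dP f + transl f.
Proof.
by move=> f0; rewrite dIE; congr (_ + _); apply: eq_bigr => a _; rewrite f0 sub0r.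
Qed.

Lemma bi_phi_metric f k l : bi (phi_metric f) k l = 0.
Proof. by rewrite /bi big1 // => b _; rewrite comp_assemble scaler0. Qed.

Lemma bi_phi_wedge f k l : bi (phi_wedge f) k l = Cv k (Cv l (emb set0 f)).
Proof.
rewrite -(sum_pairs k l (fun i j => CCv i j (emb set0 f))); apply: eq_bigr => b _.
by rewrite comp_assemble.
Qed.

Lemma bi_phi_gamma f k l : bi (phi_gamma f) k l = Nv k (Nv l (emb setT f)).
Proof.
rewrite -(sum_pairs k l (fun i j => NNv i j (emb setT f))); apply: eq_bigr => b _.
by rewrite comp_assemble.
Qed.

Lemma act_eq0 f : vec_invariant Cv Nv (fun k => comp (inr k) f) ->
  bivec_invariant Cv Nv (bi f) -> forall a, act a f = 0.
Proof.
move=> vf bf a; apply: compP => b; rewrite linear0.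
by case: b => [b|k]; [rewrite -bi_pair bi_act bf|rewrite comp_actV vf].
Qed.

Lemma act_phi_metric f a : act a (phi_metric f) = 0.
Proof.
apply: act_eq0 => [i j k|i j k l]; last by rewrite !bi_phi_metric linear0 !scaler0 !(addr0, subr0).
rewrite !comp_assemble; have := vec_invariant_CN NCv NNv CCv
  (fun i j => rot_emb0 i j f) (fun i j => linear0 (rotv i j)) i j k.
by rewrite !linear0 !addr0.
Qed.

Lemma act_phi_wedge f a : act a (phi_wedge f) = 0.
Proof.
apply: act_eq0 => [i j k|i j k l]; first by rewrite !comp_assemble linear0 !scaler0 !(addr0, subr0).
by rewrite !bi_phi_wedge; apply: (bivec_invariant_CC NCv CCv (fun i j => rot_emb0 i j f)).
Qed.

Lemma act_phi_gamma f a : act a (phi_gamma f) = 0.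
Proof.
apply: act_eq0 => [i j k|i j k l]; first by rewrite !comp_assemble linear0 !scaler0 !(addr0, subr0).
by rewrite !bi_phi_gamma; apply: (bivec_invariant_NN NCv NNv (fun i j => rot_embT i j f)).
Qed.

Lemma dP0 (D : finType) : dP (0 : {ffun {set H} * D -> R^o}) = 0.
Proof. by rewrite /dP big1 // => a _; rewrite linear0 scaler0 oppr0 linear0. Qed.

(** Translations carry V'-coefficients to so(n)'-coefficients; antisymmetrising the resulting
    product of two dx's, itself antisymmetric, gives the factor 2. *)
Lemma dI_phi_metric f : dI (phi_metric f) = - phi_metric (ds f) - 2 *: phi_wedge f.
Proof.
rewrite dI_invariant; last exact: act_phi_metric.
apply: compP => b; rewrite linearD /= comp_dP transl_comp linearB linearN linearZ /= !comp_assemble.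
case: b => [b|k]; last by rewrite emb_ds dP_C scaler0 subr0 addr0.
set i := (val b).1; set j := (val b).2; set y := emb set0 f.
transitivity (0 - (Cv i (Cv j y) - Cv j (Cv i y))); first by rewrite dP0 !comp_assemble.
by rewrite (CCv j i); apply/ffunP => x; rewrite !fockE; ring.
Qed.

Lemma dI_phi_wedge f : dI (phi_wedge f) = phi_wedge (ds f).
Proof.
rewrite dI_invariant; last exact: act_phi_wedge.
have -> : transl (phi_wedge f) = 0.
  apply: compP => -[b|k]; rewrite transl_comp linear0 // !comp_assemble.
  by rewrite !linear0 addr0 oppr0.
apply: compP => b; rewrite addr0 comp_dP !comp_assemble.
case: b => [b|k]; last exact: dP0.
by rewrite emb_ds !dP_C linearN /= opprK.
Qed.

Lemma dI_phi_gamma f : dI (phi_gamma f) = phi_gamma (ds f).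
Proof.
rewrite dI_invariant; last exact: act_phi_gamma.
have -> : transl (phi_gamma f) = 0.
  apply: compP => -[b|k]; rewrite transl_comp linear0 // !comp_assemble.
  by rewrite !linear0 addr0 oppr0.
apply: compP => b; rewrite addr0 comp_dP !comp_assemble.
case: b => [b|k]; last exact: dP0.
by rewrite emb_ds !dP_N linearN /= opprK.
Qed.

Lemma scale_emb (X : {linear W1 -> W1}) k T f : X (emb T (k *: f)) = k *: X (emb T f).
Proof. by rewrite !linearZ. Qed.

Lemma vec_invariant_form (F : 'I_n -> W1) : (0 < n)%N -> vec_invariant Cv Nv F ->
  exists p q, forall k, F k = Cv k (emb set0 p) + Nv k (emb setT q).
Proof.
move=> n0 Finv.
have [p0 q0] := (vec_N NCv NNv Finv, vec_C NCv CCv Finv).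
have := scalar_invariant n0 p0; have := scalar_invariant n0 q0.
set q := \sum_i _; set p := \sum_i _ => qE pE.
exists (n%:R^-1 *: res set0 p), (n%:R^-1 *: res setT q) => k.
have nn0 : n%:R != 0 :> R by rewrite pnatr_eq0 -lt0n.
have Cp : Cv k p = Cv k (emb set0 (res set0 p)) by rewrite {1}pE [LHS]linearD /= Cv_embT addr0.
have Nq : Nv k q = Nv k (emb setT (res setT q)) by rewrite {1}qE [LHS]linearD /= Nv_emb0 add0r.
apply: (scalerI nn0); rewrite (vec_repr NCv Finv) -/p -/q Cp Nq scale_emb.
rewrite [Nv k (emb _ (_ *: _))]scale_emb -scalerDr scalerA mulfV // scale1r.
by rewrite addrC.
Qed.

(** The trace identities leave scalar invariants, placed at none or all of the dx^i. For the
    so(n)'-components two of the four resulting terms, Nv j (Cv l _) in lowest and Cv j (Nv l _) in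
    top degree, are multiples of delta_jl and vanish on a pair j < l. *)
Lemma kernel_form f : (1 < n)%N -> (forall a, act a f = 0) ->
  exists p q u v, f = phi_metric p + phi_vol q + phi_wedge u + phi_gamma v.
Proof.
move=> n1 f0; have n0 := ltnW n1.
have rot_sym (G : 'I_n -> 'I_n -> W1) : (forall i j, G j i = - G i j) ->
    (forall i j : 'I_n, (i < j)%N -> G i j = 0) -> forall i j, G i j = 0.
  move=> Ganti G0 i j; case: (ltngtP i j) => ij; first exact: G0.
    by rewrite Ganti G0 ?oppr0.
  have {ij} <- := val_inj ij; apply/ffunP => x; rewrite fock0.
  have := congr1 (fun g : W1 => g x) (Ganti i i); rewrite fockN => e.
  by apply/eqP; rewrite -eqNr; apply/eqP.
have rotC i j y : rotv j i y = - rotv i j y by rewrite /rot opprB.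
have vf : vec_invariant Cv Nv (fun k => comp (inr k) f).
  move=> i j k; move: i j; apply: rot_sym => [i j|i j ij].
    by rewrite rotC; apply/ffunP => x; rewrite !fockE; ring.
  by rewrite -(comp_actV (ordpair ij)) f0 linear0.
have bf : bivec_invariant Cv Nv (bi f).
  move=> i j k l; move: i j; apply: rot_sym => [i j|i j ij].
    by rewrite rotC; apply/ffunP => x; rewrite !fockE; ring.
  by rewrite -(bi_act (ordpair ij)) f0 /bi big1 // => b _; rewrite linear0 scaler0.
have [p [q pqE]] := vec_invariant_form n0 vf.
have [z1 [y1 yz1]] := vec_invariant_form n0 (bivec_C NCv CCv bf).
have [z2 [y2 yz2]] := vec_invariant_form n0 (bivec_N NCv NNv bf).
have n10 : (n%:R - 1) != 0 :> R.
  by rewrite subr_eq0 -[1]/(1%:R) eqr_nat gtn_eqF.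
exists p, q, ((n%:R - 1)^-1 *: z2), ((n%:R - 1)^-1 *: y1).
apply: compP => b; rewrite !linearD /= !comp_assemble.
case: b => [b|k]; last by rewrite pqE !addr0.
rewrite !add0r -bi_pair; apply: (scalerI n10).
rewrite (bivec_repr NCv (@bi_anti f) bf) yz1 yz2 !linearZ /= scalerDr !scalerA mulfV // !scale1r.
rewrite !linearD /=.
have b12 : ((val b).1 == (val b).2) = false by rewrite -val_eqE ltn_eqF ?(valP b).
rewrite NCv Nv_emb0 linear0 b12 scale0r subrr add0r addrC; congr (_ + _).
have /eqP := NCv (val b).2 (val b).1 (emb setT y2).
rewrite Cv_embT linear0 eq_sym [_ == (val b).1]eq_sym b12 scale0r sub0r oppr_eq0 => /eqP ->.
by rewrite addr0.
Qed.

End InvariantCochains.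

(** * The cohomology of the compact form *)

(** An isomorphism Z / B = Z' / B' induced by [phi], stated additively to stay clear of truncated
    subtraction. *)
Lemma dim_quot (R : fieldType) (U V : vectType R) (phi : {linear U -> V})
    (Z B : {vspace U}) (Z' B' : {vspace V}) :
  (B' <= Z')%VS -> (forall x, x \in Z -> phi x \in Z') ->
  (forall x, x \in B -> x \in Z) ->
  (forall x, x \in Z -> (phi x \in B') = (x \in B)) ->
  (forall y, y \in Z' -> exists2 x, x \in Z & y - phi x \in B') ->
  (\dim Z + \dim B' = \dim Z' + \dim B)%N.
Proof.
move=> BZ' ZZ' BZ BB surj; pose f := linfun phi.
have sBZ : (B <= Z)%VS by apply/subvP.
have kerE : (Z :&: lker f = B :&: lker f)%VS.
  apply/vspaceP => x; rewrite !memv_cap memv_ker lfunE; apply/andP/andP => [[xZ /eqP fx]|[xB fx]].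
    by rewrite -BB // fx mem0v.
  by rewrite BZ.
have imE : (f @: B = f @: Z :&: B')%VS.
  apply/vspaceP => y; rewrite memv_cap; apply/memv_imgP/andP => [[x xB ->]|[/memv_imgP[x xZ ->]]].
    by split; [apply/memv_img/BZ|rewrite lfunE /= BB ?BZ].
  by rewrite lfunE /= => h; exists x; rewrite ?lfunE // -BB.
have sumE : (f @: Z + B' = Z')%VS.
  apply/eqP; rewrite eqEsubv subv_add BZ' andbT; apply/andP; split.
    by apply/subvP => _ /memv_imgP[x xZ ->]; rewrite lfunE; apply: ZZ'.
  apply/subvP => y /surj[x xZ h]; rewrite -[y](subrK (phi x)) addrC.
  by apply: memv_add => //; rewrite -(lfunE phi); apply: memv_img.
rewrite -(limg_ker_dim f Z) -(limg_ker_dim f B) kerE imE -sumE.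
by have := dimv_sum_cap (f @: Z) B'; lia.
Qed.

(** * Weight-zero projections and the reduction of relative cocycles *)

Section CompactCohomology.
Variables (R : realFieldType) (n : nat).
Hypothesis n3 : (2 < n)%N.
Local Notation P := (pairT n).
Local Notation H := (basisH n).
Local Notation WI := {ffun {set H} * H -> R^o}.
Local Notation W1 := {ffun {set H} * unit -> R^o}.
Local Notation Wso := {ffun {set P} * unit -> R^o}.
Local Notation c := (@ceuc R n).
Local Notation rkH := (@rkH n).
Local Notation rkP := (@rkP n).
Local Notation piW := (piW rkH).
Local Notation dI := (@dI R n).
Local Notation ds := (@ds R n).
Local Notation dt := (dW rkH c (@rho_triv R H)).
Local Notation rotv := (rot (@Cv R n) (@Nv R n)).
Local Notation Om := (casimir (fun a => @act R n a : {linear WI -> WI})).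

Let n0 : (0 < n)%N. Proof. exact: ltn_trans n3. Qed.
Let n1 : (1 < n)%N. Proof. exact: ltn_trans n3. Qed.

Definition r0 (y : W1) : W1 := [ffun x : {set H} * unit => if SV x.1 == set0 then y x else 0].
Definition isV (b : H) : bool := if b is inr _ then true else false.
(** The weight-0 part: no dx^i and no coefficient in V'; [r0] is its scalar analogue. Weight comes
    from dilations, hence the compatibility with [dI], [hom] and [piW]. *)
Definition p0 (f : WI) : WI :=
  [ffun x : {set H} * H => if isV x.2 then 0 else if SV x.1 == set0 then f x else 0].
Definition pV (f : WI) : WI := [ffun x : {set H} * H => if isV x.2 then f x else 0].

Lemma r0_is_linear : linear r0.
Proof. by move=> k f g; apply/ffunP => x; rewrite !ffunE; case: eqP; rewrite ?scaler0 ?addr0. Qed.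
HB.instance Definition _ := GRing.isLinear.Build R W1 W1 _ r0 r0_is_linear.

Lemma p0_is_linear : linear p0.
Proof.
move=> k f g; apply/ffunP => [[S [b|b]]]; rewrite !ffunE /= ?scaler0 ?addr0 //.
by case: eqP; rewrite ?scaler0 ?addr0.
Qed.
HB.instance Definition _ := GRing.isLinear.Build R WI WI _ p0 p0_is_linear.

Lemma pV_is_linear : linear pV.
Proof. by move=> k f g; apply/ffunP => [[S [b|b]]]; rewrite !ffunE /= ?scaler0 ?addr0. Qed.
HB.instance Definition _ := GRing.isLinear.Build R WI WI _ pV pV_is_linear.

Lemma comp_p0 b f : comp b (p0 f) = if b is inl _ then r0 (comp b f) else 0.
Proof. by apply/ffunP => [[S []]]; rewrite !ffunE /=; case: b => b; rewrite !ffunE. Qed.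

Lemma comp_pV b f : comp b (pV f) = if b is inr _ then comp b f else 0.
Proof. by apply/ffunP => [[S []]]; rewrite !ffunE /=; case: b => b; rewrite !ffunE. Qed.

Lemma r0K y : r0 (r0 y) = r0 y.
Proof. by apply/ffunP => x; rewrite !ffunE; case: eqP. Qed.

Lemma p0K f : p0 (p0 f) = p0 f.
Proof. by apply: compP => b; rewrite !comp_p0; case: b => // b; rewrite r0K. Qed.

Lemma r0_emb y : r0 y = emb set0 (res set0 y).
Proof.
by apply/ffunP => [[S []]]; rewrite !ffunE /=; case: eqP => // S0; rewrite -{1}(join_SPSV S) S0.
Qed.

Lemma r0_emb0 f : r0 (emb set0 f) = emb set0 f.
Proof. by rewrite r0_emb resK. Qed.

Lemma r0_embT f : r0 (emb setT f) = 0.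
Proof.
apply/ffunP => [[S []]]; rewrite !ffunE /=; case: eqP => // ->.
by case: eqP => // /setP /(_ (Ordinal n0)); rewrite !inE.
Qed.

Lemma r0_cr a y : r0 (cr rkH (inl a) y) = cr rkH (inl a) (r0 y).
Proof.
apply/ffunP => [[S []]]; rewrite !ffunE /=.
have -> : SV (S :\ inl a) = SV S by apply/setP => i; rewrite !inE.
by case: eqP => _; case: ifP => _; rewrite ?mulr0.
Qed.

Lemma r0_an a y : r0 (an rkH (inl a) y) = an rkH (inl a) (r0 y).
Proof.
apply/ffunP => [[S []]]; rewrite !ffunE /=.
have -> : SV (inl a |: S) = SV S by apply/setP => i; rewrite !inE.
by case: eqP => _; case: ifP => _; rewrite ?mulr0.
Qed.

Lemma Nv_r0 i y : Nv R i (r0 y) = 0.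
Proof. by rewrite r0_emb Nv_emb0. Qed.

Lemma r0_Cv i y : r0 (Cv R i y) = 0.
Proof.
apply/ffunP => [[S []]]; rewrite /Cv /= !ffunE /=; case: eqP => // /setP /(_ i).
by rewrite !inE => ->.
Qed.

(** As n > 2, some dx^i survives two contractions of the volume form. *)
Lemma r0_Nv2 i j f : r0 (Nv R i (Nv R j (emb setT f))) = 0.
Proof.
apply/ffunP => [[S []]]; rewrite /Nv /= !ffunE /=; case: eqP => // S0.
case: ifP => // _; case: ifP => [|_]; first by rewrite mulr0.
case: eqP => [/setP e|_]; last by rewrite !mulr0.
have : (#|[set: 'I_n]| <= #|[set i; j]|)%N.
  apply: subset_leq_card; apply/subsetP => k _; have := e k; rewrite !inE.
  have := S0 => /setP /(_ k); rewrite !inE => -> /=; rewrite orbF => /orP[] /eqP[->];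
  by rewrite eqxx ?orbT.
by rewrite cardsT card_ord cards2; case: eqP => _ /=; lia.
Qed.

Lemma rot_r0 i j y : rotv i j (r0 y) = 0.
Proof. by rewrite r0_emb rot_emb0. Qed.

Lemma r0_rot i j y : r0 (rotv i j y) = 0.
Proof. by rewrite /rot linearB /= !r0_Cv subrr. Qed.

Lemma p0_piW y : p0 (piW y) = piW (r0 y).
Proof.
apply: compP => b; rewrite comp_p0 !comp_piW.
case: b => [b|k]; first by rewrite r0_an.
by rewrite -[an _ _ _]/(Nv R k (r0 y)) Nv_r0.
Qed.

Lemma p0_cr a f : p0 (cr rkH (inl a) f) = cr rkH (inl a) (p0 f).
Proof.
apply: compP => b; rewrite comp_cr !comp_p0 comp_cr.
by case: b => b; [exact: r0_cr|rewrite linear0].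
Qed.

Lemma p0_an a f : p0 (an rkH (inl a) f) = an rkH (inl a) (p0 f).
Proof.
apply: compP => b; rewrite comp_an !comp_p0 comp_an.
by case: b => b; [exact: r0_an|rewrite linear0].
Qed.

Lemma p0_act a f : p0 (act a f) = act a (p0 f).
Proof.
apply: compP => b; rewrite comp_p0; case: b => [b|k]; last first.
  by rewrite comp_actV !comp_p0 linear0 !scaler0 !(addr0, subr0).
rewrite !comp_act comp_p0 rot_r0 linearD /= r0_rot !addr0 linear_sum.
apply: eq_bigr => -[e|e] _ /=; rewrite comp_p0 ?linearZ //=.
by rewrite oppr0 !scale0r.
Qed.

Lemma p0_transl f : p0 (transl f) = 0.
Proof.
apply: compP => b; rewrite comp_p0 linear0; case: b => // b.
by rewrite transl_comp linearN linearB /= -![cr _ _ _]/(Cv R _ _) !r0_Cv subrr oppr0.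
Qed.

Lemma transl_p0 f : transl (p0 f) = 0.
Proof.
apply: compP => -[b|k]; rewrite transl_comp linear0 // !comp_p0 !linear0.
by rewrite addr0 oppr0.
Qed.

Lemma p0_quad a f : p0 (quad rkH (mP R a) f) = quad rkH (mP R a) (p0 f).
Proof.
rewrite !quad_mP linear_sum; apply: eq_bigr => b _; rewrite linear_sum; apply: eq_bigr => e _ /=.
by rewrite linearZ /= p0_cr p0_an.
Qed.

Lemma p0_dI f : p0 (dI f) = dI (p0 f).
Proof.
rewrite !dIE linearD /= p0_transl transl_p0 !addr0 linear_sum; apply: eq_bigr => a _ /=.
by rewrite p0_cr linearB /= p0_act linearZ /= p0_quad.
Qed.

Lemma p0_hom f : p0 (hom f) = hom (p0 f).
Proof.
by rewrite /hom /homot linear_sum; apply: eq_bigr => a _ /=; rewrite p0_an p0_act.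
Qed.

(** Transferred from [p0_dI] through [piW], which is injective away from degree 0, where both sides
    vanish. *)
Lemma r0_dt y : r0 (dt y) = dt (r0 y).
Proof.
apply/eqP; rewrite -subr_eq0; apply/eqP; apply: (@piW_inj _ _ rkH); last first.
  by rewrite !fockE ffunE /= dW_set0 if_same dW_set0 subr0.
have dpi z : piW (dt z) = - dI (piW z) by rewrite /dI dW_piW ?opprK //; [exact: rkH_inj|exact: ceuc_anti].
by rewrite linearB /= -p0_piW !dpi linearN /= p0_dI p0_piW subrr.
Qed.

Lemma dI_piW y : dI (piW y) = - piW (dt y).
Proof. by apply: dW_piW; [exact: rkH_inj|exact: ceuc_anti]. Qed.

(** [emb set0] is inflation along the homomorphism from [h] onto so(n). *)
Lemma dt_emb0 f : dt (emb set0 f) = emb set0 (ds f).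
Proof.
have mV0 a : quad rkH (mV R a) (emb set0 f) = 0.
  rewrite quad_mV big1 // => k _; rewrite big1 // => l _.
  by rewrite -[an _ _ _]/(Nv R l _) Nv_emb0 linear0 scaler0.
rewrite dW_trivE big_sumType /= emb_ds [X in _ + X](_ : _ = 0) ?addr0.
  by apply: eq_bigr => a _; rewrite c_split mV0 addr0.
under eq_bigr do rewrite linearN linearZ /=.
rewrite sumrN -scaler_sumr cr_mixed big1 ?scaler0 ?oppr0 // => a _.
by rewrite mV0 linear0.
Qed.

Definition coeffP (f : WI) := forall k, comp (inr k) f = 0.

Lemma pV0P f : reflect (coeffP f) (f \in lker (linfun pV)).
Proof.
rewrite memv_ker lfunE; apply: (iffP eqP) => [h k|h].
  by have := congr1 (comp (inr k)) h; rewrite comp_pV linear0.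
by apply: compP => -[b|k]; rewrite comp_pV linear0.
Qed.

Lemma p0P f : reflect (p0 f = 0) (f \in lker (linfun p0)).
Proof. by rewrite memv_ker lfunE; apply: eqP. Qed.

Lemma r0P y : reflect (r0 y = 0) (y \in lker (linfun r0)).
Proof. by rewrite memv_ker lfunE; apply: eqP. Qed.

Lemma coeffP_dI (f : WI) : coeffP f -> coeffP (dI f).
Proof.
move=> f0 k; rewrite dIE linearD /= transl_comp addr0 linear_sum big1 // => a _ /=.
rewrite comp_cr linearB linearZ /= comp_actV comp_quad !f0.
by rewrite !(linear0, scaler0, addr0, oppr0).
Qed.

Lemma coeffP_hom (f : WI) : coeffP f -> coeffP (hom f).
Proof.
move=> f0 k; rewrite /hom /homot linear_sum big1 // => a _ /=.
by rewrite comp_an comp_actV !f0 !(linear0, scaler0, addr0, oppr0).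
Qed.

Lemma act_hom0 (f : WI) : (forall a, act a f = 0) -> hom f = 0.
Proof. by move=> f0; rewrite /hom /homot big1 // => a _; rewrite /= f0 linear0. Qed.

Lemma p0_metric (f : Wso) : p0 (phi_metric f) = 0.
Proof.
by apply: compP => b; rewrite comp_p0 comp_assemble linear0; case: b => b; rewrite ?linear0.
Qed.

Lemma p0_wedge (f : Wso) : p0 (phi_wedge f) = 0.
Proof.
by apply: compP => b; rewrite comp_p0 comp_assemble linear0; case: b => b; rewrite ?r0_Cv.
Qed.

Lemma p0_gamma (f : Wso) : p0 (phi_gamma f) = 0.
Proof.
by apply: compP => b; rewrite comp_p0 comp_assemble linear0; case: b => b; rewrite ?r0_Nv2.
Qed.

Lemma p0_vol (f : Wso) : p0 (phi_vol f) = 0.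
Proof.
by apply: compP => b; rewrite comp_p0 comp_assemble linear0; case: b => b; rewrite ?linear0.
Qed.

Definition Vpos : {vspace WI} := lker (linfun p0).
(** [VA] has positive weight and coefficients in so(n)'; [VAT] adds the metric family, and [VB] the
    positive-weight image of pi_R^*. By [piW_VAT] the last sum is direct. *)
Definition VA : {vspace WI} := (lker (linfun p0) :&: lker (linfun pV))%VS.
Definition VAT : {vspace WI} := (VA + limg (linfun (@phi_metric R n)))%VS.
Definition VB : {vspace WI} := (VAT + linfun piW @: lker (linfun r0))%VS.

Lemma VAP f : reflect (p0 f = 0 /\ coeffP f) (f \in VA).
Proof. by rewrite memv_cap; apply: (iffP andP) => -[/p0P ? /pV0P ?]. Qed.

Lemma VA_wedge (f : Wso) : phi_wedge f \in VA.
Proof. by apply/VAP; split; [exact: p0_wedge|move=> k; rewrite comp_assemble]. Qed.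

Lemma VA_gamma (f : Wso) : phi_gamma f \in VA.
Proof. by apply/VAP; split; [exact: p0_gamma|move=> k; rewrite comp_assemble]. Qed.

Lemma VA_dI (f : WI) : f \in VA -> dI f \in VA.
Proof.
move=> /VAP[f0 fP]; apply/VAP; split; last exact: coeffP_dI.
by rewrite p0_dI f0 linear0.
Qed.

Lemma VA_hom (f : WI) : f \in VA -> hom f \in VA.
Proof.
move=> /VAP[f0 fP]; apply/VAP; split; last exact: coeffP_hom.
by rewrite p0_hom f0 linear0.
Qed.

Lemma VATP f : reflect (exists2 a, a \in VA & exists t, f = a + phi_metric t) (f \in VAT).
Proof.
apply: (iffP memv_addP) => [[a aA [_ /memv_imgP[t _ ->] ->]]|[a aA [t ->]]].
  by exists a => //; exists t; rewrite lfunE.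
by exists a => //; exists (phi_metric t) => //; rewrite -(lfunE (@phi_metric R n)); apply: memv_img; rewrite memvf.
Qed.

Lemma VAT_VA (f : WI) : f \in VA -> f \in VAT.
Proof. by move=> fA; apply/VATP; exists f => //; exists 0; rewrite linear0 addr0. Qed.

Lemma VAT_metric (t : Wso) : phi_metric t \in VAT.
Proof. by apply/VATP; exists 0; [exact: mem0v|exists t; rewrite add0r]. Qed.

Lemma VAT_dI (f : WI) : f \in VAT -> dI f \in VAT.
Proof.
move=> /VATP[a aA [t ->]]; rewrite linearD /= dI_phi_metric; apply: rpredD; first exact/VAT_VA/VA_dI.
apply: rpredB; last by apply: rpredZ; apply/VAT_VA/VA_wedge.
by rewrite rpredN VAT_metric.
Qed.

Lemma hom_metric (t : Wso) : hom (phi_metric t) = 0.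
Proof. by apply: act_hom0 => a; apply: act_phi_metric. Qed.

Lemma hom_gamma (t : Wso) : hom (phi_gamma t) = 0.
Proof. by apply: act_hom0 => a; apply: act_phi_gamma. Qed.

Lemma VAT_hom (f : WI) : f \in VAT -> hom f \in VAT.
Proof.
move=> /VATP[a aA [t ->]]; rewrite linearD /= hom_metric addr0; exact/VAT_VA/VA_hom.
Qed.

Lemma VBP f : reflect (exists w y, [/\ w \in VAT, r0 y = 0 & f = w + piW y]) (f \in VB).
Proof.
apply: (iffP memv_addP) => [[w wT [_ /memv_imgP[y /r0P y0 ->] ->]]|[w [y [wT y0 ->]]]].
  by exists w, y; rewrite lfunE.
exists w => //; exists (piW y) => //; rewrite -(lfunE piW); apply: memv_img; exact/r0P.
Qed.

Lemma VB_VAT (f : WI) : f \in VAT -> f \in VB.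
Proof. by move=> fT; apply/VBP; exists f, 0; rewrite !linear0 addr0. Qed.

Lemma VB_piW (y : W1) : r0 y = 0 -> piW y \in VB.
Proof. by move=> y0; apply/VBP; exists 0, y; rewrite mem0v add0r. Qed.

Lemma VB_dI (f : WI) : f \in VB -> dI f \in VB.
Proof.
move=> /VBP[w [y [wT y0 ->]]]; rewrite linearD /= dI_piW; apply: rpredD.
  exact/VB_VAT/VAT_dI.
by rewrite rpredN; apply: VB_piW; rewrite r0_dt y0 linear0.
Qed.

(** The homotopy leaves the image of [piW], but only by a cochain with so(n)'-coefficients: y' is
    the corresponding homotopy on scalar cochains, its sign chosen to match the V'-components. *)
Lemma hom_piW (y : W1) : r0 y = 0 -> hom (piW y) \in VB.
Proof.
move=> y0; pose y' := - \sum_a an rkH (inl a) (rotv (val a).1 (val a).2 y).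
have y'0 : r0 y' = 0.
  rewrite /y' linearN linear_sum big1 ?oppr0 // => a _ /=.
  by rewrite r0_an r0_rot linear0.
have -> : hom (piW y) = (hom (piW y) - piW y') + piW y' by rewrite subrK.
apply: rpredD; last exact: VB_piW.
apply/VB_VAT/VAT_VA/VAP; split.
  by rewrite linearB /= p0_hom !p0_piW y0 y'0 !(linear0, addr0, oppr0).
move=> k; rewrite linearB /= comp_piW.
have -> : comp (inr k) (hom (piW y)) =
    \sum_a an rkH (inl a) (Nv R k (rotv (val a).1 (val a).2 y)).
  rewrite /hom /homot linear_sum; apply: eq_bigr => a _ /=.
  rewrite comp_an comp_actV !comp_piW; congr (an _ _ _).
  rewrite -![an rkH (inr _) y]/(Nv R _ y) (rot_N (@NCv R n) (@NNv R n)).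
  by apply/ffunP => x; rewrite !fockE; ring.
rewrite -[an rkH (inr k) _]/(Nv R k y') /y' linearN opprK linear_sum -big_split big1 // => a _ /=.
by rewrite an_an ?addNr //; exact: rkH_inj.
Qed.

Lemma VB_hom (f : WI) : f \in VB -> hom f \in VB.
Proof.
move=> /VBP[w [y [wT y0 ->]]]; rewrite linearD /=; apply: rpredD; last exact: hom_piW.
exact/VB_VAT/VAT_hom.
Qed.

(** Comparing V'-components gives Nv k y = Cv k (emb set0 t). Applying Nv k again kills the left
    side and leaves emb set0 t = 0; then all Nv k y vanish, so [y] has weight 0. *)
Lemma piW_VAT (y : W1) : r0 y = 0 -> piW y \in VAT -> y = 0.
Proof.
move=> y0 /VATP[a /VAP[_ aP] [t pyE]].
have NyE k : Nv R k y = Cv R k (emb set0 t).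
  have := congr1 (comp (inr k)) pyE; rewrite comp_piW linearD /= aP comp_assemble add0r //.
have t0 : emb set0 t = 0.
  have := congr1 (Nv R (Ordinal n0)) (NyE (Ordinal n0)).
  rewrite NCv Nv_emb0 linear0 eqxx scale1r subr0 => <-.
  by rewrite /Nv /= an_sq.
apply/ffunP => [[S []]]; rewrite fock0.
have [S0|[k]] := set_0Vmem (SV S).
  by have /ffunP /(_ (S, tt)) := y0; rewrite !ffunE /= S0 eqxx.
rewrite inE => kS; have /ffunP /(_ (S :\ inr k, tt)) := NyE k.
rewrite t0 linear0 /Nv /= !ffunE /= setD11 setD1K // => /eqP.
by rewrite mulf_eq0 signr_eq0 /= => /eqP.
Qed.

Lemma kernel_VB (f : WI) : Om f = 0 -> f \in VB.
Proof.
move=> /(casimir_ker (@act_anti R n)) f0; have [p [q [u [v ->]]]] := kernel_form n1 f0.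
(* The volume family has the V'-components of pi_R^* of the volume form, so their difference lies in
   [VA]. *)
have volE : phi_vol q \in VB.
  have -> : phi_vol q = (phi_vol q - piW (emb setT q)) + piW (emb setT q) by rewrite subrK.
  apply: rpredD; last by apply: VB_piW; exact: r0_embT.
  apply/VB_VAT/VAT_VA/VAP; split; first by rewrite linearB /= p0_vol p0_piW r0_embT !(linear0, addr0, oppr0).
  by move=> k; rewrite linearB /= comp_assemble comp_piW; apply: subrr.
by rewrite !rpredD // ?VB_VAT ?VAT_metric ?VAT_VA ?VA_wedge ?VA_gamma.
Qed.

(** [harmonic_repr] in positive weight relative to [VB] brings [u] into [VB] modulo a coboundary;
    the direct sum then separates dI w = a0 from the pi_R^*-part. *)
Lemma pos_reduce u a0 y : p0 u = 0 -> dI u = a0 + piW y -> a0 \in VA -> r0 y = 0 ->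
  exists w u' y', [/\ w \in VAT, dI w = a0 & u = dI u' + w + piW y'].
Proof.
move=> u0 duE a0A y0.
have duB : dI u \in VB by rewrite duE rpredD ?VB_piW ?VB_VAT ?VAT_VA.
have [x0 [u' [b [_ x00 _ bB uE]]]] : exists x0 u' b,
    [/\ x0 \in Vpos, Om x0 = 0, u' \in Vpos, b \in VB & u = x0 + dI u' + b].
  apply: (harmonic_repr (@act_anti R n) (h := @hom R n)) => //.
  - exact: homP.
  - exact: dI_sq.
  - by move=> g /p0P g0; apply/p0P; rewrite p0_dI g0 linear0.
  - by move=> g /p0P g0; apply/p0P; rewrite p0_hom g0 linear0.
  - exact: VB_dI.
  - exact: VB_hom.
  - exact/p0P.
have : x0 + b \in VB by rewrite rpredD // kernel_VB.
move=> /VBP[w [y' [wT y'0 xbE]]]; exists w, u', y'; split => //; last first.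
  by rewrite uE addrAC xbE addrC addrA.
have duE' : dI u = dI w - piW (dt y').
  have -> : u = dI u' + (w + piW y') by rewrite uE addrAC xbE addrC.
  by rewrite linearD /= dI_sq add0r linearD /= dI_piW.
have e : dI w - a0 = piW (y + dt y').
  rewrite [piW (_ + _)]linearD /=; apply/eqP; rewrite subr_eq addrC addrA.
  by rewrite -duE duE' subrK.
apply/eqP; rewrite -subr_eq0 e; apply/eqP.
rewrite (@piW_VAT (y + dt y')) ?linear0 //.
  by rewrite linearD /= y0 r0_dt y'0 !(linear0, addr0).
by rewrite -e; apply: rpredB; [exact: VAT_dI|exact: VAT_VA].
Qed.

(** One pair i, j suffices: Nv j after Nv i kills the gamma term and recovers the wedge one, and
    creation operators then undo the contractions of the volume form. *)
Lemma wedge_gamma_indep s t :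
  (forall b, comp (inl b) (phi_wedge s + phi_gamma t : WI) = 0) -> s = 0 /\ t = 0.
Proof.
pose b : P := @ordpair n (Ordinal n0) (Ordinal n1) isT.
move=> /(_ b); rewrite linearD /= !comp_assemble.
set i := (val b).1; set j := (val b).2; set E := emb set0 s; set G := emb setT t => e.
have NE k : Nv R k E = 0 by apply: Nv_emb0.
have CG k : Cv R k G = 0 by apply: Cv_embT.
have NN0 k y : Nv R k (Nv R k y) = 0 by apply: an_sq.
have ij : (i == j) = false by [].
have E0 : E = 0.
  have := congr1 (fun y => Nv R j (Nv R i y)) e.
  rewrite !linearD /= -/(Nv R i) NN0 !linear0 addr0 => <-.
  have -> : Nv R i (Cv R i (Cv R j E)) = Cv R j E.
    by rewrite NCv (NCv i j) NE ij eqxx !(linear0, scale0r, scale1r, subr0).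
  by rewrite NCv NE eqxx !(linear0, scale1r, subr0).
have G0 : G = 0.
  move: e; rewrite E0 !linear0 add0r => e.
  have CN k l : Cv R k (Nv R l G) = (l == k)%:R *: G.
    by have /eqP := NCv l k G; rewrite CG linear0 eq_sym subr_eq0 => /eqP.
  have := congr1 (Cv R i) e; rewrite linear0.
  have /eqP := NCv i i (Nv R j G); rewrite CN [j == i]eq_sym ij scale0r linear0 eqxx scale1r.
  rewrite eq_sym subr_eq0 => /eqP <- NG.
  by have := CN j j; rewrite NG linear0 eqxx scale1r.
have res0 T : res T 0 = 0 :> Wso by apply/ffunP => x; rewrite !ffunE.
by rewrite -[s](resK set0) -[t](resK setT) -/E -/G E0 G0 !res0.
Qed.

(** Harmonic reduction relative to the gamma family leaves invariants inside [VAT]. Comparing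
    so(n)'-components gives ds u = 2 p, so the metric and wedge parts are together exact, and a
    primitive of [g] in the gamma part. *)
Lemma gamma_lift w g : w \in VAT -> dI w = phi_gamma g ->
  exists v u, ds v = g /\ w = phi_gamma v + dI u.
Proof.
move=> wT dwE.
have [x0 [u' [b [x0T x00 _ bG wE]]]] : exists x0 u' b, [/\ x0 \in VAT, Om x0 = 0,
    u' \in VAT, b \in limg (linfun (@phi_gamma R n)) & w = x0 + dI u' + b].
  apply: (harmonic_repr (@act_anti R n) (h := @hom R n)) => //.
  - exact: homP.
  - exact: dI_sq.
  - exact: VAT_dI.
  - exact: VAT_hom.
  - move=> _ /memv_imgP[f _ ->]; rewrite lfunE /= dI_phi_gamma -(lfunE (@phi_gamma R n)).
    by apply: memv_img; rewrite memvf.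
  - by move=> _ /memv_imgP[f _ ->]; rewrite lfunE /= hom_gamma mem0v.
  - by rewrite /= dwE -(lfunE (@phi_gamma R n)); apply: memv_img; rewrite memvf.
have [v0 _ {bG}] := memv_imgP bG; rewrite lfunE /= => bE.
have [p [q [u [v x0E]]]] := kernel_form n1 (casimir_ker (@act_anti R n) x00).
(* In [VAT] the V'-components are those of the metric family alone, which excludes a volume term. *)
have q0 : emb setT q = 0.
  apply: piW_VAT; first exact: r0_embT.
  have [a aA [t x0E']] := VATP _ x0T.
  have -> : piW (emb setT q) = (piW (emb setT q) - phi_metric (t - p)) + phi_metric (t - p).
    by rewrite subrK.
  apply: rpredD; last exact: VAT_metric.
  apply/VAT_VA/VAP; split.
    by rewrite linearB /= p0_metric p0_piW r0_embT !(linear0, addr0, oppr0).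
  move=> k; have [_ aP] := VAP _ aA.
  have e : Cv R k (emb set0 t) = Cv R k (emb set0 p) + Nv R k (emb setT q).
    have := congr1 (comp (inr k)) x0E; rewrite x0E' !linearD /= aP !comp_assemble.
    by rewrite add0r !addr0.
  rewrite linearB /= comp_assemble comp_piW [emb set0 _]linearB [Cv R k _]linearB /= -/(Cv R k) e.
  by apply/ffunP => x; rewrite !fockE; ring.
have vol0 : phi_vol q = 0 :> WI.
  by apply: compP => b'; rewrite comp_assemble linear0 q0; case: b' => // k; rewrite linear0.
have {}x0E : x0 = phi_metric p + phi_wedge u + phi_gamma v by rewrite x0E vol0 addr0.
have dE : dI w = - phi_metric (ds p) + (phi_wedge (ds u - 2 *: p) + phi_gamma (ds (v + v0))).
  have -> : phi_wedge (ds u - 2 *: p) = phi_wedge (ds u) - 2 *: phi_wedge p :> WI.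
    by rewrite linearB /= linearZ.
  have -> : phi_gamma (ds (v + v0)) = phi_gamma (ds v) + phi_gamma (ds v0) :> WI.
    by rewrite !linearD.
  have -> : dI w = dI (phi_metric p) + dI (phi_wedge u) + dI (phi_gamma v) + dI (dI u') +
      dI (phi_gamma v0).
    by rewrite wE bE x0E !linearD.
  rewrite dI_sq dI_phi_metric dI_phi_wedge !dI_phi_gamma.
  by apply/ffunP => x; rewrite !fockE; ring.
have [] : ds u - 2 *: p = 0 /\ ds (v + v0) - g = 0.
  apply: wedge_gamma_indep => b'.
  have compE (A B C D : WI) : A = - C + (B + D) -> comp (inl b') C = 0 ->
      comp (inl b') (B + (D - A)) = 0.
    move=> -> C0; rewrite (_ : B + _ = C) //.
    by apply/ffunP => x; rewrite !fockE; ring.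
  have -> : phi_gamma (ds (v + v0) - g) = phi_gamma (ds (v + v0)) - phi_gamma g :> WI.
    by rewrite linearB.
  by rewrite -dwE; apply: compE dE _; rewrite comp_assemble.
move=> /eqP; rewrite subr_eq0 => /eqP du /eqP; rewrite subr_eq0 => /eqP dv.
(* Since ds u = 2 p, the coboundary of half of [phi_metric u] is minus the sum of the metric and
   wedge parts. *)
exists (v + v0), (u' - 2^-1 *: phi_metric u); split => //.
have half : dI (2^-1 *: phi_metric u) = - phi_metric p - phi_wedge u.
  rewrite linearZ /= dI_phi_metric du linearZ /= scalerBr scalerN !scalerA mulVf ?pnatr_eq0 //.
  by rewrite !scale1r.
have -> : phi_gamma (v + v0) = phi_gamma v + phi_gamma v0 :> WI by rewrite linearD.
have -> : dI (u' - 2^-1 *: phi_metric u) = dI u' - dI (2^-1 *: phi_metric u) by rewrite linearB.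
rewrite half wE x0E bE.
by apply/ffunP => x; rewrite !fockE; ring.
Qed.

(** All four families of invariants have positive weight, so the harmonic part of a weight-0 cocycle
    is 0. *)
Lemma weight0_acyclic f : p0 f = f -> dI f = 0 -> exists2 u, p0 u = u & f = dI u.
Proof.
move=> pf df; pose U : {vspace WI} := lker (linfun p0 - \1)%VF.
have UP g : reflect (p0 g = g) (g \in U).
  by rewrite memv_ker add_lfunE opp_lfunE id_lfunE lfunE subr_eq0; exact: eqP.
have [x0 [u [b [/UP x0U x00 /UP uU b0 fE]]]] : exists x0 u b, [/\ x0 \in U, Om x0 = 0,
    u \in U, b \in 0%VS & f = x0 + dI u + b].
  apply: (harmonic_repr (@act_anti R n) (h := @hom R n)) => //.
  - exact: homP.
  - exact: dI_sq.
  - by move=> g /UP gU; apply/UP; rewrite p0_dI gU.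
  - by move=> g /UP gU; apply/UP; rewrite p0_hom gU.
  - by move=> g; rewrite !memv0 => /eqP ->; rewrite linear0.
  - by move=> g; rewrite !memv0 => /eqP ->; rewrite linear0.
  - exact/UP.
  - by rewrite /= df memv0.
exists u => //; rewrite fE; move: b0; rewrite memv0 => /eqP ->.
have [p [q [s [v x0E]]]] := kernel_form n1 (casimir_ker (@act_anti R n) x00).
by rewrite -x0U x0E !linearD /= p0_metric p0_vol p0_wedge p0_gamma !addr0 add0r.
Qed.

End CompactCohomology.

(** * Relative cohomology of the compact form, degree by degree *)

Section CompactHR.
Variables (R : realFieldType) (n : nat).
Hypothesis n3 : (2 < n)%N.
Local Notation P := (pairT n).
Local Notation H := (basisH n).
Local Notation WI := {ffun {set H} * H -> R^o}.
Local Notation W1 := {ffun {set H} * unit -> R^o}.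
Local Notation Wso := {ffun {set P} * unit -> R^o}.
Local Notation c := (@ceuc R n).
Local Notation rkH := (@rkH n).
Local Notation rkP := (@rkP n).
Local Notation piW := (piW rkH).
Local Notation dI := (@dI R n).
Local Notation ds := (@ds R n).
Local Notation dt := (dW rkH c (@rho_triv R H)).

Lemma card_SPSV (S : {set H}) : #|S| = (#|SP S| + #|SV S|)%N.
Proof.
rewrite -{1}(join_SPSV S) cardsU (_ : _ :&: _ = set0) ?cards0 ?subn0.
  by rewrite !card_imset //; [exact: inr_inj|exact: inl_inj].
by apply/setP => x; rewrite !inE; apply/negP => /andP[/imsetP[a _ ->] /imsetP[]].
Qed.

Lemma emb_deg T j (f : Wso) : emb T (deg j f) = deg (j + #|T|)%N (emb T f).
Proof.
apply/ffunP => [[S []]]; rewrite !ffunE /=; case: eqP => [ST|_]; last by rewrite if_same.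
by rewrite card_SPSV ST eqn_add2r.
Qed.

Lemma comp_deg (D : finType) b k (f : {ffun {set H} * D -> R^o}) : comp b (deg k f) = deg k (comp b f).
Proof. by apply/ffunP => x; rewrite !ffunE. Qed.

Lemma p0_deg k (f : WI) : p0 (deg k f) = deg k (p0 f).
Proof.
apply/ffunP => x; rewrite !ffunE; case: (isV x.2); first by rewrite if_same.
by case: (SV x.1 == set0); rewrite ?if_same.
Qed.

(** The gamma family carries n - 2 of the dx^i; the guard covers the degrees in which the
    subtraction would truncate. *)
Lemma deg_gamma k (f : Wso) :
  deg k (phi_gamma f) = if (n <= k.+2)%N then phi_gamma (deg (k.+2 - n)%N f) else 0 :> WI.
Proof.
apply: compP => b; rewrite comp_deg comp_assemble.
have -> : deg k (match b with
  inl b => Nv R (val b).1 (Nv R (val b).2 (emb setT f)) | inr _ => 0 end) =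
  match b with
  inl b => Nv R (val b).1 (Nv R (val b).2 (deg k.+2 (emb setT f))) | inr _ => 0 end.
  by case: b => b; rewrite ?linear0 // /Nv /= -!an_deg.
have -> : deg k.+2 (emb setT f) = if (n <= k.+2)%N then emb setT (deg (k.+2 - n)%N f) else 0.
  case: ifP => nk; first by rewrite emb_deg cardsT card_ord subnK.
  apply/ffunP => [[S []]]; rewrite !ffunE /=; case: eqP => // Sk; case: eqP => // ST.
  by move: nk; rewrite -Sk card_SPSV ST cardsT card_ord leq_addl.
case: ifP => _; first by rewrite comp_assemble.
by rewrite linear0; case: b => // b; rewrite !linear0.
Qed.

(** In positive weight, [pos_reduce] with a0 = 0 and then [gamma_lift] with g = 0 leave only the
    gamma family. *)
Lemma weight_split x y : dI x = piW y ->
  exists v u z, ds v = 0 /\ x - p0 x = phi_gamma v + dI u + piW z.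
Proof.
move=> dx.
have [||||w [u [z [wT dw xE]]]] := @pos_reduce _ _ n3 (x - p0 x) 0 (y - r0 y).
- by rewrite linearB /= p0K subrr.
- by rewrite add0r !linearB /= dx -p0_dI dx p0_piW.
- exact: mem0v.
- by rewrite linearB /= r0K subrr.
have [v [u' [dv wE]]] : exists v u', ds v = 0 /\ w = phi_gamma v + dI u'.
  by apply: (gamma_lift n3) => //; rewrite linear0.
exists v, (u + u'), z; split => //.
rewrite xE wE linearD /=; congr (_ + _); by rewrite addrC -addrA [dI u' + _]addrC.
Qed.

(** The weight-0 parts of [u] and [y] cancel since the gamma family has positive weight;
    [pos_reduce] then absorbs pi_R^*, and [gamma_lift] yields the primitive. *)
Lemma gamma_exact f u y : phi_gamma f = dI u + piW y -> exists g, f = ds g.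
Proof.
move=> fE.
have [||||w [u' [z [wT dw _]]]] := @pos_reduce _ _ n3 (u - p0 u) (phi_gamma f) (- (y - r0 y)).
- by rewrite linearB /= p0K subrr.
- have := congr1 (@p0 R n) fE; rewrite (p0_gamma n3) linearD /= p0_dI p0_piW => p0E.
  rewrite linearN !linearB /= fE.
  have e : dI (p0 u) = - piW (r0 y) by apply/eqP; rewrite -addr_eq0 -p0E.
  by rewrite e; apply/ffunP => t; rewrite !fockE; ring.
- exact: VA_gamma.
- by rewrite linearN linearB /= r0K subrr oppr0.
by have [v [_ [<- _]]] := gamma_lift n3 wT dw; exists v.
Qed.

(** Inherited from [dI_sq] through the injective gamma family, which intertwines the
    differentials. *)
Lemma ds_sq f : ds (ds f) = 0.
Proof.
have [] // := @wedge_gamma_indep R n n3 0 (ds (ds f)).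
by move=> b; rewrite -!dI_phi_gamma dI_sq !(linear0, addr0).
Qed.

(** Inflation from so(n) followed by pi_R^*. *)
Definition piE (f : Wso) : WI := piW (emb set0 f).
HB.instance Definition _ := GRing.Linear.copy piE (piW \o @emb R n set0).

Lemma dI_piE f : dI (piE f) = - piE (ds f).
Proof. by rewrite /piE dI_piW // dt_emb0. Qed.

Lemma piE_deg k f : piE (deg k.+1 f) = deg k (piE f).
Proof. by rewrite /piE emb_deg cards0 addn0 piW_deg. Qed.

Lemma p0_piE f : p0 (piE f) = piE f.
Proof. by rewrite /piE p0_piW r0_emb0. Qed.

Lemma piE_inj k f : deg k.+1 f = f -> piE f = 0 -> f = 0.
Proof.
move=> df pf; have e0 : emb set0 f = 0 :> W1.
  apply: (piW_inj pf); rewrite ffunE /=; case: eqP => // _; rewrite -df ffunE /=.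
  case: eqP => // /eqP; rewrite (_ : SP set0 = set0) ?cards0 //.
  by apply/setP => a; rewrite !inE.
rewrite -[f](resK set0) e0.
by apply/ffunP => x; rewrite !ffunE.
Qed.

Definition so_cocycles k := (lker (dl rkP (@cso R n) (@rho_triv R P)) :&: @homog R _ unit k)%VS.
Definition so_boundaries k := (limg (dl rkP (@cso R n) (@rho_triv R P)) :&: @homog R _ unit k)%VS.

Lemma so_cocyclesP k f : reflect (ds f = 0 /\ deg k f = f) (f \in so_cocycles k).
Proof.
rewrite memv_cap memv_ker lfunE.
apply: (iffP andP) => [[/eqP e /homogP d]|[e d]]; first by [].
by split; [exact/eqP|exact/homogP].
Qed.

Lemma so_boundariesP k f :
  reflect ((exists g, f = ds g) /\ deg k f = f) (f \in so_boundaries k).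
Proof.
rewrite memv_cap; apply: (iffP andP) => [[/memv_imgP[g _ ->] /homogP h]|[[g fE] h]].
  by split=> //; exists g; rewrite lfunE.
split; last exact/homogP.
by apply/memv_imgP; exists g; rewrite ?memvf // lfunE.
Qed.

Lemma so_boundaries_sub k : (so_boundaries k <= so_cocycles k)%VS.
Proof.
apply/subvP => f /so_boundariesP[[g fE] df]; apply/so_cocyclesP; split=> //.
by rewrite fE ds_sq.
Qed.

Lemma dim_piE k (X : {vspace Wso}) : (forall f, f \in X -> deg k.+1 f = f) ->
  \dim (linfun piE @: X) = \dim X.
Proof.
move=> Xdeg; apply: limg_dim_eq; apply/eqP; rewrite -subv0; apply/subvP => f.
rewrite memv_cap memv_ker lfunE memv0 => /andP[fX /eqP pf].
by apply/eqP; apply: (piE_inj (Xdeg f fX)).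
Qed.

Section Degree.
Variable m : nat.

(** The connecting map: if dI x = piW y then [phi1 x] is [piW (r0 y)], which encodes an
    so(n)-cocycle of degree m + 3. *)
Let phi1 : WI -> WI := fun f => dI (p0 f).
HB.instance Definition _ := GRing.Linear.copy phi1 (dI \o @p0 R n).

Definition HR_cocycles := ((dl rkH c (rho_coad c) @^-1: limg (pil R rkH)) :&: @homog R _ H m.+1)%VS.
Definition HR_boundaries := ((limg (dl rkH c (rho_coad c)) + limg (pil R rkH)) :&: @homog R _ H m.+1)%VS.
(** The cocycles whose class in H^{m+3}(so(n)) vanishes. Cocycles modulo these give H^{m+3}, and
    these modulo boundaries the gamma part. *)
Definition HR_middle := (HR_cocycles :&:
  linfun phi1 @^-1: (linfun piE @: so_boundaries m.+3))%VS.

Lemma HR_cocyclesP x : reflect (deg m.+1 x = x /\ exists y, dI x = piW y) (x \in HR_cocycles).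
Proof.
rewrite memv_cap -memv_preim lfunE; apply: (iffP andP) => [[/memv_imgP[y _ e] /homogP dx]|[dx [y e]]].
  by split=> //; exists y; rewrite e lfunE.
split; last exact/homogP.
by apply/memv_imgP; exists y; rewrite ?memvf // lfunE.
Qed.

Lemma HR_boundariesP x :
  reflect (deg m.+1 x = x /\ exists u y, x = dI u + piW y) (x \in HR_boundaries).
Proof.
rewrite memv_cap; apply: (iffP andP) => [[/memv_addP[_ /memv_imgP[u _ ->] [_ /memv_imgP[y _ ->] ->]] /homogP dx]|].
  by split=> //; exists u, y; rewrite !lfunE.
move=> [dx [u [y xE]]]; split; last exact/homogP.
rewrite xE; apply: memv_add; apply/memv_imgP; [exists u|exists y]; by rewrite ?memvf ?lfunE.
Qed.

Lemma HR_middleP x : reflect (x \in HR_cocycles /\ exists2 f, f \in so_boundaries m.+3 & phi1 x = piE f)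
  (x \in HR_middle).
Proof.
rewrite [x \in HR_middle]memv_cap -[X in _ && X]memv_preim lfunE.
apply: (iffP andP) => -[xZ].
  by move=> /memv_imgP[f fB e]; split=> //; exists f => //; rewrite [LHS]e lfunE.
by move=> [f fB e]; split=> //; apply/memv_imgP; exists f => //; rewrite [RHS]lfunE.
Qed.

Lemma phi1_deg k x : deg k.+1 (phi1 x) = phi1 (deg k x).
Proof. by rewrite /phi1 p0_deg; symmetry; exact: dW_deg. Qed.

Lemma HR_boundaries_middle x : x \in HR_boundaries -> x \in HR_middle.
Proof.
move=> /HR_boundariesP[dx [u [y xE]]]; apply/HR_middleP; split.
  apply/HR_cocyclesP; split=> //; exists (- dt y).
  by rewrite xE linearD /= dI_sq add0r dI_piW // linearN.
exists (ds (deg m.+2 (- res set0 y))).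
  apply/so_boundariesP; split; first by exists (deg m.+2 (- res set0 y)).
  by rewrite /ds -dW_deg deg_id.
rewrite -dx -phi1_deg /ds dW_deg piE_deg -/(ds (- res set0 y)); congr (deg _ _).
rewrite /phi1 -p0_dI xE linearD /= dI_sq add0r dI_piW // linearN /= p0_piW r0_dt r0_emb dt_emb0.
by rewrite [ds (- _)]linearN [piE (- _)]linearN.
Qed.

Lemma ds_deg k f : ds (deg k f) = deg k.+1 (ds f).
Proof. exact: dW_deg. Qed.

(** Surjectivity of the connecting map is acyclicity in weight 0: for a cocycle [f], the cocycle
    [piE f] has weight 0, and a primitive of it is the required relative cocycle. *)
Lemma dim_HR_cocycles : (\dim HR_cocycles + \dim (so_boundaries m.+3) =
  \dim (so_cocycles m.+3) + \dim HR_middle)%N.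
Proof.
rewrite -(@dim_piE m.+2 (so_boundaries m.+3)); last by move=> f /so_boundariesP[].
rewrite -(@dim_piE m.+2 (so_cocycles m.+3)); last by move=> f /so_cocyclesP[].
have img (f : Wso) (X : {vspace Wso}) : f \in X -> piE f \in (linfun piE @: X)%VS.
  by move=> fX; rewrite -(lfunE piE); apply: memv_img.
apply: (@dim_quot _ _ _ (phi1 : {linear WI -> WI})).
- exact/limgS/so_boundaries_sub.
- move=> x /HR_cocyclesP[dx [y e]].
  have e1 : phi1 x = piE (res set0 y) by rewrite /phi1 -p0_dI e p0_piW r0_emb.
  pose f := deg m.+3 (res set0 y).
  have fE : phi1 x = piE f by rewrite /f piE_deg -e1 phi1_deg dx.
  rewrite /= fE; apply: img; apply/so_cocyclesP; split; last by rewrite deg_id.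
  apply: (@piE_inj m.+3); first by rewrite /f ds_deg deg_id.
  by rewrite -[piE _]opprK -dI_piE -fE dI_sq oppr0.
- by move=> x /HR_middleP[].
- move=> x xZ; rewrite /=; apply/memv_imgP/HR_middleP => [[f fB e]|[_ [f fB e]]].
    by split=> //; exists f => //; rewrite e lfunE.
  by exists f => //; rewrite e lfunE.
- move=> _ /memv_imgP[f /so_cocyclesP[df degf] ->]; rewrite lfunE /=.
  have [||u pu fE] := @weight0_acyclic R n n3 (piE f).
  + exact: p0_piE.
  + by rewrite dI_piE df linear0 oppr0.
  have duE : dI (deg m.+1 u) = piE f.
    by rewrite -[LHS]/(dW _ _ _ (deg _ _)) dW_deg -[dW _ _ _ u]/(dI u) -fE -piE_deg degf.
  exists (deg m.+1 u); last by rewrite /phi1 p0_deg pu duE subrr mem0v.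
  by apply/HR_cocyclesP; split; [rewrite deg_id|exists (emb set0 f)].
Qed.

(** If phi1 x = piE (ds z) then p0 x + piE z is a weight-0 cocycle, hence exact; [weight_split]
    treats the rest of [x]. *)
Lemma HR_middle_repr x : x \in HR_middle ->
  exists v, ds v = 0 /\ x - deg m.+1 (phi_gamma v) \in HR_boundaries.
Proof.
move=> /HR_middleP[/HR_cocyclesP[dx [y e]] [f /so_boundariesP[[z fE] _] p1E]].
have [||u pu uE] := @weight0_acyclic R n n3 (p0 x + piE z).
- by rewrite linearD /= p0K p0_piE.
- by rewrite linearD /= -[dI (p0 x)]/(phi1 x) p1E fE dI_piE subrr.
have [v [u' [z' [dv xE]]]] := weight_split e.
exists v; split=> //; apply/HR_boundariesP; split; first by rewrite linearB /= deg_id dx.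
exists (deg m (u + u')), (deg m.+2 (z' - emb set0 z)).
rewrite -[dI (deg _ _)]/(dW _ _ _ (deg _ _)) dW_deg piW_deg -linearD -[in LHS]dx -linearB /=.
congr (deg _ _); rewrite -[dW _ _ _ _]/(dI _) linearD linearB /= -/(piE z) -uE.
have xE' : x = phi_gamma v + dI u' + piW z' + p0 x by rewrite -xE subrK.
by rewrite {1}xE'; apply/ffunP => t; rewrite !fockE; ring.
Qed.

(** A gamma cochain of degree m + 1 has n - 2 vector legs, which leaves m + 3 - n legs in so(n).
    Injectivity is [gamma_exact], surjectivity [HR_middle_repr]. *)
Lemma dim_HR_middle : (n <= m.+3)%N ->
  (\dim (so_cocycles (m.+3 - n)) + \dim HR_boundaries =
   \dim HR_middle + \dim (so_boundaries (m.+3 - n)))%N.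
Proof.
move=> nm; set j := (m.+3 - n)%N.
have degG f : deg j f = f -> deg m.+1 (phi_gamma f) = phi_gamma f :> WI.
  by move=> df; rewrite deg_gamma nm df.
apply: (@dim_quot _ _ _ (@phi_gamma R n : {linear Wso -> WI})).
- by apply/subvP => x; apply: HR_boundaries_middle.
- move=> f /so_cocyclesP[df degf]; apply/HR_middleP; split.
    apply/HR_cocyclesP; split; first exact: degG.
    by exists 0; rewrite /= dI_phi_gamma df !linear0.
  exists 0; first exact: mem0v.
  by rewrite /phi1 /= (p0_gamma n3) !linear0.
- by move=> f; apply/subvP/so_boundaries_sub.
- move=> f /so_cocyclesP[df degf]; apply/HR_boundariesP/so_boundariesP.
    move=> [_ [u [y fE]]]; split=> //; exact: (gamma_exact fE).
  move=> [[g fE] _]; split; first exact: degG.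
  by exists (phi_gamma g), 0; rewrite linear0 addr0 /= fE dI_phi_gamma.
- move=> x /[dup] xM /HR_middle_repr[v [dv xB]]; exists (deg j v).
    by apply/so_cocyclesP; rewrite ds_deg dv linear0 deg_id.
  by move: xB; rewrite deg_gamma nm.
Qed.

Lemma HR_middle_small : (m.+3 < n)%N -> HR_middle = HR_boundaries.
Proof.
move=> mn; apply/vspaceP => x; apply/idP/idP; last exact: HR_boundaries_middle.
by move=> /HR_middle_repr[v [_]]; rewrite deg_gamma leqNgt mn subr0.
Qed.

Lemma fock_HRdim_compact : fock_HRdim rkH c m =
  (fock_cohdim rkP (@cso R n) (@rho_triv R P) m.+3 +
   if (n <= m.+3)%N then fock_cohdim rkP (@cso R n) (@rho_triv R P) (m.+3 - n) else 0)%N.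
Proof.
have h k := dimvS (so_boundaries_sub k).
have B1 := h m.+3; have B2 := h (m.+3 - n)%N.
have e1 := dim_HR_cocycles.
rewrite /fock_HRdim /fock_cohdim -/HR_cocycles -/HR_boundaries.
rewrite -/(so_cocycles m.+3) -/(so_boundaries m.+3).
rewrite -/(so_cocycles (m.+3 - n)%N) -/(so_boundaries (m.+3 - n)%N).
case: leqP => nm; first by have e2 := dim_HR_middle nm; lia.
by move: e1; rewrite (HR_middle_small nm); lia.
Qed.

End Degree.

End CompactHR.

(** * The class of gamma *)

Section GammaClass.
Variables (R : realType) (p q : nat).
Local Notation n := (p + q)%N.
Hypothesis n4 : (4 <= n)%N.
Local Notation c := (@c_h R p q).

Lemma c_h_anti a b e : c a b e = - c b a e.
Proof. by rewrite !c_hE ceuc_anti mulrN andbC. Qed.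

Lemma dco_commuting k x (t : {ffun 'I_k.+1 -> basisH n}) b :
  (forall i e, c (t i) b e = 0) -> (forall i j e, c (t i) (t j) e = 0) ->
  dco c k x (t, b) = 0.
Proof.
move=> tb tt; rewrite /dco dCEE ffunE /= big1 ?add0r => [|i _]; last first.
  by rewrite big1 ?mulr0 // => d _; rewrite /rho_coad tb oppr0 mul0r.
rewrite big1 // => i _; rewrite big1 // => j _.
by rewrite big1 ?mulr0 // => e _; rewrite tt mul0r.
Qed.

(** Exchanging the coefficient with the first argument transposes two arguments of the alternating
    form [y]. *)
Lemma pistar_swap k (y : cochain R (basisH n) unit k.+2) (t : {ffun 'I_k.+1 -> basisH n}) b :
  y \in alt R (basisH n) unit k.+2 ->
  pistar R (basisH n) k.+1 y ([ffun s => if s == ord0 then b else t s], t ord0) =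
  - pistar R (basisH n) k.+1 y (t, b).
Proof.
move=> /altP yalt; rewrite pistarE !ffunE /=.
set u := [ffun r => _]; set v := [ffun r => _].
have -> : u = [ffun r => v (tperm ord0 (lift ord0 ord0) r)].
  apply/ffunP => r; rewrite !ffunE; case: tpermP => [->|->|].
  - by rewrite unlift_none liftK.
  - by rewrite unlift_none liftK ffunE eqxx.
  case: (unliftP ord0 r) => [r' ->|->] // _ r'1; rewrite ffunE ifN //.
  by apply: contra_not_neq r'1 => ->.
by rewrite yalt odd_tperm neq_lift expr1 mulN1r.
Qed.

Let k0 := (n - 3)%N.
Let i0 : 'I_n := Ordinal (leq_trans (isT : (0 < 4)%N) n4).
Let i1 : 'I_n := Ordinal (leq_trans (isT : (1 < 4)%N) n4).
Let pr01 : pairT n := @ordpair n i0 i1 isT.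
Let others := [seq l <- enum 'I_n | (l != i0) && (l != i1)].

Lemma size_others : size others = k0.+1.
Proof.
have -> : size others = #|~: [set i0; i1]|.
  rewrite cardE; apply/perm_size/uniq_perm => [||l].
  - exact/filter_uniq/enum_uniq.
  - exact: enum_uniq.
  by rewrite mem_filter !mem_enum !inE negb_or andbT.
by have := cardsC [set i0; i1]; have := n4; rewrite cards2 card_ord /k0 /=; lia.
Qed.

Lemma gamma_coef_neq0 (pr : pairT n) : gamma_coef R pr != 0.
Proof.
by rewrite /gamma_coef; case: ifP => _; last case: ifP => _; rewrite ?oppr_eq0 signr_eq0.
Qed.

(* Evaluate at the tuple d_3, ..., d_n with coefficient alpha_12, and again with
   d_3 and alpha_12 exchanged: all arguments commute, so coboundaries vanish and
   elements of Pim change sign, whereas gamma is nonzero only at the first one. *)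
Lemma gamma_notin_boundaries : gamma_star R p q \notin CRbnd c k0.
Proof.
apply/negP => /memv_addP[_ /memv_imgP[x _ ->] [_ /memv_imgP[y yalt ->] gE]].
pose t : {ffun 'I_k0.+1 -> basisH n} := [ffun s : 'I_k0.+1 => inr (nth i0 others s)].
pose b : basisH n := inl pr01.
pose t' : {ffun 'I_k0.+1 -> basisH n} := [ffun s => if s == ord0 then b else t s].
have tE s : t s = inr (nth i0 others s) by rewrite ffunE.
have tO (s : 'I_k0.+1) : (nth i0 others s != i0) && (nth i0 others s != i1).
  have : nth i0 others s \in others by apply: mem_nth; rewrite size_others.
  by rewrite mem_filter => /andP[].
have cVP s e : c (t s) b e = 0.
  rewrite c_hE tE; case: e => [e|l]; rewrite /= ?mulr0 //.
  have /andP[/negPf s0 /negPf s1] := tO s.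
  by rewrite so_mxE /= s0 s1 !andbF subrr mulr0.
have cVV s s' e : c (t s) (t s') e = 0 by rewrite c_hE !tE mulr0.
have cPV s e : c b (t s) e = 0 by rewrite c_h_anti cVP oppr0.
have cPP e : c b b e = 0 by apply/eqP; rewrite -eqNr -c_h_anti.
have g1 : gamma_star R p q (t, b) = - gamma_star R p q (t', t ord0).
  have t'E s : t' s = if s == ord0 then b else t s by rewrite ffunE.
  have cP's s e : c (t' s) (t ord0) e = 0 by rewrite t'E; case: ifP.
  have cPs s e : c (t s) b e = 0 by exact: cVP.
  have cPP' s s' e : c (t' s) (t' s') e = 0.
    by rewrite !t'E; case: ifP => _; case: ifP => _.
  by rewrite gE !fockE (dco_commuting _ cPs cVV) (dco_commuting _ cP's cPP')
     !add0r pistar_swap ?opprK.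
have g2 : gamma_star R p q (t', t ord0) = 0.
  by rewrite ffunE big1 // => pr _; rewrite /= tE mulr0 mul0r.
have omega1 : omega R pr01 t = 1.
  rewrite /omega -[RHS](det1 _ k0.+1); congr (\det _); apply/matrixP => r s; rewrite !mxE tE.
  rewrite -/others (inj_eq (@inr_inj _ _)) nth_uniq ?size_others //; last first.
    exact/filter_uniq/enum_uniq.
  by rewrite -[r == s]val_eqE /= [in RHS]eq_sym; case: eqP.
move: g1; rewrite g2 oppr0 ffunE (bigD1 pr01) //;
  rewrite [(_, _).1]/= [(_, _).2]/=;
  rewrite eqxx mulr1 omega1 mulr1 big1.
  by rewrite [X in X = _ -> _]addr0; apply/eqP/gamma_coef_neq0.
move=> pr /negPf ne; rewrite (_ : (b == inl pr) = false) ?mulr0 ?mul0r //.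
by rewrite -[RHS]ne eq_sym.
Qed.

Lemma HRclass_gamma : HRclass_span_dim c (gamma_star R p q) = 1%N.
Proof.
rewrite /HRclass_span_dim dimv_disjoint_sum; last first.
  apply/eqP; rewrite -subv0; apply/subvP => x; rewrite memv_cap memv0 => /andP[/vlineP[a ->]].
  apply: contraTT; rewrite scaler_eq0 negb_or => /andP[a0 _].
  by rewrite rpredZeq (negPf a0) /= gamma_notin_boundaries.
rewrite addnK dim_vline; case: eqP => // g0.
by have := gamma_notin_boundaries; rewrite g0 mem0v.
Qed.

End GammaClass.

(** * Return to so(p,q) and h_{p,q} *)

Lemma Hdim_so (R : realType) (p q k : nat) :
  Hdim (@c_so R p q) (@rho_triv R _) k =
  fock_cohdim (@rkP (p + q)) (@cso R (p + q)) (@rho_triv R _) k.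
Proof.
apply: (@Hdim_transfer _ _ _ (@rkP_inj _) (fun a => parity (inl a)) _ (fun _ => false)).
- move=> a b e; exact: ceuc_graded.
- move=> a b e; exact: c_hE.
- by move=> a d e; rewrite eqxx.
- by move=> a d e; rewrite mulr0.
- by move=> a b e; exact: c_h_anti.
Qed.

Theorem theorem6p4 (R : realType) (p q : nat) (m : nat) :
  (4 <= p + q)%N ->
  HRdim (@c_h R p q) m =
    (betti (@c_so R p q) (m + 3)%:Z
     + betti (@c_so R p q) ((m + 3)%:Z - (p + q)%:Z)
       * @HRclass_span_dim R _ (@c_h R p q) (p + q - 3) (gamma_star R p q))%N.
Proof.
move=> n4; rewrite HRclass_gamma // muln1.
rewrite (@HRdim_transfer _ _ _ (@rkH_inj _) (@parity p q) _ _
  (@ceuc_graded R p q) (@c_hE R p q) (@c_h_anti R p q)).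
rewrite fock_HRdim_compact ?(leq_trans _ n4) // addn3 /= Hdim_so; congr (_ + _)%N.
case: leqP => nm.
  by rewrite subzn //= Hdim_so.
(* For m + 3 < n the degree is a negative integer, where [betti] is 0. *)
have [k ->] : exists k, (m.+3%:Z - (p + q)%:Z)%R = Negz k.
  by exists ((p + q) - m.+3).-1%N; rewrite NegzE prednK ?subn_gt0 // -subzn ?opprB // ltnW.
by [].
Qed.
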